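(* Define $r^*(2)=2$, $r^*(d)=3$ for $3\le d\le 7$, and $r^*(d)=\lceil (d-1)/2\rceil$ for $d\ge 8$. Let $d\ge 2$ be an integer, and let $r\in\mathbb{N}$ with $r\ge r^*(d)$. Then, with probability tending to $1$ as $n\to\infty$, $$|\mathrm{Aut}(G_n(\mathbb{L}^d,r))|\ge\exp\bigl(\Omega(n^{1/6}\log n)\bigr),$$ i.e. there is an absolute constant $c>0$ such that $\Pr\left[|\mathrm{Aut}(G_n(\mathbb{L}^d,r))|\ge\exp(c\,n^{1/6}\log n)\right]\to 1$ as $n\to\infty$.
   Context: Graphs are simple and undirected, and need not be connected. An unlabelled graph is an isomorphism class of graphs. $\mathrm{Aut}(G)$ is the group of graph automorphisms of $G$. $\mathbb{L}^d$ is the graph with vertex-set $\mathbb{Z}^d$ and edge-set $\{\{x,x+e_i\}: x\in\mathbb{Z}^d, 1\le i\le d\}$, where $e_i$ is the $i$th standard unit vector. For a graph $G$, a vertex $v$ and $r\in\mathbb{N}$, $\mathrm{Link}_r(v,G)$ denotes the subgraph of $G$ induced by the set of vertices at graph distance at most $r$ from $v$. If $F$ is a vertex-transitive graph and $u\in V(F)$, a graph $G$ is $r$-locally $F$ if for every $v\in V(G)$ there is a graph isomorphism $\phi:\mathrm{Link}_r(u,F)\to\mathrm{Link}_r(v,G)$ with $\phi(u)=v$ (independent of the choice of $u$). $G_n(F,r)$ denotes a graph chosen uniformly at random from the set of all unlabelled $n$-vertex graphs that are $r$-locally $F$; for $F=\mathbb{L}^d$ this set is nonempty for all sufficiently large $n$.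 *)

(* Defs.v *)
From HB Require Import structures.
From mathcomp Require Import all_boot all_order all_fingroup all_algebra.
From mathcomp Require Import all_classical all_reals all_analysis.

Set Implicit Arguments.
Unset Strict Implicit.
Unset Printing Implicit Defensive.

Import Order.TTheory GRing.Theory Num.Theory.
Import numFieldNormedType.Exports.

Local Open Scope classical_set_scope.
Local Open Scope ring_scope.

(* Graphs are given by their adjacency relation, symmetric and irreflexive. *)
Definition simple_graph (V : Type) (e : rel V) : Prop :=
  symmetric e /\ irreflexive e.

Definition lattice (d : nat) : rel 'rV[int]_d :=
  fun x y => [exists i : 'I_d,
    (y == x + delta_mx 0 i) || (x == y + delta_mx 0 i)].

Lemma lattice_simple (d : nat) : simple_graph (@lattice d).
Proof.
split=> [x y|x].
  by apply/existsP/existsP=> -[i]; rewrite orbC => xy; exists i.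
apply/existsP=> -[i]; rewrite orbb => /eqP/matrixP/(_ 0 i)/eqP.
by rewrite !mxE !eqxx /= -[eqbLHS]addr0 (inj_eq (addrI _)).
Qed.

(* The vertices joined to v by a walk of at most r edges. *)
Definition link_vertices (V : Type) (e : rel V) (r : nat) (v : V) : set V :=
  [set w | exists p : seq V, [/\ path e v p, last v p = w & (size p <= r)%N]].

(* Isomorphism of Link_r(u, e) onto Link_r(v, e') mapping u to v; both are
   induced subgraphs, and the values of phi outside the first one are
   irrelevant. *)
Definition link_iso (V W : Type) (e : rel V) (e' : rel W) (r : nat)
    (u : V) (v : W) (phi : V -> W) : Prop :=
  [/\ set_bij (link_vertices e r u) (link_vertices e' r v) phi,
      (forall x y, link_vertices e r u x -> link_vertices e r u y ->
         e' (phi x) (phi y) = e x y)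
    & phi u = v].

(* r-locally F, read off at the base vertex u of the graph F; for
   vertex-transitive F the choice of u is immaterial. *)
Definition r_locally (V W : Type) (F : rel V) (u : V) (r : nat) (G : rel W) :
    Prop :=
  forall v : W, exists phi : V -> W, link_iso F G r u v phi.

(* Labelled simple graphs on 'I_n, as adjacency matrices. *)
Definition lgraph (n : nat) : finType :=
  {A : 'M[bool]_n | [forall i, ~~ A i i] && (A^T == A)}.

Definition ladj (n : nat) (G : lgraph n) : rel 'I_n := fun x y => val G x y.

Lemma ladj_simple (n : nat) (G : lgraph n) : simple_graph (ladj G).
Proof.
have /andP[/forallP irrG /eqP symG] := valP G; split=> [x y|x].
  by rewrite /ladj -[in LHS]symG mxE.
exact/negbTE/irrG.
Qed.

Definition is_isom (n : nat) (G H : lgraph n) (s : {perm 'I_n}) : bool :=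
  [forall x, forall y, ladj H (s x) (s y) == ladj G x y].

Lemma is_isomP (n : nat) (G H : lgraph n) (s : {perm 'I_n}) :
  reflect (forall x y, ladj H (s x) (s y) = ladj G x y) (is_isom G H s).
Proof.
apply: (iffP forallP) => GH x; last by apply/forallP=> y; apply/eqP.
by move=> y; apply/eqP; move/forallP: (GH x); apply.
Qed.

Definition isomorphic (n : nat) : rel (lgraph n) :=
  fun G H => [exists s : {perm 'I_n}, is_isom G H s].

Lemma isomorphic_equiv (n : nat) : equivalence_rel (@isomorphic n).
Proof.
apply/equivalence_relP; split=> [G|G H /existsP[s /is_isomP sGH] K].
  by apply/existsP; exists 1%g; apply/is_isomP=> x y; rewrite !perm1.
apply/existsP/existsP => -[t /is_isomP tK].
  exists (s^-1 * t)%g; apply/is_isomP=> x y.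
  by rewrite !permM tK -sGH !permKV.
by exists (s * t)%g; apply/is_isomP=> x y; rewrite !permM tK sGH.
Qed.

Definition graph_aut (n : nat) (G : lgraph n) : {set {perm 'I_n}} :=
  [set s | is_isom G G s]%SET.

Lemma graph_aut_group_set (n : nat) (G : lgraph n) : group_set (graph_aut G).
Proof.
apply/group_setP; split=> [|s t].
  by rewrite inE; apply/is_isomP=> x y; rewrite !perm1.
rewrite !inE => /is_isomP sG /is_isomP tG.
by apply/is_isomP=> x y; rewrite !permM tG sG.
Qed.

Canonical graph_aut_group (n : nat) (G : lgraph n) : {group {perm 'I_n}} :=
  Group (graph_aut_group_set G).

(* Unlabelled n-vertex graphs, i.e. isomorphism classes of labelled ones. *)
Definition unlabelled (n : nat) : {set {set lgraph n}} :=
  equivalence_partition (@isomorphic n) [set: lgraph n]%SET.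

(* The sample space of G_n(F, r). *)
Definition unlabelled_r_locally (V : Type) (F : rel V) (u : V) (r n : nat) :
    {set {set lgraph n}} :=
  [set C in unlabelled n |
     [forall G in C, `[< r_locally F u r (ladj G) >]]]%SET.

(* Probability that a uniform random element of S satisfies E (0 if S is
   empty). *)
Definition unif_prob (R : realType) (T : finType) (S : {set T}) (E : pred T) :
    R :=
  #|[set x in S | E x]%SET|%:R / #|S|%:R.

(* Pr[ t <= |Aut(G_n(F, r))| ]; all members of an isomorphism class have the
   same number of automorphisms. *)
Definition prob_aut_ge (R : realType) (V : Type) (F : rel V) (u : V)
    (r n : nat) (t : R) : R :=
  unif_prob R (unlabelled_r_locally F u r n)
    (fun C => [forall G in C, t <= #|graph_aut G|%:R]).

Definition rstar (d : nat) : nat :=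
  (if d == 2 then 2 else if d <= 7 then 3 else uphalf (d - 1))%N.

(* Main.v *)
Require Import Defs.
From HB Require Import structures.
From mathcomp Require Import all_boot all_order all_fingroup all_algebra.
From mathcomp Require Import all_classical all_reals all_analysis.
From mathcomp Require Import zify ring lra.

Set Implicit Arguments.
Unset Strict Implicit.
Unset Printing Implicit Defensive.

Import Order.TTheory GRing.Theory Num.Theory.
Import numFieldNormedType.Exports.

Local Open Scope classical_set_scope.
Local Open Scope ring_scope.

(* Call p : Z^d -> V(G) a cover if it maps the neighbours of every point onto
   the neighbours of its image and identifies no two points at distance at most
   2r+1.  For r >= 3 (or d = 2 and r >= 2) parallel transport of frames of
   neighbours around the squares of an r-locally L^d graph is flat, so every
   component has a cover and is Z^d modulo a discrete group of affine signed
   permutations; since r >= r*(d) gives d <= 2r+1, this group is torsion free.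

   Components whose group consists of translations have a shift automorphism,
   so a graph with few automorphisms has few of them.  For the other components
   some signed permutation b <> 1 preserves the lattice of translations, and
   with S the sum of the powers of b, torsion-freeness gives S <> 0.  Up to
   bounded index the lattice is then determined by two lattices of rank d-1
   (inside the kernels of S and of ord(b) - S), so there are only about x^(d-1)
   such components of size at most x, against about x^d circulant graphs.
   Splitting components at size n^(1/d), there are exp(n^((d-1)/d+o(1))) graphs
   with few translation components, whereas unions of distinct circulant graphs
   already provide exp(c n^(d/(d+1))) graphs. *)

(** * Directions and signed permutations *)

(** All estimates are made in terms of M with n of order M^(d(d+1)), which keeps exponents integral.
    Components are split at size y = M^(d+1); then y^(d-1), the number of possible small twisted
    components up to logarithms, and n / y, the number of large components, both have order
    M^(d^2-1). Circulant graphs of size about M^d give 2^(c M^(d^2)) classes. A single factor M thus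
    has to beat powers of log M, so logarithms may be wasted in the counts but no power of x may be.
    This is why pivots of Hermite forms are counted through their product, while everything else
    about a component (point group, cosets, the gluing of the two lattices of rank d-1) is confined
    to data whose size is bounded in terms of d.

    A typical graph then has at least M^(d^2-1) components with a shift, a number of order
    n^((d-1)/d). This exceeds n^(1/6) log n for every d >= 2, and the constant c = 1 serves all d
    and r.

    Isomorphism classes are recovered from covers: the translation parts of the deck group determine
    the fibres of a cover, hence its component, and the base point may be moved freely. *)

Notation dir d := ('I_d * bool)%type.

Definition uvec d (s : dir d) : 'rV[int]_d := (-1) ^+ s.2 *: delta_mx 0 s.1.
Definition oppd d (s : dir d) : dir d := (s.1, ~~ s.2).
Definition nrm d (z : 'rV[int]_d) : nat := (\sum_i `|z 0%R i|)%N.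

Section Directions.
Variable d : nat.
Implicit Types (s t u : dir d) (z y : 'rV[int]_d).

Lemma oppdK : involutive (@oppd d).
Proof. by case=> i b; rewrite /oppd /= negbK. Qed.

Lemma oppd_neq s : (oppd s == s) = false.
Proof. by case: s => i []; rewrite xpair_eqE eqxx. Qed.

Lemma uvec_opp s : uvec (oppd s) = - uvec s.
Proof. by case: s => i [] /=; rewrite /uvec /= ?expr0 ?expr1 ?scaleN1r ?scale1r ?opprK. Qed.

Lemma uvecE s i : uvec s 0 i = (-1) ^+ s.2 * (i == s.1)%:R.
Proof. by rewrite !mxE /=. Qed.

Lemma uvec_dot s t :
  (-1) ^+ s.2 * uvec t 0 s.1 = (t == s)%:R - (t == oppd s)%:R.
Proof.
rewrite uvecE; case: s t => [i b] [j c] /=; rewrite !xpair_eqE (eq_sym i j).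
by case: (j == i); case: b; case: c.
Qed.

Lemma uvec_inj : injective (@uvec d).
Proof.
move=> s t st; have := uvec_dot s t; rewrite -st uvec_dot eqxx.
rewrite [s == oppd s]eq_sym oppd_neq; case: eqP => [->//|_].
by case: (t == oppd s).
Qed.

Lemma uvec_neq0 s : uvec s != 0.
Proof.
apply/eqP=> s0; have := uvec_dot s s.
by rewrite s0 mxE mulr0 eqxx [s == _]eq_sym oppd_neq.
Qed.

(** Common neighbours of two lattice points are found from this relation; the local rigidity
    arguments below reduce to it. *)
Lemma uvec_sum s u t v : uvec s + uvec u = uvec t + uvec v ->
  [\/ s = t /\ u = v, s = v /\ u = t | u = oppd s /\ v = oppd t].
Proof.
move=> E; have [us|us] := eqVneq u (oppd s).
  apply: Or33; split=> //; apply: uvec_inj; apply/eqP.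
  by rewrite uvec_opp -addr_eq0 addrC -E us uvec_opp subrr.
have [st|st] := eqVneq s t.
  by apply: Or31; split=> //; apply: uvec_inj; apply: (addrI (uvec s)); rewrite E st.
have [sv|sv] := eqVneq s v.
  apply: Or32; split=> //; apply: uvec_inj; apply: (addrI (uvec s)).
  by rewrite E sv addrC.
(* Paired with [s], the left side is at least 1 and the right side at most 0. *)
have /(congr1 (fun z : 'rV[int]_d => (-1) ^+ s.2 * z 0 s.1)) := E.
have addE (x y : 'rV[int]_d) i : (x + y) 0 i = x 0 i + y 0 i by rewrite mxE.
rewrite !addE !mulrDr !uvec_dot eqxx [s == oppd s]eq_sym oppd_neq (negbTE us).
rewrite ![_ == s]eq_sym (negbTE st) (negbTE sv).
by case: (s == u); case: (t == oppd s); case: (v == oppd s).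
Qed.

Lemma nrm0 : nrm (0 : 'rV[int]_d) = 0%N.
Proof. by rewrite /nrm big1 // => i _; rewrite mxE. Qed.

Lemma nrmN z : nrm (- z) = nrm z.
Proof. by apply: eq_bigr => i _; rewrite mxE abszN. Qed.

Lemma nrmD z y : (nrm (z + y) <= nrm z + nrm y)%N.
Proof.
by rewrite -big_split leq_sum // => i _; rewrite mxE; move: (z _ _) (y _ _) => a b; rewrite /=;
  lia.
Qed.

Lemma nrmB z y : (nrm (z - y) <= nrm z + nrm y)%N.
Proof. by rewrite -(nrmN y) nrmD. Qed.

Lemma nrm_eq0 z : (nrm z == 0%N) = (z == 0).
Proof.
apply/eqP/eqP => [|->]; last exact: nrm0.
move/eqP; rewrite sum_nat_eq0 => /forallP z0; apply/rowP=> i; rewrite mxE.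
by apply/eqP; rewrite -absz_eq0; have := z0 i.
Qed.

Lemma nrm_uvec s : nrm (uvec s) = 1%N.
Proof.
rewrite /nrm (bigD1 s.1) //= big1 ?addn0 => [|i /negbTE si].
  by rewrite uvecE eqxx mulr1; case: s.2.
by rewrite uvecE si mulr0.
Qed.

Lemma nrm_uvecD z s : (nrm (z + uvec s) <= (nrm z).+1)%N.
Proof. by apply: leq_trans (nrmD _ _) _; rewrite nrm_uvec addn1. Qed.

Lemma nrm_step z : z != 0 -> exists s, nrm z = (nrm (z - uvec s)).+1.
Proof.
move=> /rV0Pn[i zi].
pose s : dir d := (i, z 0 i < 0); exists s.
rewrite /nrm (bigD1 i) //= [in RHS](bigD1 i) //= -addSn; congr addn; last first.
  by apply: eq_bigr => j ji; rewrite !mxE (negbTE ji) mulr0 subr0.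
rewrite !mxE !eqxx /= mulr1; case: (ltP (z 0 i) 0) => zi0; move: zi zi0.
  by rewrite /= expr1; lia.
by rewrite /= expr0; lia.
Qed.

(** Supplies an intermediate point from which one chart sees both ends of a short vector. *)
Lemma nrm_split z a b : (nrm z <= a + b)%N ->
  exists y, (nrm y <= a)%N /\ (nrm (z - y) <= b)%N.
Proof.
elim: a z => [|a IH] z zab; first by exists 0; rewrite nrm0 subr0.
have [->|/nrm_step[s zs]] := eqVneq z 0; first by exists 0; rewrite subr0 !nrm0.
have /IH[y [ya yb]] : (nrm (z - uvec s) <= a + b)%N by rewrite zs addSn in zab.
exists (y + uvec s); split; last by rewrite opprD addrA addrAC.
by apply: leq_trans (nrm_uvecD _ _) _.
Qed.

Lemma latticeE x y : lattice x y = [exists s, y == x + uvec s].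
Proof.
apply/existsP/existsP => [[i /orP[] /eqP xy]|[[i []] /eqP xy]].
- by exists (i, false); rewrite xy /uvec expr0 scale1r.
- by exists (i, true); rewrite xy /uvec expr1 scaleN1r addrK.
- by exists i; rewrite xy /uvec /= expr1 scaleN1r subrK eqxx orbT.
by exists i; rewrite xy /uvec /= expr0 scale1r eqxx.
Qed.

Lemma latticeP x y : reflect (exists s, y = x + uvec s) (lattice x y).
Proof. by rewrite latticeE; apply: (iffP existsP) => -[s /eqP]; exists s => //; apply/eqP. Qed.

Lemma dir_mem_opp s t : s.1 = t.1 -> s = t \/ s = oppd t.
Proof. by case: s t => [i []] [j []] /= ->; auto. Qed.

End Directions.

Section Signed.
Variable d : nat.
Implicit Types (s t u : dir d) (z y : 'rV[int]_d) (a b : {perm dir d}).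

Definition signed b := [forall s, b (oppd s) == oppd (b s)].

Lemma signedP b : reflect (forall s, b (oppd s) = oppd (b s)) (signed b).
Proof. by apply: (iffP forallP) => H s; apply/eqP. Qed.

Lemma signed1 : signed 1%g.
Proof. by apply/signedP=> s; rewrite !perm1. Qed.

Lemma signedM a b : signed a -> signed b -> signed (a * b)%g.
Proof. by move=> /signedP ha /signedP hb; apply/signedP=> s; rewrite !permM ha hb. Qed.

Lemma signedV a : signed a -> signed a^-1%g.
Proof.
by move=> /signedP ha; apply/signedP=> s; apply: (@perm_inj _ a); rewrite ha !permKV.
Qed.

Lemma signedX a n : signed a -> signed (a ^+ n)%g.
Proof.
move=> ha; elim: n => [|n IH]; first by rewrite expg0 signed1.
by rewrite expgS signedM.
Qed.

(** Acts on row vectors from the right, so that matrix products follow the composition order of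
    permutations. *)
Definition bmx b : 'M[int]_d := \matrix_i uvec (b (i, false)).

Lemma uvec_bmx b s : signed b -> uvec s *m bmx b = uvec (b s).
Proof.
move=> /signedP hb; case: s => i c; rewrite /uvec /= -scalemxAl -rowE rowK.
case: c; last by rewrite expr0 scale1r.
by rewrite expr1 scaleN1r -[(i, true)]/(oppd (i, false)) hb -uvec_opp.
Qed.

Lemma vec_sum z : z = \sum_i z 0 i *: uvec (i, false).
Proof.
rewrite {1}[z]row_sum_delta; apply: eq_bigr => i _.
by rewrite /uvec /= expr0 scale1r.
Qed.

Lemma bmx1 : bmx 1%g = 1%:M.
Proof.
by apply/row_matrixP=> i; rewrite rowK perm1 /uvec expr0 scale1r row1.
Qed.

Lemma bmxM a b : signed a -> signed b -> bmx (a * b)%g = bmx a *m bmx b.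
Proof.
move=> ha hb; apply/row_matrixP=> i.
by rewrite row_mul !rowK permM uvec_bmx.
Qed.

Lemma bmxK b : signed b -> bmx b *m bmx b^-1%g = 1%:M.
Proof. by move=> hb; rewrite -bmxM ?signedV // mulgV bmx1. Qed.

Lemma bmxVK b : signed b -> bmx b^-1%g *m bmx b = 1%:M.
Proof. by move=> hb; rewrite -bmxM ?signedV // mulVg bmx1. Qed.

Lemma bmx_inj b : signed b -> injective (fun z => z *m bmx b).
Proof.
by move=> hb z y /(congr1 (mulmx^~ (bmx b^-1%g))); rewrite -!mulmxA bmxK // !mulmx1.
Qed.

Lemma nrm_bmx_le b z : signed b -> (nrm (z *m bmx b) <= nrm z)%N.
Proof.
move=> hb; have [n] := ubnP (nrm z); elim: n z => // n IH z.
have [->|/nrm_step[s ->] lt_n] := eqVneq z 0; first by rewrite mul0mx nrm0.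
rewrite -{1}(subrK (uvec s) z) mulmxDl uvec_bmx //.
by apply: leq_trans (nrm_uvecD _ _) _; rewrite ltnS IH.
Qed.

Lemma nrm_bmx b z : signed b -> nrm (z *m bmx b) = nrm z.
Proof.
move=> hb; apply/eqP; rewrite eqn_leq nrm_bmx_le //=.
by rewrite -{1}[z]mulmx1 -(bmxK hb) mulmxA nrm_bmx_le ?signedV.
Qed.

End Signed.

(** * Local charts *)

(** Surjectivity onto the link is replaced by the third clause, a local condition: images of inner
    points have no neighbours outside the image of the ball. *)
Definition chart d (V : Type) (e : rel V) (r : nat) (phi : 'rV[int]_d -> V) :=
  [/\ forall y z, (nrm y <= r)%N -> (nrm z <= r)%N -> phi y = phi z -> y = z,
      forall y z, (nrm y <= r)%N -> (nrm z <= r)%N ->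
        e (phi y) (phi z) = lattice y z
    & forall y c, (nrm y < r)%N -> e (phi y) c ->
        exists s, c = phi (y + uvec s)].

Section Links.
Variables (d : nat) (V : Type) (e : rel V).
Implicit Types (phi : 'rV[int]_d -> V) (v : V).

Lemma link_vertices_step k v w c :
  link_vertices e k v w -> e w c -> link_vertices e k.+1 v c.
Proof.
move=> [p [vp <- pk]] ec; exists (rcons p c).
by rewrite rcons_path vp ec last_rcons size_rcons ltnS.
Qed.

Lemma link_vertices_le j k v w :
  (j <= k)%N -> link_vertices e j v w -> link_vertices e k v w.
Proof. by move=> jk [p [vp pw pj]]; exists p; split=> //; apply: leq_trans jk. Qed.

Lemma lattice_ball k (x z : 'rV[int]_d) :
  link_vertices (@lattice d) k x z <-> (nrm (z - x)%R <= k)%N.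
Proof.
split=> [[p [xp <- pk]]|].
  apply: leq_trans pk; elim: p x xp => [|y p IH] x /=; first by rewrite subrr nrm0.
  case/andP=> /latticeP[s ->] /IH; set w := last _ _ => le_w.
  have -> : w - x = (w - (x + uvec s)) + uvec s by rewrite opprD addrA subrK.
  by apply: leq_trans (nrm_uvecD _ _) _.
elim: k x z => [|k IH] x z zx.
  exists [::]; split=> //=.
  by apply/esym/eqP; rewrite -subr_eq0 -nrm_eq0 -leqn0.
have [/eqP|/nrm_step[s]] := eqVneq (z - x) 0.
  by rewrite subr_eq0 => /eqP <-; exists [::].
rewrite -addrA -opprD => zs.
have /IH[p [xp pz pk]] : (nrm (z - (x + uvec s)) <= k)%N by rewrite -ltnS -zs.
exists (x + uvec s :: p); split=> //=; rewrite xp andbT.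
by apply/latticeP; exists s.
Qed.

Lemma latticeD (x : 'rV[int]_d) s : lattice x (x + uvec s).
Proof. by apply/latticeP; exists s. Qed.

Lemma chart_link_vertices r phi k y :
  (forall y z, (nrm y <= r)%N -> (nrm z <= r)%N -> lattice y z -> e (phi y) (phi z)) ->
  (nrm y <= k)%N -> (k <= r)%N -> link_vertices e k (phi 0) (phi y).
Proof.
move=> adj; elim: k y => [|k IH] y yk kr.
  by move: yk; rewrite leqn0 nrm_eq0 => /eqP ->; exists [::].
have [->|/nrm_step[s ys]] := eqVneq y 0; first by exists [::].
have yk' : (nrm (y - uvec s) <= k)%N by rewrite -ltnS -ys.
apply: link_vertices_step (IH _ yk' (ltnW kr)) _; apply: adj.
- exact: leq_trans yk' (ltnW kr).
- exact: leq_trans kr.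
by rewrite -{2}(subrK (uvec s) y) latticeD.
Qed.

Lemma link_iso_chart r v phi :
  link_iso (@lattice d) e r 0 v phi -> chart e r phi /\ phi 0 = v.
Proof.
have ball (y : 'rV[int]_d) : (nrm y <= r)%N -> link_vertices (@lattice d) r 0 y.
  by move=> yr; apply/lattice_ball; rewrite subr0.
move=> [[_ inj surj] adj phi0]; split=> //.
have adj' y z : (nrm y <= r)%N -> (nrm z <= r)%N -> e (phi y) (phi z) = lattice y z.
  by move=> yr zr; apply: adj; apply: ball.
split=> // [y z yr zr|y c yr ec]; first by apply: inj; rewrite inE; apply: ball.
have : link_vertices e r v c.
  have /link_vertices_le : ((nrm y).+1 <= r)%N by [].
  apply; apply: link_vertices_step ec; rewrite -phi0.
  apply: (@chart_link_vertices r) => //; last exact: ltnW.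
  by move=> ? ? ? ? ?; rewrite adj'.
case/surj => z /lattice_ball; rewrite subr0 => zr zc; move: ec; rewrite -zc adj' // 1?ltnW //.
by case/latticeP=> s ->; exists s.
Qed.

Lemma chart_link_iso r phi :
  chart e r phi -> link_iso (@lattice d) e r 0 (phi 0) phi.
Proof.
move=> [inj adj nb]; split=> // [|y z]; last first.
  by move=> /lattice_ball + /lattice_ball; rewrite !subr0; apply: adj.
split=> [y|y z|w [p [vp <- pr]]].
- move/lattice_ball; rewrite subr0 => yr.
  by apply: (@chart_link_vertices r) => // a b ar br; rewrite adj.
- by rewrite !inE => /lattice_ball + /lattice_ball; rewrite !subr0; apply: inj.
suff [y [yp <-]] : exists y, (nrm y <= size p)%N /\ phi y = last (phi 0) p.
  by exists y => //; apply/lattice_ball; rewrite subr0; apply: leq_trans pr.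
elim/last_ind: p vp pr => [|p c IH]; first by exists 0; rewrite nrm0.
rewrite rcons_path size_rcons last_rcons => /andP[/IH{}IH ec] pr.
have [y [yp yE]] := IH (ltnW pr); rewrite -yE in ec.
have [s ->] := nb _ _ (leq_ltn_trans yp pr) ec.
by exists (y + uvec s); split=> //; apply: leq_trans (nrm_uvecD _ _) _.
Qed.

End Links.

Section Charts.
Variables (d : nat) (V : Type) (e : rel V) (r : nat).
Hypotheses (e_sym : symmetric e) (r2 : (2 <= r)%N).
Implicit Types (s t u : dir d) (phi psi : 'rV[int]_d -> V) (y z : 'rV[int]_d).

Lemma nrm_uvec2 s t : (nrm (uvec s + uvec t) <= 2)%N.
Proof. by apply: leq_trans (nrm_uvecD _ _) _; rewrite nrm_uvec. Qed.

Lemma chart_adj phi y s : chart e r phi -> (nrm y < r)%N -> e (phi y) (phi (y + uvec s)).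
Proof.
move=> [_ adj _] yr; rewrite adj ?latticeD // ?(ltnW yr) //.
exact: leq_trans (nrm_uvecD _ _) _.
Qed.

Lemma chart_common2 phi y z c : chart e r phi -> (nrm y < r)%N -> (nrm z <= r)%N ->
  e (phi y) c -> e (phi z) c ->
  exists u v, c = phi (y + uvec u) /\ y + uvec u = z + uvec v.
Proof.
move=> [_ adj nb] yr zr ey ez; have [u cE] := nb _ _ yr ey.
have yur : (nrm (y + uvec u) <= r)%N by exact: leq_trans (nrm_uvecD _ _) _.
by move: ez; rewrite cE adj // => /latticeP[v vE]; exists u, v.
Qed.

(** The case [t = oppd s] is included; there both alternatives coincide, so opposite neighbours have
    the centre as their only common neighbour. *)
Lemma chart_square phi y s t c : chart e r phi -> (nrm (y + uvec s)%R < r)%N ->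
  (nrm (y + uvec t)%R <= r)%N -> s != t ->
  e (phi (y + uvec s)) c -> e (phi (y + uvec t)) c ->
  c = phi y \/ c = phi (y + uvec s + uvec t).
Proof.
move=> ch ys yt st es et; have [u [v [-> /eqP]]] := chart_common2 ch ys yt es et.
rewrite -!addrA (inj_eq (addrI y)) => /eqP/uvec_sum[[]|[_ ->]|[-> _]].
- by move=> /eqP; rewrite (negbTE st).
- by right.
by left; rewrite uvec_opp subrr addr0.
Qed.

Lemma chart_square0 phi s t c : chart e r phi -> s != t ->
  e (phi (uvec s)) c -> e (phi (uvec t)) c ->
  c = phi 0 \/ c = phi (uvec s + uvec t).
Proof.
move=> ch st; have := @chart_square phi 0 s t c ch; rewrite !add0r !nrm_uvec.
by apply=> //; exact: ltnW.
Qed.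

Lemma chart_uvec_inj phi s t : chart e r phi -> phi (uvec s) = phi (uvec t) -> s = t.
Proof. by move=> [inj _ _] /inj E; apply: uvec_inj; apply: E; rewrite nrm_uvec ltnW. Qed.

Lemma chart_frame0 phi s : chart e r phi -> e (phi 0) (phi (uvec s)).
Proof.
move=> ch; have := @chart_adj phi 0 s ch; rewrite add0r nrm0; apply.
exact: ltnW.
Qed.

Lemma chart_frame_surj phi c : chart e r phi -> e (phi 0) c -> exists s, c = phi (uvec s).
Proof.
move=> [_ _ nb] ec; have [|s ->] := nb 0 c _ ec; first by rewrite nrm0 ltnW.
by exists s; rewrite add0r.
Qed.

Lemma chart_bmx phi (b : {perm dir d}) : signed b -> chart e r phi ->
  chart e r (fun y => phi (y *m bmx b)).
Proof.
move=> hb [inj adj nb]; split=> [y z yr zr|y z yr zr|y c yr ec].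
- by move/inj; rewrite !nrm_bmx // => E; apply: (bmx_inj hb); apply: E.
- rewrite adj ?nrm_bmx //; apply/latticeP/latticeP=> -[s sE].
    exists ((b^-1)%g s); apply: (bmx_inj hb) => /=.
    by rewrite mulmxDl uvec_bmx // permKV.
  by exists (b s); rewrite sE mulmxDl uvec_bmx.
have [|s ->] := nb _ _ _ ec; first by rewrite nrm_bmx.
by exists ((b^-1)%g s); rewrite mulmxDl uvec_bmx // permKV.
Qed.

(* Two nearest neighbours are opposite iff they have a single common
   neighbour, so any such system of neighbours differs from that of a chart by
   a signed permutation. *)
Lemma chart_signed (f : dir d -> V) psi : chart e r psi -> injective f ->
  (forall t, e (psi 0) (f t)) ->
  (forall t, (forall c, e (f t) c -> e (f (oppd t)) c -> c = psi 0) \/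
    exists a, [/\ a.1 != t.1, d = 2 &
      forall c, e (f a) c -> e (f (oppd a)) c -> c = psi 0]) ->
  exists2 b : {perm dir d}, signed b & forall t, f t = psi (uvec (b t)).
Proof.
move=> ch finj fadj fopp; pose b0 t := xchoose (ex_intro (fun s => `[< f t = psi (uvec s) >])
  _ (introT (asboolP _) (projT2 (cid (chart_frame_surj ch (fadj t)))))).
have b0E t : f t = psi (uvec (b0 t)).
  by apply/asboolP; exact: (xchooseP (ex_intro (fun s => `[< f t = psi (uvec s) >]) _ _)).
have b0_inj : injective b0 by move=> s t st; apply: finj; rewrite !b0E st.
have single t : (forall c, e (f t) c -> e (f (oppd t)) c -> c = psi 0) ->
    b0 (oppd t) = oppd (b0 t).
  move=> t1; apply: contrapT => /eqP nopp.
  have tt : b0 t != b0 (oppd t) by rewrite (inj_eq b0_inj) eq_sym oppd_neq.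
  have E : psi (uvec (b0 t) + uvec (b0 (oppd t))) = psi 0.
    have ult u : (nrm (uvec u : 'rV[int]_d) < r)%N by rewrite nrm_uvec.
    apply: t1; rewrite !b0E; first exact: chart_adj.
    by rewrite addrC; apply: chart_adj.
  have [inj _ _] := ch; have /eqP : uvec (b0 t) + uvec (b0 (oppd t)) = 0.
    by apply: inj E; rewrite ?nrm0 // (leq_trans (nrm_uvec2 _ _)).
  rewrite addr_eq0 => /eqP E'; case/negP: nopp; apply/eqP/uvec_inj.
  by rewrite uvec_opp E' opprK.
exists (perm b0_inj); last by move=> t; rewrite permE.
apply/signedP=> t; rewrite !permE; case: (fopp t) => [/single //|[a [at1 d2 /single oa]]].
(* In dimension 2, once the axis of [a] goes to an axis, the two directions of the other axis must
   share the remaining one. *)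
have fst_neq u : u.1 != a.1 -> (b0 u).1 != (b0 a).1.
  apply: contra => /eqP /dir_mem_opp[|] E.
    by rewrite (b0_inj _ _ E).
  by move: E; rewrite -oa => /b0_inj ->.
have t1 := fst_neq t; have t2 := fst_neq (oppd t).
rewrite eq_sym /= in t1 t2; have {}t1 := t1 at1; have {}t2 := t2 at1.
have : (b0 t).1 = (b0 (oppd t)).1.
  by clear -d2 t1 t2; apply: val_inj; move: (b0 t).1 (b0 (oppd t)).1 (b0 a).1 t1 t2 => i j k;
   rewrite -!val_eqE /=; have := ltn_ord i; have := ltn_ord j; have := ltn_ord k; lia.
case/dir_mem_opp => [/b0_inj /esym/eqP|->]; first by rewrite oppd_neq.
by rewrite oppdK.
Qed.

End Charts.

(** * Parallel transport of frames *)

Lemma int_iter (X : Type) (f g : X -> X) : cancel f g -> cancel g f ->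
  exists it : int -> X -> X, [/\ forall x, it 0 x = x,
    forall n x, it (n + 1) x = f (it n x)
  & forall h : X -> X, (forall x, h (f x) = f (h x)) ->
      (forall x, h (g x) = g (h x)) -> forall n x, h (it n x) = it n (h x)].
Proof.
(* [Negz k] stands for -(k+1), hence the [k.+1] iterations of the inverse. *)
move=> fK gK; exists (fun n => match n with Posz k => iter k f | Negz k => iter k.+1 g end).
split=> // [[k|[|k]] x|h hf hg [k|k] x].
- by rewrite -PoszD addn1.
- by rewrite /= gK.
- by rewrite (_ : Negz k.+1 + 1 = Negz k) /= ?gK // !NegzE -addn1 PoszD opprD subrK.
- by elim: k => //= k IH; rewrite hf IH.
by elim: k => /= [|k IH]; rewrite hg // IH.
Qed.

(** Flatness integrates: commuting invertible steps, applied coordinate by coordinate in a fixed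
    order, define the displacement by any lattice vector. *)
Lemma lattice_action d (X : Type) (T T' : 'I_d -> X -> X) :
  (forall i, cancel (T i) (T' i)) -> (forall i, cancel (T' i) (T i)) ->
  (forall i j x, T i (T j x) = T j (T i x)) ->
  exists a : 'rV[int]_d -> X -> X, (forall x, a 0 x = x) /\
    forall z i x, a (z + uvec (i, false)) x = T i (a z x).
Proof.
move=> TK T'K TC.
have /choice[it itP] : forall i, exists it : int -> X -> X, [/\ forall x, it 0 x = x,
    forall n x, it (n + 1) x = T i (it n x)
  & forall h : X -> X, (forall x, h (T i x) = T i (h x)) ->
      (forall x, h (T' i x) = T' i (h x)) -> forall n x, h (it n x) = it n (h x)].
  by move=> i; apply: int_iter.
pose a s (z : 'rV[int]_d) x := foldr (fun i x => it i (z 0 i) x) x s.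
exists (a (enum 'I_d)); split=> [x|z i x].
  by rewrite /a; elim: (enum _) => //= i s ->; rewrite mxE; case: (itP i).
have itC j n y : T i (it j n y) = it j n (T i y).
  have [_ _] := itP j; apply=> {}y; first exact: TC.
  by apply: (can_inj (TK j)); rewrite TC !T'K.
suff aP s : uniq s -> a s (z + uvec (i, false)) x = if i \in s then T i (a s z x) else a s z x.
  by rewrite aP ?enum_uniq // mem_enum.
elim: s => //= j s IH /andP[js /IH{}IH]; rewrite /= IH in_cons.
rewrite mxE uvecE /= expr0 mul1r; have [ji|ij] /= := eqVneq j i.
  by rewrite ji in js *; rewrite (negbTE js); case: (itP i) => _ ->.
by rewrite addr0; case: ifP => // _; rewrite itC.
Qed.

Section Transport.
Variables (d : nat) (V : Type) (e : rel V) (r : nat).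
Hypotheses (e_sym : symmetric e) (r2 : (2 <= r)%N) (dr : d = 2%N \/ (3 <= r)%N).
Hypothesis e_loc : forall v, exists phi : 'rV[int]_d -> V, chart e r phi /\ phi 0 = v.
Implicit Types (s t u : dir d) (phi psi : 'rV[int]_d -> V) (y z : 'rV[int]_d).

Let state := (V * (dir d -> V))%type.
Implicit Types x : state.

Definition frame_at phi y : state := (phi y, fun s => phi (y + uvec s)).

Definition valid_state x := exists2 phi, chart e r phi & x = frame_at phi 0.

(** The new frame looks back to the old centre, and its transverse vectors close up squares. The
    vector straight ahead is left to be determined by elimination. *)
Definition transport x s x' := [/\ x'.1 = x.2 s, x'.2 (oppd s) = x.1 &
  forall t, t != s -> t != oppd s -> e (x.2 t) (x'.2 t)].

Lemma frame_at0 phi s : (frame_at phi 0).2 s = phi (uvec s).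
Proof. by rewrite /= add0r. Qed.

Lemma valid_adj x s : valid_state x -> e x.1 (x.2 s).
Proof. by move=> [phi ch ->]; rewrite frame_at0; exact: (chart_frame0 r2 _ ch). Qed.

Lemma valid_inj x : valid_state x -> injective x.2.
Proof.
move=> [phi ch ->] s t; rewrite !frame_at0; exact: (chart_uvec_inj r2 ch).
Qed.

Lemma valid_surj x c : valid_state x -> e x.1 c -> exists s, c = x.2 s.
Proof.
by move=> [phi ch ->] /(chart_frame_surj r2 ch)[s ->]; exists s; rewrite frame_at0.
Qed.

(** Squares force the transverse neighbours; injectivity of the frame then leaves one neighbour for
    direction [s]. This is also what makes transport unique. *)
Lemma transport_frame phi y s x' : chart e r phi -> (nrm y < r)%N ->
  (nrm (y + uvec s)%R < r)%N -> valid_state x' -> transport (frame_at phi y) s x' ->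
  x' = frame_at phi (y + uvec s).
Proof.
move=> ch yr ysr vx' [/= x'1 x's x't].
have side t : t != s -> t != oppd s -> x'.2 t = phi (y + uvec s + uvec t).
  move=> ts tos; have := x't t ts tos; rewrite e_sym => et.
  have e1 : e (phi (y + uvec s)) (x'.2 t) by rewrite -x'1 valid_adj.
  have ytr : (nrm (y + uvec t) <= r)%N by apply: leq_trans (nrm_uvecD _ _) _.
  rewrite e_sym in et; rewrite eq_sym in ts.
  have [] := chart_square ch ysr ytr ts e1 et => //.
  by rewrite -x's => /(valid_inj vx') E; rewrite E eqxx in tos.
rewrite [x']surjective_pairing; congr pair => //; apply/funext => t.
have [->|tos] := eqVneq t (oppd s); first by rewrite x's uvec_opp addrK.
have [->|ts] := eqVneq t s; last exact: side.
have := valid_adj s vx'; rewrite x'1; have [_ _ nb] := ch.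
move=> /(nb _ _ ysr)[w wE]; have [ws|ws] := eqVneq w s; first by rewrite wE ws.
have [wos|wos] := eqVneq w (oppd s).
  move: wE; rewrite wos uvec_opp addrK -x's => /(valid_inj vx')/eqP.
  by rewrite eq_sym oppd_neq.
by move: wE; rewrite -(side w ws wos) => /(valid_inj vx') ws'; case/eqP: ws.
Qed.

(** The new frame is read in the old chart, but validity asks for a chart centred at the new vertex;
    [chart_signed] matches the two. On transverse axes this requires the common neighbours of points
    of norm 2, hence r >= 3, whereas for d = 2 the axis of [s] alone suffices. *)
Lemma transport_ex x s : valid_state x -> exists2 x', valid_state x' & transport x s x'.
Proof.
move=> [phi ch ->]; exists (frame_at phi (uvec s)); last first.
  split=> [||t ts tos]; rewrite /= ?add0r // ?uvec_opp ?subrr //.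
  by rewrite addrC; apply: (chart_adj _ ch) => //; rewrite nrm_uvec.
have [inj _ _] := ch; have [psi [psich psi0]] := e_loc (phi (uvec s)).
have single c : e (phi (uvec s + uvec s)) c -> e (phi (uvec s + uvec (oppd s))) c ->
    c = phi (uvec s).
  rewrite uvec_opp subrr => e1 e2.
  have r0 : (nrm (0 : 'rV[int]_d) < r)%N by rewrite nrm0 ltnW.
  have [u [v [-> E]]] := chart_common2 ch r0 (leq_trans (nrm_uvec2 _ _) r2) e2 e1.
  have : uvec u + uvec (oppd v) = uvec s + uvec s by rewrite uvec_opp -[uvec u]add0r E addrK.
  by case/uvec_sum=> [[->]|[->]|[_ /eqP]]; rewrite ?add0r // eq_sym oppd_neq.
have [|||b hb bE] := @chart_signed _ _ _ _ r2 (fun t => phi (uvec s + uvec t)) psi psich.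
- move=> t u /inj; rewrite !(leq_trans (nrm_uvec2 _ _) r2) => /(_ isT isT) /addrI.
  exact: uvec_inj.
- by move=> t; rewrite psi0; apply: (chart_adj _ ch) => //; rewrite nrm_uvec.
- move=> t; rewrite psi0; have [->|ts] := eqVneq t s; first by left.
  have [->|tos] := eqVneq t (oppd s); first by left=> c; rewrite oppdK => ? ?; apply: single.
  case: dr => [d2|r3].
    right; exists s; split=> //; apply/eqP=> st.
    by case: (dir_mem_opp (esym st)) => E; rewrite E eqxx in ts tos.
  left=> c e1 e2.
  have := chart_common2 ch (leq_ltn_trans (nrm_uvec2 s t) r3) (leq_trans (nrm_uvec2 _ _) r2) e1
    e2.
  case=> u [v [-> /eqP]];
    rewrite -!addrA (inj_eq (addrI _)) => /eqP/uvec_sum[[/eqP]|[_ ->]|[-> _]].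
  - by rewrite eq_sym oppd_neq.
  - by rewrite uvec_opp subrr addr0.
  - by rewrite uvec_opp subrr addr0.
exists (fun y => psi (y *m bmx b)); first exact: chart_bmx.
congr pair; first by rewrite /= mul0mx psi0.
by apply/funext=> t; rewrite /= add0r uvec_bmx // -bE.
Qed.

Lemma transport_uniq x s x1 x2 : valid_state x -> valid_state x1 -> valid_state x2 ->
  transport x s x1 -> transport x s x2 -> x1 = x2.
Proof.
move=> [phi ch ->] v1 v2.
have r0 : (nrm (0 : 'rV[int]_d) < r)%N by rewrite nrm0 ltnW.
have r1 : (nrm (0 + uvec s : 'rV[int]_d) < r)%N by rewrite add0r nrm_uvec.
by do 2!move/(transport_frame ch r0 r1) => -> //.
Qed.

Lemma transport_sym x s x' : transport x s x' -> transport x' (oppd s) x.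
Proof.
move=> [x1 xs xt]; split=> [||t ts tos]; rewrite ?oppdK //.
by rewrite e_sym xt //; rewrite oppdK in tos.
Qed.

(** Being opposite is intrinsic: opposite neighbours have only the centre in common, while
    neighbours along different axes close up a square. *)
Lemma valid_opp x x' a : valid_state x -> valid_state x' -> x.1 = x'.1 ->
  x.2 a = x'.2 a -> x.2 (oppd a) = x'.2 (oppd a).
Proof.
move=> vx vx' x1 xa; have := valid_adj (oppd a) vx'; rewrite -x1 => /(valid_surj vx)[u uE].
rewrite uE; have [->//|ua] := eqVneq u (oppd a).
have [ua'|ua'] := eqVneq u a.
  by move: uE; rewrite ua' xa => /(valid_inj vx')/eqP; rewrite oppd_neq.
have [phi ch xE] := vx; have [psi psich x'E] := vx'.
have e1 : e (phi (uvec a)) (phi (uvec a + uvec u)) by apply: (chart_adj _ ch) => //;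
  rewrite nrm_uvec.
have e2 : e (phi (uvec u)) (phi (uvec a + uvec u)).
  by rewrite addrC; apply: (chart_adj _ ch) => //; rewrite nrm_uvec.
have : phi (uvec a + uvec u) = psi 0.
  have aE : phi (uvec a) = psi (uvec a).
    by have := xa; rewrite {1}xE {1}x'E !frame_at0.
  have uE' : phi (uvec u) = psi (uvec (oppd a)).
    by have := uE; rewrite {1}xE {1}x'E !frame_at0.
  rewrite aE in e1; rewrite uE' in e2.
  have [] := chart_square0 r2 psich _ e1 e2; rewrite ?uvec_opp ?subrr //.
  by rewrite eq_sym oppd_neq.
have -> : psi 0 = phi 0 by have := x1; rewrite {1}xE {1}x'E.
have [inj _ _] := ch; move/inj; rewrite nrm0 (leq_trans (nrm_uvec2 _ _) r2).
move=> /(_ isT isT)/eqP; rewrite addrC addr_eq0 -uvec_opp => /eqP/uvec_inj E.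
by rewrite E eqxx in ua.
Qed.

(** After two sides of a square the initial chart still sees the whole frame except its vectors [s]
    and [t]; these are recovered by [valid_opp]. *)
Lemma transport_two phi s t x : chart e r phi -> s.1 != t.1 -> valid_state x ->
  transport (frame_at phi (uvec s)) t x ->
  [/\ x.1 = phi (uvec s + uvec t), x.2 (oppd t) = phi (uvec s),
      x.2 (oppd s) = phi (uvec t) &
      forall u, u.1 != s.1 -> u.1 != t.1 -> x.2 u = phi (uvec s + uvec t + uvec u)].
Proof.
move=> ch st vx [/= x1 xt xu].
have neq1 (u v : dir d) : u.1 != v.1 -> u != v by apply: contraNneq => ->.
split=> // [|u us ut].
  have := xu (oppd s) (neq1 (oppd s) t st) (neq1 (oppd s) (oppd t) st).
  rewrite uvec_opp subrr => e1; have := valid_adj (oppd s) vx; rewrite x1 => e2.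
  have r0 : (nrm (0 : 'rV[int]_d) < r)%N by rewrite nrm0 ltnW.
  have [u [v [uE E0]]] := chart_common2 ch r0 (leq_trans (nrm_uvec2 _ _) r2) e1 e2.
  have : uvec u + uvec (oppd v) = uvec s + uvec t by rewrite uvec_opp -[uvec u]add0r E0 addrK.
  case/uvec_sum=> [[E _]|[E _]|[_ E]].
  - move: uE; rewrite add0r E -xt => /(valid_inj vx) E'.
    by move: st; rewrite -[s.1]/((oppd s).1) E' eqxx.
  - by rewrite uE add0r E.
  - by rewrite E eqxx in st.
case: dr => [d2|r3].
  clear -d2 st us ut; exfalso; move: st us ut; rewrite -!val_eqE /=.
  have := ltn_ord u.1; have := ltn_ord s.1; have := ltn_ord t.1; lia.
have := xu u (neq1 _ _ ut) (neq1 _ (oppd t) ut) => e1.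
have := valid_adj u vx; rewrite x1 => e2.
have := chart_square ch (leq_ltn_trans (nrm_uvec2 s u) r3) (leq_trans (nrm_uvec2 s t) r2) _ e1 e2.
case; [exact: neq1| |by move=> ->; rewrite addrAC].
rewrite -xt => /(valid_inj vx) E.
by rewrite E eqxx in ut.
Qed.

(** Trivial holonomy around a square, because the description in [transport_two] is symmetric in [s]
    and [t]. *)
Lemma transport_comm x s t x1 x2 x12 x21 : s.1 != t.1 ->
  valid_state x -> valid_state x1 -> valid_state x2 -> valid_state x12 -> valid_state x21 ->
  transport x s x1 -> transport x t x2 -> transport x1 t x12 -> transport x2 s x21 ->
  x12 = x21.
Proof.
move=> st [phi ch ->] v1 v2 v12 v21.
have r0 : (nrm (0 : 'rV[int]_d) < r)%N by rewrite nrm0 ltnW.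
have r1 u : (nrm (0 + uvec u : 'rV[int]_d) < r)%N by rewrite add0r nrm_uvec.
move/(transport_frame ch r0 (r1 s) v1) => -> {x1 v1}.
move/(transport_frame ch r0 (r1 t) v2) => -> {x2 v2}.
rewrite !add0r => /(transport_two ch st v12)[a1 a2 a3 a4].
rewrite eq_sym in st; move=> /(transport_two ch st v21)[b1 b2 b3 b4].
have E1 : x12.1 = x21.1 by rewrite a1 b1 addrC.
rewrite [x12]surjective_pairing [x21]surjective_pairing E1; congr pair; apply/funext=> u.
have [us|us] := eqVneq u.1 s.1.
  have E : x12.2 (oppd s) = x21.2 (oppd s) by rewrite a3 b2.
  case: (dir_mem_opp us) => -> //; rewrite -[s]oppdK; exact: valid_opp E.
have [ut|ut] := eqVneq u.1 t.1.
  have E : x12.2 (oppd t) = x21.2 (oppd t) by rewrite a2 b3.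
  case: (dir_mem_opp ut) => -> //; rewrite -[t]oppdK; exact: valid_opp E.
by rewrite a4 // b4 // [uvec t + _]addrC.
Qed.

End Transport.

(** * Covers *)

(* The second clause bounds the minimal displacement of the deck
   transformations of p from below by 2r+2. *)
Definition cover d (V : Type) (e : rel V) (r : nat) (p : 'rV[int]_d -> V) :=
  (forall z c, e (p z) c <-> exists s, c = p (z + uvec s)) /\
  (forall z y, (nrm (z - y)%R <= (2 * r).+1)%N -> p z = p y -> z = y).

Section CoverExists.
Variables (d : nat) (V : Type) (e : rel V) (r : nat).
Hypotheses (e_sym : symmetric e) (r2 : (2 <= r)%N) (dr : d = 2%N \/ (3 <= r)%N).
Hypothesis e_loc : forall v, exists phi : 'rV[int]_d -> V, chart e r phi /\ phi 0 = v.

Let X := {x : V * (dir d -> V) | valid_state e r x}.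

Let step_ex (s : dir d) (x : X) : exists x' : X, transport e (sval x) s (sval x').
Proof.
case: x => x vx; have [x' vx' xx'] := transport_ex r2 dr e_loc s vx.
by exists (exist _ x' vx').
Qed.

Let step s x : X := sval (cid (step_ex s x)).

Let stepP s x : transport e (sval x) s (sval (step s x)).
Proof. exact: (svalP (cid (step_ex s x))). Qed.

Let X_eq (x y : X) : sval x = sval y -> x = y.
Proof. by case: x y => x vx [y vy] /= xy; apply: eq_exist. Qed.

Let stepE s x y : transport e (sval x) s (sval y) -> step s x = y.
Proof.
by move=> xy; apply/X_eq;
  apply: (transport_uniq e_sym r2 (svalP x) (svalP _) (svalP _) (stepP s x) xy).
Qed.

Let stepK s : cancel (step s) (step (oppd s)).
Proof. by move=> x; apply/stepE/(transport_sym e_sym)/stepP. Qed.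

Let stepC s t x : s.1 != t.1 -> step s (step t x) = step t (step s x).
Proof.
move=> st; apply/X_eq/esym; apply: (transport_comm e_sym r2 dr st (svalP x)
  (svalP (step s x)) (svalP (step t x)) (svalP _) (svalP _)); exact: stepP.
Qed.

Lemma cover_ex v : exists p : 'rV[int]_d -> V, cover e r p /\ p 0 = v.
Proof.
have TC i j x : step (i, false) (step (j, false) x) = step (j, false) (step (i, false) x).
  by have [->//|ij] := eqVneq i j; apply: stepC.
have [a [a0 aD]] := lattice_action (fun i => @stepK (i, false)) (fun i => @stepK (i, true)) TC.
have {}aD z s x : a (z + uvec s) x = step s (a z x).
  case: s => i [] //; apply: (can_inj (@stepK (i, false))).
  rewrite [RHS](@stepK (i, true)) -aD.
  by rewrite -[(i, true)]/(oppd (i, false)) uvec_opp subrK.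
have [phi0 [ch0 <-]] := e_loc v.
pose x0 : X := exist _ (frame_at phi0 0) (ex_intro2 _ _ phi0 ch0 erefl).
pose p z := (sval (a z x0)).1; exists p; split; last by rewrite /p a0.
have r0 : (nrm (0 : 'rV[int]_d) < r)%N by rewrite nrm0 ltnW.
(* Near any [z] the action is read off from a single chart, by following a geodesic from [z]. *)
have psi z : exists2 phi, chart e r phi & forall y, (nrm y < r)%N ->
    sval (a (z + y) x0) = frame_at phi y.
  have [phi ch aE] := svalP (a z x0); exists phi => // y.
  have [n] := ubnP (nrm y); elim: n y => // n IH y.
  have [->|/nrm_step[s ys]] := eqVneq y 0; first by rewrite addr0.
  rewrite ys ltnS => yn yr; have yr' := ltnW yr.
  rewrite -(subrK (uvec s) y) addrA aD; apply: (transport_frame e_sym r2 ch yr').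
  - by rewrite subrK ys.
  - exact: svalP.
  - by rewrite -(IH _ yn yr'); apply: stepP.
have pD z s : p (z + uvec s) = (sval (a z x0)).2 s by rewrite /p aD; case: (stepP s (a z x0)).
have pE z : exists2 phi, chart e r phi & forall y, (nrm y <= r)%N -> p (z + y) = phi y.
  have [phi ch aE] := psi z; exists phi => // y.
  have [->|/nrm_step[s ys]] := eqVneq y 0; first by rewrite /p aE.
  rewrite ys => yr; rewrite -(subrK (uvec s) y) addrA pD aE //.
have nb z c : e (p z) c <-> exists s, c = p (z + uvec s).
  have [phi ch phiE] := pE z.
  have E s : p (z + uvec s) = phi (uvec s) by rewrite phiE // nrm_uvec ltnW.
  rewrite -[z]addr0 phiE ?nrm0 // addr0; split=> [/(chart_frame_surj r2 ch)[s ->]|[s ->]].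
    by exists s.
  by rewrite E; apply: (chart_frame0 r2 _ ch).
have step_inj z s t : p (z + uvec s) = p (z + uvec t) -> s = t.
  have [phi ch phiE] := pE z.
  rewrite !phiE ?nrm_uvec; [exact: (chart_uvec_inj r2 ch)|exact: ltnW|exact: ltnW].
split=> // z z' zz'.
(* A chart of radius r around the intermediate point contains [z] and all but possibly the last step
   towards [z']. If [z'] is outside, its predecessor is adjacent to the common image, and
   injectivity of the frame there identifies the last step. *)
have [y [yr yr']] : exists y, (nrm y <= r)%N /\ (nrm (z - z' - y)%R <= r.+1)%N.
  by apply: nrm_split; apply: leq_trans zz' _; rewrite addnS mul2n addnn.
pose z0 := z - y; pose w := z' - z0.
have wr : (nrm w <= r.+1)%N.
  have -> : w = - (z - z' - y) by apply/rowP=> i; rewrite !mxE; ring.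
  by rewrite nrmN.
have zE : z = z0 + y by rewrite subrK.
have z'E : z' = z0 + w by rewrite addrC subrK.
have [phi ch phiE] := pE z0; have [inj adj _] := ch.
rewrite zE z'E phiE // => E; congr (_ + _).
have [wr'|wr'] := leqP (nrm w) r; first by apply: inj => //; rewrite E phiE.
have [/eqP|/nrm_step[s ws]] := eqVneq w 0.
  by rewrite -nrm_eq0 => /eqP w0; rewrite w0 in wr'.
have ws' : (nrm (w - uvec s) <= r)%N by rewrite -ltnS -ws.
have : e (p (z0 + (w - uvec s))) (p (z0 + w)) by apply/nb; exists s;
  rewrite -(addrA z0 (w - _)) subrK.
rewrite -E (phiE _ ws') adj // => /latticeP[t yE].
have : p (z0 + (w - uvec s) + uvec t) = p (z0 + (w - uvec s) + uvec s).
  by rewrite -!(addrA z0 (w - _)) subrK -yE phiE.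
by move/step_inj => ts; rewrite yE ts subrK.
Qed.

End CoverExists.

Section CoverTheory.
Variables (d r : nat).
Hypothesis r2 : (2 <= r)%N.

(** Adjacency is where 2r+1 rather than 2r is used: for [y], [y'] in the ball, [y + uvec s - y'] can
    have norm 2r+1. *)
Lemma cover_chart (V : Type) (e : rel V) (p : 'rV[int]_d -> V) z : cover e r p ->
  chart e r (fun y => p (z + y)).
Proof.
move=> [nb inj]; split=> [y y' yr yr' /inj E|y y' yr yr'|y c yr].
- apply: (addrI z); apply: E; rewrite opprD addrACA subrr add0r.
  by apply: leq_trans (nrmB _ _) _; lia.
- apply/idP/idP=> [/nb[s sE]|/latticeP[s ->]]; last by apply/nb; exists s; rewrite addrA.
  apply/latticeP.
  exists s; apply: (addrI z); rewrite addrA; apply: inj => //.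
  rewrite -addrA opprD addrACA subrr add0r opprD addrA.
  by rewrite -uvec_opp; apply: leq_trans (nrm_uvecD _ _) _;
    rewrite ltnS (leq_trans (nrmB _ _)) //; lia.
by move/nb=> [s ->]; exists s; rewrite addrA.
Qed.

Lemma r_locallyP (V : Type) (e : rel V) : symmetric e -> d = 2%N \/ (3 <= r)%N ->
  r_locally (@lattice d) 0 r e <-> forall v, exists p : 'rV[int]_d -> V, cover e r p /\ p 0 = v.
Proof.
move=> e_sym dr; split=> [loc v|loc v].
  by apply: cover_ex => // w; have [phi phiP] := loc w; exists phi; exact: link_iso_chart.
have [p [cp <-]] := loc v; exists p; apply: chart_link_iso.
by have := cover_chart 0 cp; under eq_fun do rewrite add0r.
Qed.

Section Fixed.
Variables (V : Type) (e : rel V).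
Implicit Types p : 'rV[int]_d -> V.

Lemma cover_trans p w : cover e r p -> cover e r (fun y => p (w + y)).
Proof.
move=> [nb inj]; split=> [z c|z y zy /inj E].
  by rewrite nb; split=> -[s ->]; exists s; rewrite addrA.
by apply: (addrI w); apply: E; rewrite opprD addrACA subrr add0r.
Qed.

Lemma cover_bmx p b : signed b -> cover e r p -> cover e r (fun y => p (y *m bmx b)).
Proof.
move=> hb [nb inj]; split=> [z c|z y zy /inj E].
  rewrite nb; split=> -[s ->].
    by exists (b^-1%g s); rewrite mulmxDl uvec_bmx // permKV.
  by exists (b s); rewrite mulmxDl uvec_bmx.
by apply: (bmx_inj hb); apply: E; rewrite -mulmxBl nrm_bmx.
Qed.

Lemma cover_iso p (W : Type) (e' : rel W) (h : V -> W) : injective h ->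
  (forall x y, e' (h x) (h y) = e x y) ->
  (forall x c, e' (h x) c -> exists y, c = h y) ->
  cover e r p -> cover e' r (h \o p).
Proof.
move=> hinj he hsurj [nb inj]; split=> [z c|z y zy /hinj]; last exact: inj.
split=> [/= ec|[s ->]]; last by rewrite /= he nb; exists s.
have [y yE] := hsurj _ _ ec; move: ec; rewrite yE he nb => -[s ->].
by exists s.
Qed.

(** A frame forces the next one, as in parallel transport, so agreement spreads along geodesics. *)
Lemma cover_uniq p p' : cover e r p -> cover e r p' -> p 0 = p' 0 ->
  (forall s, p (uvec s) = p' (uvec s)) -> p =1 p'.
Proof.
move=> cp cp' p0 ps.
suff H z : p z = p' z /\ forall s, p (z + uvec s) = p' (z + uvec s).
  by move=> z; case: (H z).
have [n] := ubnP (nrm z); elim: n z => // n IH z.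
have [->|/nrm_step[s zs]] := eqVneq z 0; first by split=> // s; rewrite add0r.
rewrite zs ltnS => /IH; set y := z - uvec s => -[yE ysE].
rewrite -(subrK (uvec s) z) -/y; split=> //.
have ch := cover_chart y cp; have ch' := cover_chart y cp'.
have side t : t != s -> t != oppd s -> p (y + uvec s + uvec t) = p' (y + uvec s + uvec t).
  move=> ts tos.
  have e1 : e (p (y + uvec s)) (p (y + uvec s + uvec t)) by apply/(proj1 cp); exists t.
  have e2 : e (p (y + uvec t)) (p (y + uvec s + uvec t)).
    by apply/(proj1 cp); exists s; rewrite addrAC.
  rewrite ysE in e1; rewrite ysE in e2; rewrite eq_sym in ts.
  have [E|->] := chart_square0 r2 ch' ts e1 e2; last by rewrite addrA.
  have [inj _ _] := ch; have : p (y + (uvec s + uvec t)) = p (y + 0).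
    by rewrite addrA E !addr0 yE.
  move/inj; rewrite nrm0 (leq_trans (nrm_uvec2 _ _) r2) => /(_ isT isT)/eqP.
  by rewrite addrC addr_eq0 -uvec_opp => /eqP/uvec_inj E'; rewrite E' eqxx in tos.
move=> t; have [->|tos] := eqVneq t (oppd s); first by rewrite uvec_opp addrK.
have [->|ts] := eqVneq t s; last exact: side.
have : e (p (y + uvec s)) (p' (y + uvec s + uvec s)).
  by rewrite ysE; apply/(proj1 cp'); exists s.
move/(proj1 cp) => [u uE]; rewrite uE; have [-> //|us] := eqVneq u s.
have ch2 := cover_chart (y + uvec s) cp'.
have : p' (y + uvec s + uvec s) = p' (y + uvec s + uvec u).
  rewrite uE; have [->|uos] := eqVneq u (oppd s); last exact: side.
  by rewrite uvec_opp !addrK.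
by move/(chart_uvec_inj r2 ch2) => E; rewrite E eqxx in us.
Qed.

Lemma cover_same_base p p' : cover e r p -> cover e r p' -> p 0 = p' 0 ->
  exists2 b, signed b & forall y, p' y = p (y *m bmx b).
Proof.
move=> cp cp' p0.
have ch' : chart e r p' by have := cover_chart 0 cp'; under eq_fun do rewrite add0r.
have ch : chart e r p by have := cover_chart 0 cp; under eq_fun do rewrite add0r.
have [||| b hb bE] := @chart_signed _ _ _ _ r2 (fun t => p' (uvec t)) p ch.
- by move=> s t; apply: (chart_uvec_inj r2 ch').
- by move=> t; rewrite p0; apply: (chart_frame0 r2 _ ch').
- move=> t; left=> c e1 e2; rewrite p0.
  have tt : t != oppd t by rewrite eq_sym oppd_neq.
  by have [->//|->] := chart_square0 r2 ch' tt e1 e2; rewrite uvec_opp subrr.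
exists b => //; apply: cover_uniq => //; first exact: cover_bmx.
  by rewrite mul0mx.
by move=> s; rewrite bE uvec_bmx.
Qed.

Lemma cover_move p z z' : cover e r p -> p z = p z' ->
  exists2 b, signed b & forall y, p (z' + y) = p (z + y *m bmx b).
Proof.
move=> cp zz'; have := cover_same_base (cover_trans z cp) (cover_trans z' cp).
by rewrite !addr0 => /(_ zz').
Qed.

Lemma cover_neq p z s : cover e r p -> p (z + uvec s) <> p z.
Proof.
move=> [_ inj] /inj; rewrite addrAC subrr add0r nrm_uvec => /(_ isT)/eqP.
by rewrite -subr_eq0 addrAC subrr add0r (negbTE (uvec_neq0 s)).
Qed.

End Fixed.
End CoverTheory.

(** * Deck transformations *)

Section Deck.
Variables (d r : nat) (V : Type) (e : rel V) (p : 'rV[int]_d -> V).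
Hypotheses (r2 : (2 <= r)%N) (cp : cover e r p).
Implicit Types (a b : {perm dir d}) (z y u v w : 'rV[int]_d).

(** Equivalently, for signed [b], y |-> z + y *m bmx b^-1 is a deck transformation of [q], with
    translation part [z]. *)
Definition trans_part (q : 'rV[int]_d -> V) b z := forall y, q (z + y) = q (y *m bmx b).

Definition periods (q : 'rV[int]_d -> V) z := forall y, q (z + y) = q y.

Lemma periods0 : periods p 0.
Proof. by move=> y; rewrite add0r. Qed.

Lemma periodsN z : periods p z -> periods p (- z).
Proof. by move=> hz y; rewrite -hz addrA subrr add0r. Qed.

Lemma periodsD z y : periods p z -> periods p y -> periods p (z + y).
Proof. by move=> hz hy w; rewrite -addrA hz hy. Qed.

Lemma periodsB z y : periods p z -> periods p y -> periods p (z - y).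
Proof. by move=> hz /periodsN; apply: periodsD. Qed.

Lemma trans_part1 z : trans_part p 1%g z <-> periods p z.
Proof. by rewrite /trans_part bmx1; split=> hz y; move: (hz y); rewrite mulmx1. Qed.

Lemma trans_part_coset b v z : signed b -> trans_part p b v ->
  trans_part p b z <-> periods p (z - v).
Proof.
move=> hb hv; split=> [hz y|hz y].
  by rewrite -addrA hz -hv addrA subrr add0r.
have /= := hz (v + y); rewrite addrA subrK => ->; exact: hv.
Qed.

Lemma trans_partM a b u v : signed a -> signed b ->
  trans_part p a u -> trans_part p b v ->
  trans_part p (a * b)%g (u + v *m bmx a^-1%g).
Proof.
move=> ha hb hu hv y.
by rewrite -addrA hu mulmxDl -mulmxA bmxVK // mulmx1 hv bmxM // mulmxA.
Qed.

Lemma periods_bmx b v z : signed b -> trans_part p b v -> periods p z ->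
  periods p (z *m bmx b).
Proof.
move=> hb hv hz y; rewrite -{1}[y]mulmx1 -(bmxVK hb) mulmxA -mulmxDl -hv addrCA hz hv.
by rewrite -mulmxA bmxVK // mulmx1.
Qed.

(** Moving the origin conjugates the deck group by a translation, which changes translation parts by
    a coboundary. *)
Lemma trans_part_shift w b z : signed b ->
  trans_part (fun y => p (w + y)) b z <-> trans_part p b (z + w - w *m bmx b^-1%g).
Proof.
move=> hb; split=> hz y.
  have /= := hz (y - w *m bmx b^-1%g).
  rewrite mulmxBl -mulmxA bmxVK // mulmx1 [w + (_ *m _ - _)]addrC subrK => <-.
  by congr p; apply/rowP=> j; rewrite !mxE; ring.
have := hz (y + w *m bmx b^-1%g).
rewrite mulmxDl -mulmxA bmxVK // mulmx1 [w + _ *m _]addrC => <-.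
by congr p; apply/rowP=> j; rewrite !mxE; ring.
Qed.

(** The cover is regular: its fibres are the orbits of the deck group. Hence translation parts
    determine the quotient graph. *)
Lemma cover_kernel z z' : p z = p z' <->
  exists2 b, signed b & trans_part p b (z - z' *m bmx b^-1%g).
Proof.
split=> [zz'|[b hb hz]].
  have [b hb bE] := cover_move r2 cp (esym zz').
  exists b => // y; rewrite -addrA bE mulmxDl mulNmx -mulmxA bmxVK // mulmx1.
  by rewrite addrA subrr add0r.
have := hz (z' *m bmx b^-1%g).
by rewrite subrK -mulmxA bmxVK // mulmx1.
Qed.

End Deck.

Lemma cover_kernel_eq d r (V V' : Type) (e : rel V) (e' : rel V')
    (p : 'rV[int]_d -> V) (p' : 'rV[int]_d -> V') : (2 <= r)%N ->
  cover e r p -> cover e' r p' ->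
  (forall b z, signed b -> trans_part p b z <-> trans_part p' b z) ->
  forall z z', p z = p z' <-> p' z = p' z'.
Proof.
move=> r2 cp cp' E z z'; rewrite (cover_kernel r2 cp) (cover_kernel r2 cp').
by split=> -[b hb hz]; exists b => //; apply/E.
Qed.

(** * Absence of torsion, and the averaging operator of a signed permutation *)

Section Torsion.
Variables (d : nat).
Implicit Types (b : {perm dir d}) (z y u v w : 'rV[int]_d).

Lemma bmxE b z j : signed b -> let s := (b^-1)%g (j, false) in
  (z *m bmx b) 0 j = (-1) ^+ s.2 * z 0 s.1.
Proof.
move=> hb s; have scE (c : int) (x : 'rV[int]_d) k : (c *: x) 0 k = c * x 0 k by rewrite mxE.
rewrite {1 2}[z]vec_sum mulmx_suml !summxE mulr_sumr.
apply: eq_bigr => i _; rewrite -scalemxAl uvec_bmx // !(scE (z 0 i)) mulrCA uvec_dot;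
  congr (_ * _).
have := uvec_dot (j, false) (b (i, false)); rewrite /= expr0 mul1r => ->.
have /signedP hbV := signedV hb.
by rewrite -[(i, false) == oppd s]/(_) -hbV -!(can2_eq (permK b) (permKV b)).
Qed.

(** For signed [b], this is [#[b]] times the projection onto the vectors fixed by [b], unnormalised
    so as to stay integral. *)
Definition powsum b : 'M[int]_d := \sum_(i < #[b]%g) bmx (b ^+ i)%g.

Lemma powsum_bmx b : signed b -> powsum b *m bmx b = powsum b.
Proof.
move=> hb; rewrite /powsum mulmx_suml.
under eq_bigr do rewrite -bmxM ?signedX // -expgSr.
have: (0 < #[b]%g)%N by exact: order_gt0.
case E: #[b]%g => [//|n] _.
by rewrite big_ord_recr big_ord_recl /= -E expg_order expg0 addrC.
Qed.

Lemma bmx_powsum b : signed b -> bmx b *m powsum b = powsum b.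
Proof.
move=> hb; rewrite -{2}powsum_bmx // /powsum mulmx_suml mulmx_sumr.
by apply: eq_bigr => i _; rewrite -!bmxM ?signedX // -expgS expgSr.
Qed.

Lemma powsum_sqr b : signed b -> powsum b *m powsum b = #[b]%g%:R *: powsum b.
Proof.
move=> hb; rewrite {2}/powsum mulmx_sumr.
have E i : powsum b *m bmx (b ^+ i)%g = powsum b.
  elim: i => [|i IH]; first by rewrite expg0 bmx1 mulmx1.
  by rewrite expgSr bmxM ?signedX // mulmxA IH powsum_bmx.
by under eq_bigr do rewrite E; rewrite sumr_const card_ord -scaler_nat.
Qed.

Lemma round_div (s : int) (k : nat) : (0 < k)%N ->
  exists x, (2 * `|(s - k%:Z * x)%R| <= k)%N.
Proof.
(* The floor of s / k + 1 / 2, a nearest integer. *)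
move=> k0; exists ((2 * s + k%:Z) %/ (2 * k)%N%:Z)%Z.
have := divz_eq (2 * s + k%:Z) (2 * k)%N%:Z.
have := modz_ge0 (2 * s + k%:Z) (_ : (2 * k)%N%:Z != 0).
have := ltz_pmod (2 * s + k%:Z) (_ : 0 < (2 * k)%N%:Z).
move: (_ %% _)%Z (_ %/ _)%Z => m q h1 h2 E.
have {}h1 := h1 ltac:(lia); have {}h2 := h2 ltac:(lia).
nia.
Qed.

Lemma row_round z k : (0 < k)%N -> exists w, forall i, (2 * `|((z - k%:R *: w) 0 i)%R| <= k)%N.
Proof.
move=> k0; have /choice[f fP] : forall i, exists x, (2 * `|(z 0 i - k%:Z * x)%R| <= k)%N.
  by move=> i; apply: round_div.
by exists (\row_i f i) => i; rewrite !mxE; have := fP i; rewrite natz.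
Qed.

(* A nontrivial deck transformation of finite order would fix a point of R^d,
   hence move some lattice point by at most d. *)
Lemma powsum_neq0 r (V : Type) (e : rel V) (p : 'rV[int]_d -> V) b v : (2 <= r)%N ->
  (d <= (2 * r).+1)%N -> cover e r p -> signed b -> trans_part p b v -> b != 1%g ->
  powsum b != 0.
Proof.
move=> r2 dr [_ inj] hb hv; apply: contraNneq => S0.
pose k := #[b]%g; have k0 : (0 < k)%N by exact: order_gt0.
pose u := v *m bmx b.
(* Summation by parts: if the powers of [b] sum to 0, then s / k is a fixed point of the deck
   transformation x |-> x *m bmx b - u. *)
pose s := \sum_(i < k) (i%:R : int) *: (u *m bmx (b ^+ i)%g).
have sE : s *m bmx b - s = k%:R *: u.
  have -> : s *m bmx b - s = \sum_(i < k) ((i.+1%:R : int) *: (u *m bmx (b ^+ i.+1)%g) - (i%:R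
    : int) *: (u *m bmx (b ^+ i)%g))
     - u *m (powsum b *m bmx b).
    rewrite /s /powsum !mulmx_suml mulmx_sumr -!sumrB; apply: eq_bigr => i _.
    rewrite -scalemxAl -mulmxA -bmxM ?signedX // -expgSr.
    by rewrite -[in RHS]natr1 scalerDl scale1r addrAC addrK.
  rewrite S0 mul0mx mulmx0 subr0 -(big_mkord xpredT (fun i =>
    (i.+1%:R : int) *: (u *m bmx (b ^+ i.+1)%g) - (i%:R : int) *: (u *m bmx (b ^+ i)%g))).
  rewrite telescope_sumr // scale0r subr0.
  by rewrite expg_order bmx1 mulmx1.
have [x xP] := row_round s k0.
pose rho := s - k%:R *: x.
have E : k%:R *: (x *m bmx b - u - x) = rho - rho *m bmx b.
  rewrite !scalerBr -sE /rho mulmxBl -scalemxAl.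
  by rewrite !opprB !addrA; apply/rowP=> j; rewrite !mxE; ring.
(* In each coordinate, k times the displacement combines two rounding errors of size at most k / 2,
   so the coordinate moves by at most 1. *)
have dist : (nrm (x *m bmx b - u - x)%R <= d)%N.
  rewrite -[leqRHS]card_ord -sum1_card leq_sum // => j _.
  move/rowP/(_ j): E; rewrite [LHS]mxE [RHS]mxE [(- (rho *m _)) _ _]mxE bmxE //.
  set t := (b^-1)%g _; have := xP t.1; have := xP j; rewrite -/rho.
  move: ((x *m bmx b - u - x) 0 j) (rho 0 j) (rho 0 t.1) => c f g; rewrite natz.
  by case: t.2; rewrite ?expr1 ?expr0; nia.
have fixx : x *m bmx b - u = x.
  apply: inj; first exact: leq_trans dr.
  by rewrite -mulmxBl -hv addrC subrK.
(* A deck transformation fixing [x] permutes the neighbours of [x] within fibres, and these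
   neighbours have distinct images. *)
apply/eqP/permP => t; rewrite perm1; apply: uvec_inj; apply: (addrI x); apply: inj.
  rewrite opprD addrACA subrr add0r.
  by apply: leq_trans (nrmB _ _) _; rewrite !nrm_uvec; lia.
have -> : x + uvec (b t) = (x + uvec t - v) *m bmx b.
  by rewrite mulmxBl mulmxDl uvec_bmx // addrAC fixx.
by rewrite -hv addrC subrK.
Qed.

(** [uvec (b s) - uvec s] is killed by the sum S of the powers, and a nonzero row of S is killed by
    [#[b]] - S. The nonzero coordinates found here are those later erased from the two lattices. *)
Lemma powsum_eigen b : signed b -> b != 1%g -> powsum b != 0 ->
  (exists w i, w *m powsum b = 0 /\ w 0 i != 0) /\
  (exists w i, w *m powsum b = #[b]%g%:R *: w /\ w 0 i != 0).
Proof.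
move=> hb b1 S0; split.
  have [s bs] : exists s, b s != s.
    apply: contrapT => nb; case/eqP: b1; apply/permP => s; rewrite perm1.
    by apply: contrapT => bs; apply: nb; exists s; apply/eqP.
  have : uvec (b s) - uvec s != 0 by rewrite subr_eq0 (inj_eq (@uvec_inj _)).
  case/rV0Pn => i wi; exists (uvec (b s) - uvec s), i; split=> //.
  by rewrite mulmxBl -uvec_bmx // -mulmxA bmx_powsum // subrr.
have [i Si] : exists i, row i (powsum b) != 0.
  apply: contrapT => nS; case/eqP: S0; apply/row_matrixP => i; rewrite row0.
  by apply: contrapT => Si; apply: nS; exists i; apply/eqP.
case/rV0Pn: Si => j wj; exists (row i (powsum b)), j; split=> //.
by rewrite -row_mul powsum_sqr // linearZ.
Qed.

End Torsion.

(** * Hermite normal forms *)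

Section Hermite.
Variables (d : nat).
Implicit Types (H : 'rV[int]_d -> Prop) (s : pred 'I_d) (A B : 'M[int]_d) (y z t : 'rV[int]_d).

Definition subgroup H := H 0 /\ forall z y, H z -> H y -> H (z - y).

Lemma subgroupN H z : subgroup H -> H z -> H (- z).
Proof. by move=> [H0 HB] hz; rewrite -[- z]add0r; apply: HB. Qed.

Lemma subgroupD H z y : subgroup H -> H z -> H y -> H (z + y).
Proof. by move=> sH hz hy; rewrite -[y]opprK; apply: (proj2 sH) => //; apply: subgroupN. Qed.

Lemma subgroupZ H n z : subgroup H -> H z -> H (n *: z).
Proof.
move=> sH hz; have hn (k : nat) : H (k%:Z *: z).
  elim: k => [|k IH]; first by rewrite scale0r; case: sH.
  by rewrite intS scalerDl scale1r; apply: subgroupD.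
by case: n => n //; rewrite NegzE scaleNr; exact: subgroupN (hn _).
Qed.

Lemma subgroup_comb H t A : subgroup H -> (forall i, H (row i A)) -> H (t *m A).
Proof.
move=> sH hA; rewrite mulmx_sum_row.
elim/big_ind: _ => [|x y|i _]; [by case: sH|exact: subgroupD|exact: subgroupZ].
Qed.

Definition supported s y := forall i, ~~ s i -> y 0 i = 0.

Definition triangular s A := [/\ forall i, s i -> 0 < A i i,
  forall i j : 'I_d, (i < j)%N -> A i j = 0 & forall i j, ~~ s j -> A i j = 0].

(** Coordinates are reduced from the last to the first: by triangularity, earlier rows do not
    disturb those already reduced. *)
Lemma triangular_reduce s A k y : triangular s A ->
  exists t, (forall j : 'I_d, (k <= j)%N -> t 0 j = 0) /\
    (forall j : 'I_d, s j -> (j < k)%N -> 0 <= (y - t *m A) 0 j < A j j).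
Proof.
move=> [Apos Aup As]; elim: k y => [|k IH] y; first by exists 0; split=> [j _|j sj]; rewrite ?mxE.
have [kd|kd] := ltnP k d; last first.
  have [t [tk tP]] := IH y; exists t; split=> j; first by have := ltn_ord j; lia.
  by move=> sj _; apply: tP => //; apply: leq_trans kd.
pose i := Ordinal kd; pose q := (y 0%R i %/ A i i)%Z.
have [t [tk tP]] := IH (y - q *: row i A).
exists (t + q *: delta_mx 0 i); split=> j jk.
  rewrite !mxE tk ?add0r; last exact: ltnW.
  by have [ji|_] := eqVneq j i; rewrite ?andbF ?mulr0 //; move: jk; rewrite ji /= ltnn.
have E : y - (t + q *: delta_mx 0 i) *m A = y - q *: row i A - t *m A.
  by rewrite mulmxDl -scalemxAl -rowE opprD addrA addrAC.
rewrite E ltnS leq_eqVlt => /orP[/eqP ji|]; last exact: tP.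
have {ji} ji : j = i by apply: val_inj.
have -> : (y - q *: row i A - t *m A) 0 j = y 0 i - q * A i i.
  have tA0 : (t *m A) 0 i = 0.
    rewrite mxE big1 // => l _; have [/tk ->|li] := leqP k l; first by rewrite mul0r.
    by rewrite Aup ?mulr0.
  by rewrite ji mxE [(- (t *m A)) _ _]mxE tA0 !mxE; ring.
rewrite ji in jk *; have := Apos _ jk => a0.
have -> : y 0 i - q * A i i = (y 0%R i %% A i i)%Z by rewrite /q {1}(divz_eq (y 0 i) (A i i))
  addrAC subrr add0r.
by rewrite modz_ge0 ?gt_eqF //= ltz_pmod.
Qed.

(** Spanning is encoded by the last clause, that no nonzero vector of [H] supported on [s] lies
    below all pivots. It yields [hermite_span], and also makes the box of pivot sizes inject modulo
    [H], which bounds the product of the pivots. *)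
Definition hermite s H B := [/\ triangular s B, forall i, H (row i B),
  forall i j : 'I_d, s j -> (j < i)%N -> 0 <= B i j < B j j,
  forall i j, ~~ s i -> B i j = 0 &
  forall y, H y -> supported s y -> (forall i, s i -> (`|y 0%R i| < `|B i i|)%N) -> y = 0].

Lemma hermite_span s H B y : subgroup H -> hermite s H B -> H y -> supported s y ->
  exists t, y = t *m B.
Proof.
move=> sH [tB HB _ _ B0] hy sy; have [t [_ tP]] := triangular_reduce d y tB.
have [Bpos _ Bs] := tB; exists t; apply/eqP; rewrite -subr_eq0; apply/eqP; apply: B0.
- by apply: (proj2 sH) => //; apply: subgroup_comb.
- move=> i si; rewrite !mxE sy // big1 ?subr0 // => j _.
  by rewrite Bs // mulr0.
by move=> i si; have := tP i si (ltn_ord i); move: ((y - t *m B) 0 i) (B i i) => c b; lia.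
Qed.

(** The i-th pivot is the least positive i-th coordinate among vectors of [H] supported on [s] and
    vanishing beyond i; N times a unit vector shows that one exists. A second pass reduces each row
    by the earlier ones. *)
Lemma hermite_ex s H N : subgroup H -> (0 < N)%N -> (forall z, H (N%:Z *: z)) ->
  exists B, hermite s H B.
Proof.
move=> sH N0 HN.
pose P (i : 'I_d) (n : nat) := `[< (0 < n)%N /\ exists y, [/\ H y, supported s y,
  forall j : 'I_d, (i < j)%N -> y 0 j = 0 & y 0 i = n%:Z] >].
have Pex (i : 'I_d) : s i -> exists n, P i n.
  move=> si; exists N; apply/asboolP; split=> //; exists (N%:Z *: delta_mx 0 i).
  split=> // [j sj|j ij|]; rewrite !mxE ?eqxx /= ?mulr1 //.
    by have [ji|_] := eqVneq j i; rewrite ?mulr0 //; rewrite ji si in sj.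
  by have [ji|_] := eqVneq j i; rewrite ?mulr0 //; rewrite ji ltnn in ij.
have /choice[f fP] : forall i, exists y, if s i then [/\ H y, supported s y,
    forall j : 'I_d, (i < j)%N -> y 0 j = 0, 0 < y 0 i &
    forall n, P i n -> (`|y 0%R i| <= n)%N] else y = 0.
  move=> i; have [si|] := boolP (s i); last by exists 0.
  case: (ex_minnP (Pex i si)) => n /asboolP[n0 [y [hy sy yj yi]]] nmin.
  by exists y; split=> //; rewrite yi.
pose A : 'M[int]_d := \matrix_i f i.
have tA : triangular s A.
  split=> [i si|i j ij|i j sj]; rewrite mxE; have := fP i.
  - by rewrite si => -[].
  - by case: ifP => [_ [_ _ fi _ _]|_ ->]; rewrite ?mxE ?fi.
  - by case: ifP => [_ [_ fi _ _ _]|_ ->]; rewrite ?mxE ?fi.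
have HA i : H (row i A).
  by rewrite rowK; have := fP i; case: ifP => [_ []//|_ ->]; case: sH.
have A0 y : H y -> supported s y -> (forall i, s i -> (`|y 0%R i| < `|A i i|)%N) -> y = 0.
  move=> hy sy ylt; apply: contrapT => /eqP /rV0Pn[i0 yi0].
  case: (@arg_maxnP _ i0 (fun i => y 0 i != 0) val yi0) => i yi imax.
  have si : s i by apply: contraNT yi => /sy ->.
  have := fP i; rewrite si => -[_ _ _ _ /(_ `|y 0%R i|%N)].
  have Pi : P i `|y 0%R i|%N.
    apply/asboolP; split; first by rewrite absz_gt0.
    have yj (j : 'I_d) : (i < j)%N -> y 0 j = 0.
      by move=> ij; apply: contraTeq ij => /imax; rewrite -leqNgt.
    have [y0|y0] := leP 0 (y 0 i).
      by exists y; split=> //; rewrite gez0_abs.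
    exists (- y); split=> [|j /sy yj0|j /yj yj0|]; rewrite ?mxE ?yj0 ?oppr0 //.
      exact: subgroupN.
    by rewrite ltz0_abs.
  move/(_ Pi); have := ylt i si; rewrite mxE; lia.
have /choice[g gP] : forall i : 'I_d, exists t, (forall j : 'I_d, (i <= j)%N -> t 0 j = 0) /\
    (forall j : 'I_d, s j -> (j < i)%N -> 0 <= (row i A - t *m A) 0 j < A j j).
  by move=> i; apply: triangular_reduce.
have [Apos Aup As] := tA.
pose B : 'M[int]_d := \matrix_i (if s i then row i A - g i *m A else 0).
have BE (i j : 'I_d) : (i <= j)%N -> B i j = A i j.
  move=> ij; rewrite mxE; case: ifP => [si|si].
    have gA0 : (g i *m A) 0 j = 0.
      rewrite mxE big1 // => l _; have [/(proj1 (gP i)) ->|li] := leqP i l;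
        first by rewrite mul0r.
      by rewrite Aup ?mulr0 //; apply: leq_trans ij.
    by rewrite [LHS]mxE [(- (g i *m A)) _ _]mxE gA0 subr0 [LHS]mxE.
  by have := fP i; rewrite si => fi; rewrite !mxE fi mxE.
exists B; split.
- split=> [i si|i j ij|i j sj]; first by rewrite BE // Apos.
    by rewrite BE ?Aup // ltnW.
  rewrite mxE; case: ifP => _; last by rewrite mxE.
  have gA0 : (g i *m A) 0 j = 0 by rewrite mxE big1 // => l _; rewrite As // mulr0.
  by rewrite mxE [(- (g i *m A)) _ _]mxE gA0 subr0 [LHS]mxE As.
- move=> i; rewrite rowK; case: ifP => _; last by case: sH.
  by apply: (proj2 sH) => //; apply: subgroup_comb.
- move=> i j sj ji; rewrite [B j j]BE // mxE; case: ifP => si; first exact: (proj2 (gP i)).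
  by rewrite mxE lexx Apos.
- by move=> i j /negbTE si; rewrite mxE si mxE.
by move=> y hy sy ylt; apply: A0 => // i si; rewrite -BE ?ylt.
Qed.

End Hermite.

(** * Counting Hermite normal forms *)

Section Counting.

Lemma sum_recip_dyadic n :
  (\sum_(1 <= a < 2 ^ n) (a%:R^-1 : rat) <= n%:R)%R.
Proof.
elim: n => [|n IH]; first by rewrite expn0 big_geq.
have le2 : (1 <= 2 ^ n <= 2 ^ n.+1)%N by rewrite expn_gt0 leq_exp2l ?leqnSn.
rewrite (@big_cat_nat _ _ _ (2 ^ n)) /=; try by case/andP: le2.
rewrite -natr1 lerD //.
apply: (@le_trans _ _ (\sum_(2 ^ n <= a < 2 ^ n.+1) ((2 ^ n)%:R^-1 : rat))).
  rewrite big_nat [leRHS]big_nat; apply: ler_sum => a /andP[na _].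
  by rewrite lef_pV2 ?ler_nat // posrE ltr0n ?(leq_trans _ na) // expn_gt0.
rewrite sumr_const_nat expnS mul2n -addnn addnK -[X in X *+ _]mulr1 -mulrnAr.
by rewrite mulVf // pnatr_eq0 -lt0n expn_gt0.
Qed.

Definition lg x := (trunc_log 2 x).+1.

(** Each tuple is given the weight x / prod g >= 1; the total weight is at most x times a power of a
    harmonic sum, itself at most [lg x] by dyadic blocks. *)
Lemma count_prod (I : finType) x :
  (#|[set g : {ffun I -> 'I_x.+1} | [forall i, (0 < g i)%N] && (\prod_i g i <= x)%N]%SET|
     <= x * lg x ^ #|I|)%N.
Proof.
set A := finset _.
have Apos g i : g \in A -> (0 < g i)%N by rewrite inE => /andP[/forallP /(_ i)].
have Ale g : g \in A -> (\prod_i g i <= x)%N by rewrite inE => /andP[_].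
pose F (k : 'I_x.+1) : rat := if (0 < k)%N then k%:R^-1 else 0.
have F0 k : 0 <= F k by rewrite /F; case: ifP => // _; rewrite invr_ge0 ler0n.
have sumF : \sum_k F k <= (lg x)%:R.
  rewrite -(big_mkord xpredT (fun k => if (0 < k)%N then (k%:R^-1 : rat) else 0)).
  rewrite big_ltn // add0r.
  apply: le_trans (sum_recip_dyadic (lg x)).
  have xl : (x.+1 <= 2 ^ lg x)%N by apply: trunc_log_ltn.
  rewrite [leRHS](@big_cat_nat _ _ _ x.+1) //= -[leLHS]addr0 lerD ?sumr_ge0 //.
  rewrite le_eqVlt; apply/orP; left; apply/eqP; apply: eq_big_nat => k /andP[k0 _].
  by rewrite k0.
suff : (#|A|%:R : rat) <= (x * lg x ^ #|I|)%N%:R by rewrite ler_nat.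
rewrite natrM natrX -sum1_card natr_sum.
apply: (@le_trans _ _ (\sum_(g in A) (x%:R * \prod_i F (g i)))).
  apply: ler_sum => g gA.
  have -> : \prod_i F (g i) = ((\prod_i g i)%N%:R)^-1.
    by rewrite natr_prod -prodfV; apply: eq_bigr => i _; rewrite /F Apos.
  by rewrite ler_pdivlMr ?mul1r ?ler_nat ?Ale // ltr0n prodn_gt0 // => i; apply: Apos.
rewrite -mulr_sumr ler_wpM2l //.
apply: (@le_trans _ _ (\sum_(g : {ffun I -> 'I_x.+1}) \prod_i F (g i))).
  rewrite [leRHS](bigID (mem A)) /= lerDl sumr_ge0 // => g _.
  by rewrite prodr_ge0.
rewrite -(bigA_distr_bigA (fun _ k => F k)) prodr_const.
by apply: lerXn2r; rewrite ?nnegrE ?sumr_ge0 ?ler0n.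
Qed.

Variables (d x : nat).
Hypothesis d2 : (2 <= d)%N.

Let code := {ffun bool * ('I_d * 'I_d) -> 'I_x.+1}.

Definition diag_weight (i0 : bool -> 'I_d) (g : code) (k : bool * 'I_d) : nat :=
  if k.2 == i0 k.1 then 1%N else g (k.1, (k.2, k.2)).

(* Pairs of Hermite matrices, the c-th one with row and column i0 c erased. *)
Definition hermite_codes (i0 : bool -> 'I_d) : {set code} :=
  [set g : code | [&& [forall k, (0 < diag_weight i0 g k)%N],
     (\prod_k diag_weight i0 g k <= x)%N &
     [forall k : bool * ('I_d * 'I_d), let: (c, (i, j)) := k in
        if [&& i != i0 c, j != i0 c & (j < i)%N] then (g k < diag_weight i0 g (c, j))%N
        else if [&& i != i0 c & i == j] then true else g k == ord0]]]%SET.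

(** The two diagonals can be chosen in at most x * lg x ^ (2d) ways. Below a pivot w there are at
    most d-2 free entries, since the rows of the pivot and of [i0 c] are excluded, each with w
    values; the product of all w ^ (d-2) is at most x ^ (d-2). *)
Lemma card_hermite_codes i0 :
  (#|hermite_codes i0| <= x ^ d.-1 * lg x ^ (2 * d))%N.
Proof.
pose W : {set {ffun bool * 'I_d -> 'I_x.+1}} :=
  [set w : {ffun bool * 'I_d -> 'I_x.+1} | [forall i, (0 < w i)%N] && (\prod_i w i <= x)%N]%SET.
have cardW : (#|W| <= x * lg x ^ (2 * d))%N.
  by have := @count_prod (bool * 'I_d)%type x; rewrite card_prod card_bool card_ord.
pose wt (g : code) : {ffun bool * 'I_d -> 'I_x.+1} := [ffun k => inord (diag_weight i0 g k)].
have wtE g k : g \in hermite_codes i0 -> wt g k = diag_weight i0 g k :> nat.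
  rewrite inE => /and3P[/forallP gpos gx _]; rewrite ffunE inordK // ltnS.
  apply: leq_trans gx; rewrite (bigD1 k) //= leq_pmulr //.
  by rewrite prodn_gt0 // => l; apply: gpos.
have wtW g : g \in hermite_codes i0 -> wt g \in W.
  move=> gA; have := gA; rewrite !inE => /and3P[/forallP gpos gx _].
  apply/andP; split; first by apply/forallP=> k; rewrite wtE.
  by under eq_bigr do rewrite wtE //.
rewrite -sum1_card (partition_big wt (mem W)) //=.
apply: (@leq_trans (\sum_(w in W) x ^ d.-2)); last first.
  rewrite sum_nat_const mulnC; apply: leq_trans (leq_mul (leqnn _) cardW) _.
  by rewrite mulnA -expnSr; case: (d) d2 => [|[|n]].
apply: leq_sum => w; rewrite inE => /andP[/forallP wpos wx].
pose F (k : bool * ('I_d * 'I_d)) : pred 'I_x.+1 := let: (c, (i, j)) := k in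
  if [&& i != i0 c, j != i0 c & (j < i)%N] then [pred a : 'I_x.+1 | (a < w (c, j))%N]
  else if [&& i != i0 c & i == j] then pred1 (w (c, j)) else pred1 ord0.
rewrite sum1_card.
apply: (@leq_trans #|(family F : simpl_pred code)|).
  apply: subset_leq_card; apply/fintype.subsetP => g /andP[gA /eqP gw].
  apply/familyP => -[c [i j]]; have := gA; rewrite inE => /and3P[_ _ /forallP /(_ (c, (i, j)))].
  rewrite /F -gw; case: ifP => [_|_]; first by rewrite inE wtE.
  case: ifP => [/andP[ii /eqP ij] _|_ /eqP ->]; last by rewrite inE.
  rewrite inE -val_eqE /= wtE // /diag_weight /= -ij (negbTE ii) //.
rewrite card_family foldrE big_map big_enum /=.
have cardF c i j : (#|F (c, (i, j))| <= if [&& i != i0 c, j != i0 c & (j < i)%N] then (w (c,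
  j) : nat) else 1)%N.
  rewrite /F; case: ifP => _; last by case: ifP => _; rewrite card1.
  rewrite -[leqRHS]card_ord -(card_codom (f := fun a : 'I_(w (c, j)) => inord a : 'I_x.+1)).
    apply: subset_leq_card; apply/fintype.subsetP => a; rewrite inE => aw.
    by apply/codomP; exists (Ordinal aw); rewrite /= inord_val.
  move=> a b /(congr1 val); rewrite /= !inordK; first exact: val_inj.
    by rewrite ltnS (leq_trans (ltnW (ltn_ord b))) // -ltnS.
  by rewrite ltnS (leq_trans (ltnW (ltn_ord a))) // -ltnS.
apply: (@leq_trans (\prod_(k : bool * 'I_d) w k ^ d.-2)); last first.
  rewrite -(big_morph (expn^~ d.-2) (fun a b => expnMn a b d.-2) (exp1n d.-2)).
  by case: (d.-2) => // n; rewrite leq_exp2r.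
rewrite (eq_bigr (fun k => #|F (k.1, (k.2.1, k.2.2))|)); last by move=> [c [i j]].
rewrite [leqRHS](eq_bigr (fun k => w (k.1, k.2) ^ d.-2)%N); last by move=> [c j].
rewrite -(pair_bigA _ (fun c ij => #|F (c, (ij.1, ij.2))|)) /=.
rewrite -(pair_bigA _ (fun c j => w (c, j) ^ d.-2)%N) /=.
apply: leq_prod => c _.
rewrite -(pair_bigA _ (fun i j => #|F (c, (i, j))|)) /= exchange_big /=.
apply: leq_prod => j _.
apply: (@leq_trans (\prod_i if [&& i != i0 c, j != i0 c & (j < i)%N] then (w (c,
  j) : nat) else 1)).
  by apply: leq_prod => i _; apply: cardF.
rewrite -big_mkcond /= prod_nat_const leq_pexp2l //.
have [ji|ji] := eqVneq j (i0 c).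
  by rewrite (eq_card (_ : _ =i pred0)) ?card0 // => i; rewrite unfold_in /= andbF.
apply: (@leq_trans #|[predC [:: j; i0 c]]|).
  apply: subset_leq_card; apply/fintype.subsetP => i; rewrite !inE => /and3P[ii _ lt_ji].
  by rewrite (negbTE ii) orbF; apply: contraTneq lt_ji => ->; rewrite ltnn.
rewrite -[d.-2]/(d.-2) -(leq_add2l #|[:: j; i0 c]|) cardC card_ord.
have -> : #|[:: j; i0 c]| = 2 by rewrite (card_uniqP _) //= inE ji.
by case: (d) d2 => [|[|n]].
Qed.

End Counting.

(** * Lattices invariant under a signed permutation *)

Lemma card_ord_below n w : (w <= n)%N -> #|[pred a : 'I_n | (a < w)%N]| = w.
Proof.
by move=> wn; rewrite -sum1_card -(big_ord_widen n (fun=> 1%N) wn) sum1_card card_ord.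
Qed.

(** Pigeonhole: a multiple of [z] by some positive integer up to [#|O|] lies in [H], and the
    factorial is a common multiple for all [z]. *)
Lemma subgroup_finite_index d (H : 'rV[int]_d -> Prop) (O : finType) (f : 'rV[int]_d -> O) :
  subgroup H -> (forall z y, f z = f y -> H (z - y)) ->
  forall z, H (((#|O|)`!)%:Z *: z).
Proof.
move=> sH fH z; pose h (i : 'I_#|O|.+1) := f (i%:Z *: z).
have : ~~ injectiveb h.
  apply/injectiveP => /leq_card; by rewrite card_ord ltnn.
case/injectivePn => i [j ij hij].
wlog lt_ij : i j ij hij / (j < i)%N.
  move=> W; case: (ltngtP i j) => [lt|lt|/val_inj E].
  - by apply: (W j i) => //; rewrite eq_sym.
  - exact: W ij hij lt.
  - by rewrite E eqxx in ij.
have /dvdnP[m ->] : (i - j %| (#|O|)`!)%N.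
  by rewrite dvdn_fact // subn_gt0 lt_ij leq_subLR -ltnS (leq_trans (ltn_ord i)) // ltnS leq_addl.
rewrite PoszM -scalerA; apply: subgroupZ => //.
by rewrite -subzn ?(ltnW lt_ij) // scalerBl; apply: fH.
Qed.

(** The size n is kept apart from the modulus so that one code type serves all q <= n. *)
Definition residue d n (q : nat) (t : 'rV[int]_d) : 'rV['I_n.+1]_d :=
  \row_i inord `|(t 0%R i %% q%:Z)%Z|%N.

Lemma residue_eq d n q (t t' : 'rV[int]_d) : (0 < q)%N -> (q <= n)%N ->
  residue n q t = residue n q t' -> exists u, t = t' + q%:R *: u.
Proof.
move=> q0 qn E; exists (\row_i ((t 0%R i %/ q%:Z)%Z - (t' 0%R i %/ q%:Z)%Z)).
apply/rowP=> i; have /rowP/(_ i)/(congr1 val) := E; rewrite !mxE natz /=.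
have q0' : q%:Z != 0 by rewrite eqz_nat -lt0n.
have := divz_eq (t 0 i) q%:Z; have := divz_eq (t' 0 i) q%:Z.
have := modz_ge0 (t 0 i) q0'; have := modz_ge0 (t' 0 i) q0'.
have := ltz_pmod (t 0 i) (q0 : 0 < q%:Z); have := ltz_pmod (t' 0 i) (q0 : 0 < q%:Z).
move: (t 0%R i %% q%:Z)%Z (t' 0%R i %% q%:Z)%Z (t 0%R i %/ q%:Z)%Z (t' 0%R i %/ q%:Z)%Z =>
  m m' a a'.
move=> h1 h2 h3 h4 -> ->; rewrite !inordK; nia.
Qed.

Section SplitLattice.
Variables (d n x : nat) (S : 'M[int]_d) (k : nat).
Hypotheses (k0 : (0 < k)%N) (SS : S *m S = k%:R *: S).

Definition proj_mx (c : bool) := if c then k%:R%:M - S else S.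

Definition code_mx (g : {ffun bool * ('I_d * 'I_d) -> 'I_x.+1}) c : 'M[int]_d :=
  \matrix_(i, j) (g (c, (i, j)) : nat)%:Z.

(** Membership of [y] is decided by coefficients of [q y] in the two projected lattices, and only
    through their residues modulo q; [R] lists the admissible residues. *)
Definition code_lattice (q : nat) (g : {ffun bool * ('I_d * 'I_d) -> 'I_x.+1})
    (R : {set 'rV['I_n.+1]_d * 'rV['I_n.+1]_d}) (y : 'rV[int]_d) :=
  exists t1 t2 : 'rV[int]_d,
    q%:R *: y = t1 *m code_mx g false *m proj_mx false + t2 *m code_mx g true *m proj_mx true
    /\ (residue n q t1, residue n q t2) \in R.

Variables (i0 : bool -> 'I_d) (w : bool -> 'rV[int]_d).
Hypotheses (w1 : w false *m S = 0) (w2 : w true *m S = k%:R *: w true).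
Hypotheses (wpos : forall c, 0 < w c 0 (i0 c)).

(** The factor k comes from y S + y (k - S) = k y, the other two from clearing coordinate [i0 c] of
    y by a multiple of [w c]. *)
Definition split_index := (k * `|w false 0%R (i0 false)| * `|w true 0%R (i0 true)|)%N.

Hypothesis (qn : (split_index <= n)%N).

Variables (L : 'rV[int]_d -> Prop) (O : finType) (f : 'rV[int]_d -> O) (A : {set O}).
Hypotheses (sL : subgroup L) (LS : forall z, L z -> L (z *m S)).
Hypotheses (fL : forall z y, f z = f y -> L (z - y)) (fA : forall z, f z \in A).
Hypothesis (Ax : (#|A| <= x)%N).

(* The lattice L contains with bounded index the sum of the images under S and
   k - S of two lattices of rank d - 1. *)
Lemma split_lattice_code :
  exists2 g, g \in hermite_codes x i0 & exists R, forall y,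
    L y <-> code_lattice split_index g R y.
Proof.
have LT z : L z -> L (z *m (k%:R%:M - S)).
  move=> hz; rewrite mulmxBr mul_mx_scalar; apply: (proj2 sL); last exact: LS.
  by rewrite natz; apply: subgroupZ.
have Lproj c z : L z -> L (z *m proj_mx c) by case: c; [exact: LT|exact: LS].
pose H c y := L (y *m proj_mx c).
have sH c : subgroup (H c).
  split; first by rewrite /H mul0mx; case: sL.
  by move=> z y hz hy; rewrite /H mulmxBl; apply: (proj2 sL).
(* As [w c] is in the kernel of [proj_mx c], coordinate [i0 c] can be cleared up to a bounded
   factor; this is the drop to rank d-1. *)
pose s c : pred 'I_d := predC1 (i0 c).
have /choice[B BP] : forall c, exists B, hermite (s c) (H c) B.
  move=> c; apply: (@hermite_ex _ _ _ (#|O|)`!) => //; first exact: fact_gt0.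
  by move=> z; rewrite /H -scalemxAl; apply: subgroup_finite_index fL _.
pose wt (c : bool * 'I_d) := if c.2 == i0 c.1 then 1%N else `|B c.1 c.2 c.2|%N.
have wt_gt0 c : (0 < wt c)%N.
  rewrite /wt; case: eqP => // /eqP ci; have [[Bpos _ _] _ _ _ _] := BP c.1.
  by have := Bpos c.2 ci; lia.
(* The joint box of both pivot systems injects modulo [L]: applying S annihilates the second part
   and isolates the first, after which the second is separated. *)
have wtx : (\prod_c wt c <= x)%N.
  pose M := \sum_c wt c.
  have wtM c : (wt c <= M.+1)%N by rewrite /M (bigD1 c) //= -addnS leq_addr.
  pose F (c : bool * 'I_d) : pred 'I_M.+1 := [pred a : 'I_M.+1 | (a < wt c)%N].
  pose box : {set {ffun bool * 'I_d -> 'I_M.+1}} := [set h | h \in family F]%SET.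
  have -> : \prod_c wt c = #|box|.
    rewrite cardsE card_family foldrE big_map big_enum /=.
    by apply: eq_bigr => c _; rewrite card_ord_below.
  apply: leq_trans Ax.
  pose row_of (h : {ffun bool * 'I_d -> 'I_M.+1}) c : 'rV[int]_d :=
     \row_j (if j == i0 c then 0 else (h (c, j) : nat)%:Z).
  pose F' h := f (row_of h false + row_of h true *m proj_mx true).
  have lt_wt h c j : h \in box -> (h (c, j) < wt (c, j))%N.
    by rewrite inE => /familyP /(_ (c, j)); rewrite inE.
  have row_inj h h' c : h \in box -> h' \in box -> H c (row_of h c - row_of h' c) ->
      row_of h c = row_of h' c.
    move=> hb hb' hH; apply/eqP; rewrite -subr_eq0; apply/eqP.
    have [_ _ _ _] := BP c; apply=> // i.
      by rewrite /s /= negbK => /eqP ->; rewrite !mxE eqxx subrr.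
    rewrite /s /= => /negbTE ii; have := lt_wt _ c i hb; have := lt_wt _ c i hb'.
    rewrite /wt /= ii !mxE ii; move: (B c i i) (h _ : nat) (h' _ : nat) => *; lia.
  rewrite -(card_in_imset (f := F')); first by apply: subset_leq_card;
    apply/fintype.subsetP => _ /imsetP[h _ ->]; exact: fA.
  move=> h h' hb hb' /fL.
  rewrite opprD addrACA -mulmxBl => hL.
  have ST : (k%:R%:M - S) *m S = 0.
    by rewrite mulmxBl mul_scalar_mx SS subrr.
  have E1 : row_of h false = row_of h' false.
    apply: row_inj => //; have := LS hL.
    by rewrite mulmxDl -mulmxA ST mulmx0 addr0.
  have E2 : row_of h true = row_of h' true.
    by apply: row_inj => //; move: hL; rewrite E1 subrr add0r.
  apply/ffunP => -[c j]; apply: val_inj.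
  have [ji|ji] := eqVneq j (i0 c).
    by have := lt_wt _ c j hb; have := lt_wt _ c j hb'; rewrite /wt /= ji eqxx; lia.
  have : row_of h c = row_of h' c by case: c ji.
  by move/rowP/(_ j); rewrite !mxE (negbTE ji) => -[].
have wt_le c : (wt c <= x)%N.
  by apply: leq_trans wtx; rewrite (bigD1 c) //= leq_pmulr // prodn_gt0.
have Bge0 c i j : 0 <= B c i j <= x%:Z.
  have [[Bpos Bup Bs] _ Blow Bs' _] := BP c.
  have [sj|/Bs ->] := boolP (s c j); last by rewrite lexx.
  have [si|/Bs' ->] := boolP (s c i); last by rewrite lexx.
  have := wt_le (c, j); rewrite /wt /= (negbTE sj) => Bx; have := Bpos j sj.
  have [ij|ji|/val_inj ->] := ltngtP i j; first by rewrite (Bup i j) ?lexx.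
    by have := Blow _ _ sj ji; lia.
  by lia.
pose g : {ffun bool * ('I_d * 'I_d) -> 'I_x.+1} := [ffun l => inord `|B l.1 l.2.1 l.2.2|%N].
have gE c i j : (g (c, (i, j)) : nat) = `|B c i j|%N.
  by rewrite ffunE /= inordK //; have := Bge0 c i j; lia.
have gB c : code_mx g c = B c.
  by apply/matrixP => i j; rewrite mxE gE gez0_abs //; case/andP: (Bge0 c i j).
have gwt l : diag_weight i0 g l = wt l by rewrite /diag_weight /wt -gE; case: l.
exists g.
  rewrite inE; apply/and3P; split.
  - by apply/forallP=> l; rewrite gwt.
  - by under eq_bigr do rewrite gwt.
  apply/forallP => -[c [i j]]; rewrite gwt.
  have [[Bpos Bup Bs] _ Blow Bs' _] := BP c.
  have [si|/negPn/eqP si] := boolP (i != i0 c); last first.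
    by rewrite /= -val_eqE /= gE Bs' //; rewrite /s /= si negbK eqxx.
  have [sj|/negPn/eqP sj] := boolP (j != i0 c); last first.
    by case: (i == j) => //=; rewrite -val_eqE /= gE Bs // /s /= sj negbK eqxx.
  have [ji|ij] := ltnP j i.
    by rewrite /= gE /wt /= (negbTE sj); have := Blow _ _ sj ji; lia.
  have [//|/= nij] := eqVneq i j; rewrite /=.
  by rewrite /= -val_eqE /= gE Bup // ltn_neqAle ij andbT.
set q := split_index.
have q0 : (0 < q)%N.
  by rewrite /q /split_index; have := wpos false; have := wpos true; nia.
pose R := [set rr : 'rV['I_n.+1]_d * 'rV['I_n.+1]_d | `[< exists t1 t2 y, [/\ L y,
   q%:R *: y = t1 *m B false *m proj_mx false + t2 *m B true *m proj_mx true &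
   rr = (residue n q t1, residue n q t2)] >]]%SET.
have LB c t : L (t *m B c *m proj_mx c).
  have [_ HB _ _ _] := BP c; exact: (subgroup_comb t (sH c) HB).
exists R => y; split.
  move=> hy.
  pose z c := w c 0 (i0 c) *: y - y 0 (i0 c) *: w c.
  have zproj c : z c *m proj_mx c = w c 0 (i0 c) *: (y *m proj_mx c).
    rewrite /z mulmxBl -!scalemxAl; apply/eqP; rewrite -subr_eq0 addrAC subrr add0r oppr_eq0.
    case: c => /=; last by rewrite w1 scaler0.
    by rewrite mulmxBr w2 mul_mx_scalar subrr scaler0.
  have /choice[t tE] : forall c, exists t, z c = t *m B c.
    move=> c; apply: (hermite_span (sH c) (BP c)).
      by rewrite /H zproj; apply: subgroupZ => //; apply: Lproj.
    by move=> i /negPn/eqP ->; rewrite !mxE mulrC subrr.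
  exists (w true 0 (i0 true) *: t false), (w false 0 (i0 false) *: t true).
  have E : q%:R *: y = w true 0 (i0 true) *: t false *m B false *m proj_mx false +
     w false 0 (i0 false) *: t true *m B true *m proj_mx true.
    rewrite -!scalemxAl -!tE !zproj !scalerA [w false _ _ * _]mulrC -scalerDr -mulmxDr /=.
    rewrite addrC subrK mul_mx_scalar scalerA; congr (_ *: _).
    rewrite /q /split_index !natrM !natz !gez0_abs ?ltW //; ring.
  split; first by rewrite !gB.
  by rewrite inE; apply/asboolP;
    exists (w true 0 (i0 true) *: t false), (w false 0 (i0 false) *: t true), y.
move=> [t1 [t2 []]]; rewrite !gB => E; rewrite inE => /asboolP[t1' [t2' [y' [hy' E' []]]]].
move=> /(residue_eq q0 qn)[u1 u1E] /(residue_eq q0 qn)[u2 u2E].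
suff -> : y = y' + (u1 *m B false *m proj_mx false + u2 *m B true *m proj_mx true).
  by apply: subgroupD => //; apply: subgroupD.
have qnz : (q%:R : int) != 0 by rewrite natz eqz_nat -lt0n.
have scI (a b : 'rV[int]_d) : q%:R *: a = q%:R *: b -> a = b.
  by move=> /rowP ab; apply/rowP=> i; have := ab i; rewrite !mxE => /(mulfI qnz).
apply: scI; rewrite scalerDr E' E u1E u2E !mulmxDl -!scalemxAl scalerDr.
by rewrite addrACA.
Qed.

End SplitLattice.

(** * Translation parts of the deck transformations *)

Section Cosets.
Variables (d r : nat) (V : finType) (e : rel V) (p : 'rV[int]_d -> V).
Hypotheses (r2 : (2 <= r)%N) (cp : cover e r p).
Implicit Types (a b : {perm dir d}) (z y u v w : 'rV[int]_d).

Definition point_group : {set {perm dir d}} :=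
  [set b | signed b && `[< exists z, trans_part p b z >]]%SET.

Lemma point_groupP b :
  reflect (signed b /\ exists z, trans_part p b z) (b \in point_group).
Proof.
rewrite inE; apply: (iffP andP) => -[hb H]; split=> //; last exact/asboolP.
by move/asboolP: H.
Qed.

Lemma point_group1 : 1%g \in point_group.
Proof.
apply/point_groupP; split; first exact: signed1.
by exists 0; apply/trans_part1/periods0.
Qed.

Lemma point_groupM a b : a \in point_group -> b \in point_group -> (a * b)%g \in point_group.
Proof.
move=> /point_groupP[ha [u hu]] /point_groupP[hb [v hv]].
apply/point_groupP; split; first exact: signedM.
by exists (u + v *m bmx a^-1%g); apply: trans_partM.
Qed.

Lemma point_groupV a : a \in point_group -> a^-1%g \in point_group.
Proof.
move=> /point_groupP[ha [u hu]]; apply/point_groupP; split; first exact: signedV.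
exists (- (u *m bmx a)) => y; have := hu (y *m bmx a^-1%g - u).
rewrite addrC subrK => ->.
by rewrite mulmxBl -mulmxA bmxVK // mulmx1 addrC.
Qed.

Lemma periods_subgroup : subgroup (periods p).
Proof. by split; [exact: periods0|exact: periodsB]. Qed.

Lemma periods_shift w z : periods (fun y => p (w + y)) z <-> periods p z.
Proof.
split=> hz y; last by rewrite addrCA hz.
have /= := hz (y - w); rewrite [w + (y - w)]addrC subrK => <-.
by congr p; apply/rowP=> i; rewrite !mxE; ring.
Qed.

(* Translating by the average of the translation parts makes them rational
   with denominator #|point_group|, up to a bounded error. *)
Lemma centered_trans_part : exists w (rho : 'rV[int]_d), (forall i,
  0 <= rho 0 i < #|point_group|%:Z) /\
  forall b, b \in point_group -> exists v, trans_part (fun y => p (w + y)) b v /\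
    periods p (#|point_group|%:R *: v - (rho - rho *m bmx b^-1%g)).
Proof.
set P := point_group; pose q := #|P|.
have q0 : (0 < q)%N by apply/card_gt0P; exists 1%g; apply: point_group1.
have /choice[v vP] : forall b, exists v, b \in P -> trans_part p b v.
  move=> b; have [/point_groupP[_ [v hv]]|_] := boolP (b \in P); first by exists v.
  by exists 0.
pose s := \sum_(b in P) v b.
(* Summing the cocycle relation over the group: multiplied by the group order, [v] becomes a
   coboundary modulo periods. *)
have sP a : a \in P -> periods p (s - q%:R *: v a - s *m bmx a^-1%g).
  move=> aP; have /point_groupP[ha _] := aP.
  have -> : s - q%:R *: v a - s *m bmx a^-1%g = \sum_(b in P) (v (a * b)%g - (v a + v b *m bmx
    a^-1%g)).
    rewrite sumrB big_split /= sumr_const -scaler_nat -mulmx_suml opprD addrA; congr (_ - _ - _).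
    rewrite /s (reindex_inj (mulgI a)) /=; apply: eq_bigl => b.
    apply/idP/idP => [|bP]; last exact: point_groupM.
    by move=> /(point_groupM (point_groupV aP)); rewrite mulKg.
  elim/big_ind: _ => [|x y|b bP]; [exact: periods0|exact: periodsD|].
  have /point_groupP[hb _] := bP.
  apply: (proj1 (trans_part_coset _ (signedM ha hb) _)).
    by apply: trans_partM => //; apply: vP.
  exact/vP/point_groupM.
pose w := \row_i (s 0%R i %/ q%:Z)%Z; pose rho := \row_i (s 0%R i %% q%:Z)%Z.
have q0' : q%:Z != 0 by rewrite eqz_nat -lt0n.
have sE : s = q%:R *: w + rho.
  by apply/rowP=> i; rewrite !mxE natz mulrC -divz_eq.
exists w, rho; split=> [i|b bP]; first by rewrite mxE modz_ge0 //= ltz_pmod.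
have /point_groupP[hb _] := bP.
exists (v b - w + w *m bmx b^-1%g); split.
  apply/trans_part_shift => //; rewrite (_ : _ - _ = v b); first exact: vP.
  by apply/rowP=> i; rewrite !mxE; ring.
have -> : q%:R *: (v b - w + w *m bmx b^-1%g) - (rho - rho *m bmx b^-1%g) =
    - (s - q%:R *: v b - s *m bmx b^-1%g).
  rewrite sE mulmxDl -scalemxAl scalerDr scalerBr; apply/rowP=> i; rewrite !mxE; ring.
exact/periodsN/sP.
Qed.

End Cosets.

Section CosetCode.
Variable d : nat.

(** Chosen from the lattice alone, so that covers with equal periods decode with the same matrix;
    the default is 0. *)
Definition lattice_basis (L : 'rV[int]_d -> Prop) : 'M[int]_d :=
  xget 0 [set D | forall y, L y <-> exists t, y = t *m D].

(** Point group, remainder [rho], and for each [b] the coefficients of the correcting period.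
    Everything is reduced modulo the order of the point group, so the number of codes depends on d
    only. *)
Definition coset_code : finType := ({set {perm dir d}} * 'rV['I_#|{perm dir d}|.+1]_d *
  {ffun {perm dir d} -> 'rV['I_#|{perm dir d}|.+1]_d})%type.

Definition int_row n (t : 'rV['I_n]_d) : 'rV[int]_d := \row_i (t 0%R i : nat)%:Z.

Definition coset_trans (L : 'rV[int]_d -> Prop) (c : coset_code) (b : {perm dir d})
    (z : 'rV[int]_d) :=
  b \in c.1.1 /\ exists v, L (z - v) /\ #|c.1.1|%:R *: v =
    int_row c.1.2 - int_row c.1.2 *m bmx b^-1%g + int_row (c.2 b) *m lattice_basis L.

Lemma coset_code_ex r (V : finType) (e : rel V) (p : 'rV[int]_d -> V) : (2 <= r)%N ->
  cover e r p -> (exists D : 'M[int]_d, forall y, periods p y <-> exists t, y = t *m D) ->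
  exists w c, forall b z, signed b ->
    trans_part (fun y => p (w + y)) b z <-> coset_trans (periods p) c b z.
Proof.
move=> r2 cp /(xgetPex 0); rewrite -/(lattice_basis _) /=; set D := lattice_basis _ => DP.
have [w [rho [rho_lt vP]]] := centered_trans_part p.
set P := point_group p in rho_lt vP *.
have q0 : (0 < #|P|)%N by apply/card_gt0P; exists 1%g; apply: point_group1.
have qle : (#|P| <= #|{perm dir d}|)%N by apply: max_card.
have scI (a b : 'rV[int]_d) : #|P|%:R *: a = #|P|%:R *: b -> a = b.
  have qnz : (#|P|%:R : int) != 0 by rewrite natz eqz_nat -lt0n.
  by move=> /rowP ab; apply/rowP=> i; have := ab i; rewrite !mxE => /(mulfI qnz).
pose small (t : 'rV[int]_d) : 'rV['I_#|{perm dir d}|.+1]_d := \row_i inord `|t 0%R i|%N.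
have smallE (t : 'rV[int]_d) : (forall i, 0 <= t 0 i < #|P|%:Z) -> int_row (small t) = t.
  move=> tP; apply/rowP=> i; have := tP i; rewrite !mxE; move: (t 0 i) => c /andP[c0 cq].
  by rewrite inordK ?gez0_abs //; lia.
have /choice[f fP] : forall b, exists t : 'rV[int]_d, b \in P ->
    (forall i, 0 <= t 0 i < #|P|%:Z) /\ exists v, trans_part (fun y => p (w + y)) b v /\
      #|P|%:R *: v = rho - rho *m bmx b^-1%g + t *m D.
  move=> b; have [bP|_] := boolP (b \in P); last by exists 0.
  have [v [hv /DP[t tE]]] := vP b bP; have /point_groupP[hb _] := bP.
  have q0' : #|P|%:Z != 0 by rewrite eqz_nat -lt0n.
  (* Reducing the coefficients modulo the group order changes the translation part by a period
     only. *)
  exists (\row_i (t 0%R i %% #|P|%:Z)%Z) => _; split=> [i|].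
    by rewrite mxE modz_ge0 //= ltz_pmod.
  exists (v - \row_i (t 0%R i %/ #|P|%:Z)%Z *m D); split.
    apply/(trans_part_coset _ hb hv)/periods_shift.
    by rewrite addrAC subrr add0r; apply/periodsN/DP; exists (\row_i (t 0%R i %/ #|P|%:Z)%Z).
  rewrite scalerBr (canRL (subrK _) tE) [t *m D + _]addrC -addrA; congr (_ + _).
  rewrite scalemxAl -mulmxBl; congr (_ *m _).
  by apply/rowP=> i; rewrite !mxE natz {1}(divz_eq (t 0 i) #|P|%:Z) mulrC addrAC subrr add0r.
exists w, (P, small rho, [ffun b => small (f b)]) => b z hb; rewrite /coset_trans /= ffunE.
split=> [hz|[bP [v [hv vE]]]].
  have bP : b \in P.
    apply/point_groupP; split=> //.
    by exists (z + w - w *m bmx b^-1%g); apply/trans_part_shift.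
  split=> //; have [ft [v [hv vE]]] := fP b bP; exists v; rewrite !smallE //; split=> //.
  exact/(periods_shift _ w)/(trans_part_coset _ hb hv).
have [ft [v' [hv' vE']]] := fP b bP; move: vE; rewrite !smallE // -vE' => /scI vv'.
by apply/(trans_part_coset _ hb hv')/periods_shift; rewrite -vv'.
Qed.

End CosetCode.

(** * Counting components *)

Section Orbit.
Variables (d r : nat) (V : finType) (e : rel V) (p : 'rV[int]_d -> V).
Hypotheses (r2 : (2 <= r)%N) (cp : cover e r p).

Definition cover_image : {set V} := [set v | `[< exists z, p z = v >]]%SET.

Definition cover_size := (#|cover_image| * #|{perm dir d}|)%N.

Lemma cover_imageP v : reflect (exists z, p z = v) (v \in cover_image).
Proof. by rewrite inE; apply: asboolP. Qed.

(* A translate of p is determined by a fibre and a frame. *)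
Lemma cover_orbit : exists (f : 'rV[int]_d -> V * {perm dir d}) (A : {set V * {perm dir d}}),
  [/\ forall z y, f z = f y -> periods p (z - y), forall z, f z \in A & #|A| = cover_size].
Proof.
have /choice[g gP] : forall v, exists z, v \in cover_image -> p z = v.
  by move=> v; have [/cover_imageP[z zv]|_] := boolP (v \in cover_image); [exists z|exists 0].
have pim z : p z \in cover_image by apply/cover_imageP; exists z.
have /choice[b bP] : forall z, exists b, forall y, p (z + y) = p (g (p z) + y *m bmx b).
  by move=> z; have [b _ bE] := cover_move r2 cp (gP _ (pim z)); exists b.
exists (fun z => (p z, b z)), (finset.setX cover_image [set: {perm dir d}]%SET); split.
- move=> z y [zy bzy] u; rewrite -addrA bP zy bzy -bP addrA subrr add0r //.
- by move=> z; rewrite inE pim inE.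
by rewrite cardsX cardsT.
Qed.

(** Multiples of a unit vector below the pivot are distinct modulo periods, which bounds the pivot
    by the index; Hermite reduction bounds the other entries. *)
Lemma periods_basis : exists B : 'M[int]_d, (forall i j, 0 <= B i j <= cover_size%:Z) /\
  forall y, periods p y <-> exists t, y = t *m B.
Proof.
have [f [A [fp fA cA]]] := cover_orbit.
have sL := periods_subgroup p.
have [B BP] := @hermite_ex _ xpredT (periods p) _ sL (fact_gt0 _) (subgroup_finite_index sL fp).
have [[Bpos Bup _] HB Blow _ B0] := BP.
exists B; split; last first.
  move=> y; split=> [hy|[t ->]]; last exact: (subgroup_comb t sL HB).
  exact: (hermite_span sL BP hy).
have diag i : B i i <= cover_size%:Z.
  pose h (c : 'I_`|B i i|) := f (c%:Z *: delta_mx 0 i).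
  have hinj : injective h.
    move=> c c' /fp; rewrite -scalerBl => /B0 E.
    have /rowP/(_ i) : (c%:Z - c'%:Z) *: delta_mx 0 i = 0 :> 'rV[int]_d.
      apply: E => // j _; rewrite !mxE eqxx /=.
      have [->|ji] := eqVneq j i; rewrite ?mulr0 ?mulr1.
        by have := ltn_ord c; have := ltn_ord c'; lia.
      by have := Bpos j isT; lia.
    rewrite !mxE !eqxx mulr1 => E'; apply: val_inj => /=; lia.
  have : (#|codom h| <= #|A|)%N.
    by apply: subset_leq_card; apply/fintype.subsetP => _ /codomP[c ->]; exact: fA.
  by rewrite (card_codom hinj) card_ord cA; have := Bpos i isT; lia.
move=> i j; have := diag j; have := Bpos j isT.
have [ij|ji|/val_inj ->] := ltngtP i j; first by rewrite (Bup i j).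
  by have := Blow i j isT ji; lia.
by lia.
Qed.

End Orbit.

(** * Codes for covers of bounded size *)

Section Codes.
Variables (d r : nat).
Hypotheses (d2 : (2 <= d)%N) (r2 : (2 <= r)%N) (dr : (d <= (2 * r).+1)%N).

(** The shift [w] is free because a component is to be recovered, not the base point of its
    cover. *)
Definition cover_coded (T : Type) (E : T -> {perm dir d} -> 'rV[int]_d -> Prop) (A : T -> Prop)
    (V : Type) (p : 'rV[int]_d -> V) :=
  exists w c, A c /\ forall b z, signed b -> trans_part (fun y => p (w + y)) b z <-> E c b z.

(** A crude count storing a whole basis; only its logarithm will matter, once for each exceptional
    component. *)
Lemma all_code : exists C, forall x, exists (T : finType)
    (E : T -> {perm dir d} -> 'rV[int]_d -> Prop),
  (#|T| <= C * x.+1 ^ (d * d))%N /\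
  forall (V : finType) (e : rel V) p, cover e r p -> (cover_size p <= x)%N ->
    cover_coded E (fun=> True) p.
Proof.
exists #|coset_code d| => x; exists ({ffun 'I_d * 'I_d -> 'I_x.+1} * coset_code d)%type.
exists (fun c : {ffun 'I_d * 'I_d -> 'I_x.+1} * coset_code d => coset_trans (fun y =>
  exists t : 'rV[int]_d,
  y = t *m \matrix_(i, j) (c.1 (i, j) : nat)%:Z) c.2).
split; first by rewrite card_prod card_ffun card_prod !card_ord mulnC.
move=> V e p cp px; have [B [Bx BP]] := periods_basis r2 cp.
have [w [c cP]] := coset_code_ex r2 cp (ex_intro _ B BP).
exists w, ([ffun l => inord `|B l.1 l.2|%N], c); split=> // b z hb; rewrite cP //=.
suff -> : periods p = fun y => exists t : 'rV[int]_d, y = t *m \matrix_(i, j)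
     ([ffun l => inord `|B l.1 l.2|%N : 'I_x.+1] (i, j) : nat)%:Z by [].
apply/funext => y; apply/propext; rewrite BP.
suff -> : \matrix_(i, j) ([ffun l => inord `|B l.1 l.2|%N : 'I_x.+1] (i, j) : nat)%:Z = B by [].
by apply/matrixP=> i j; rewrite mxE ffunE inordK /=; have := Bx i j; lia.
Qed.

Definition twisted (V : Type) (p : 'rV[int]_d -> V) :=
  exists b z, [/\ signed b, b != 1%g & trans_part p b z].

(** [C] can precede [x] since the vectors [iw b], and with them the moduli [q b] and their bound
    [n], depend only on d. *)
Lemma small_code : exists C, forall x, exists (T : finType) (A : {set T})
    (E : T -> {perm dir d} -> 'rV[int]_d -> Prop),
  (#|A| <= C * (x ^ d.-1 * lg x ^ (2 * d)))%N /\
  forall (V : finType) (e : rel V) p, cover e r p -> (cover_size p <= x)%N ->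
    twisted p -> cover_coded E (fun c => c \in A) p.
Proof.
pose good (b : {perm dir d}) (iw : (bool -> 'I_d) * (bool -> 'rV[int]_d)) :=
  [/\ iw.2 false *m powsum b = 0, iw.2 true *m powsum b = #[b]%g%:R *: iw.2 true &
      forall c, 0 < iw.2 c 0 (iw.1 c)].
have o : 'I_d by exact: (Ordinal d2).
have /choice[iw iwP] : forall b, exists iw, signed b -> b != 1%g -> powsum b != 0 -> good b iw.
  move=> b; have [H|nH] := pselect (signed b /\ b != 1%g /\ powsum b != 0); last first.
    by exists (fun=> o, fun=> 0) => ? ? ?; case: nH.
  have [hb [b1 S0]] := H; have [[w1 [i1 [w1S w1i]]] [w2 [i2 [w2S w2i]]]] := powsum_eigen hb b1 S0.
  have pos (w : 'rV[int]_d) i : w 0 i != 0 -> exists c : int, 0 < (c *: w) 0 i.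
    by move=> wi; exists (w 0 i); rewrite mxE; move: wi; move: (w 0 i) => a; nia.
  have [c1 c1P] := pos _ _ w1i; have [c2 c2P] := pos _ _ w2i.
  exists (fun c => if c then i2 else i1, fun c => if c then c2 *: w2 else c1 *: w1) => _ _ _.
  split=> [||[]] //=; first by rewrite -scalemxAl w1S scaler0.
  by rewrite -scalemxAl w2S !scalerA mulrC.
pose q b := split_index #[b]%g (iw b).1 (iw b).2.
pose n := (\sum_b q b)%N.
have qn b : (q b <= n)%N by rewrite /n (bigD1 b) //= leq_addr.
pose RT : finType := {set 'rV['I_n.+1]_d * 'rV['I_n.+1]_d}.
exists (#|{perm dir d}| * (#|RT| * #|coset_code d|))%N => x.
pose G : finType := {ffun bool * ('I_d * 'I_d) -> 'I_x.+1}.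
pose A : {set {perm dir d} * (G * (RT * coset_code d))} :=
  [set c | c.2.1 \in hermite_codes x (iw c.1).1]%SET.
exists ({perm dir d} * (G * (RT * coset_code d)))%type, A.
exists (fun c => coset_trans (code_lattice (powsum c.1) #[c.1]%g (q c.1) c.2.1 c.2.2.1) c.2.2.2).
split.
  have -> : #|A| = (\sum_b #|hermite_codes x (iw b).1| * (#|RT| * #|coset_code d|))%N.
    rewrite -sum1_card (eq_bigl (fun c : {perm dir d} * (G * (RT * coset_code d)) =>
       xpredT c.1 && (c.2.1 \in hermite_codes x (iw c.1).1))); last by move=> c; rewrite inE.
    rewrite -(pair_big_dep xpredT (fun b c => c.1 \in hermite_codes x (iw b).1) (fun _ _ =>
      1%N)) /=.
    apply: eq_bigr => b _; rewrite sum1_card -card_prod -[X in (_ * X)%N]cardsT -cardsX.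
    by apply: eq_card => -[g h]; rewrite finset.in_setX finset.in_setT andbT.
  apply: (@leq_trans (\sum_(b : {perm dir d}) (x ^ d.-1 * lg x ^ (2 * d)) * (#|RT| *
    #|coset_code d|))).
    by apply: leq_sum => b _; rewrite leq_mul2r card_hermite_codes ?orbT.
  by rewrite sum_nat_const; apply/eq_leq; ring.
move=> V e p cp px [b [v [hb b1 hv]]].
have S0 := powsum_neq0 r2 dr cp hb hv b1; have [w1 w2 wpos] := iwP b hb b1 S0.
have [f [W [fp fW cW]]] := cover_orbit r2 cp.
have LS z : periods p z -> periods p (z *m powsum b).
  move=> hz; rewrite /powsum mulmx_sumr.
  elim/big_ind: _ => [|y y'|i _]; [exact: periods0|exact: periodsD|].
  elim: (i : nat) => [|j IH]; first by rewrite expg0 bmx1 mulmx1.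
  by rewrite expgSr bmxM ?signedX // mulmxA; apply: periods_bmx hv _.
have Wx : (#|W| <= x)%N by rewrite cW.
have [g gA [R RP]] := split_lattice_code (order_gt0 b) (powsum_sqr hb) w1 w2 wpos (qn b)
   (periods_subgroup p) LS fp fW Wx.
have [B [_ BP]] := periods_basis r2 cp.
have [w [c cP]] := coset_code_ex r2 cp (ex_intro _ B BP).
exists w, (b, (g, (R, c))); split; first by rewrite inE.
move=> b' z hb'; rewrite cP //=.
suff -> : periods p = code_lattice (powsum b) #[b]%g (q b) g R by [].
by apply/funext => y; apply/propext; rewrite RP.
Qed.

End Codes.

(** * Components and automorphisms *)

Section Components.
Variables (d r : nat) (V : finType) (e : rel V).
Hypotheses (r2 : (2 <= r)%N) (e_sym : symmetric e).
Implicit Types p : 'rV[int]_d -> V.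

Let csym : connect_sym e := sym_connect_sym e_sym.

Lemma cover_connect p z y : cover e r p -> connect e (p z) (p y).
Proof.
move=> [nb _]; rewrite -(subrK z y) addrC; move: (y - z) => {y} y.
have [n] := ubnP (nrm y); elim: n y => // n IH y.
have [->|/nrm_step[s ys]] := eqVneq y 0; first by rewrite addr0.
rewrite ys ltnS => /IH zy; apply: connect_trans zy (connect1 _).
by apply/nb; exists s; rewrite -addrA subrK.
Qed.

Lemma cover_connectP p z v : cover e r p -> connect e (p z) v -> exists y, p y = v.
Proof.
move=> [nb _] /connectP[l + ->]; elim: l z => [|w l IH] z /=; first by exists z.
by case/andP=> /nb[s ->]; apply: IH.
Qed.

Lemma untwisted_periods p z y : cover e r p -> ~ twisted p -> p z = p y -> periods p (z - y).
Proof.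
move=> cp np /(cover_kernel r2 cp)[b hb hz].
have [b1|b1] := eqVneq b 1%g; last by case: np; exists b; eexists; split; eauto.
by move: hz; rewrite b1 invg1 bmx1 mulmx1 => /trans_part1.
Qed.

Definition good_roots : {set V} :=
  [set v | roots e v && `[< exists p, [/\ cover e r p, p 0 = v & ~ twisted p] >]]%SET.

Hypothesis d0 : (0 < d)%N.

(** In an untwisted cover the fibres are cosets of the periods, so translation by a unit vector
    descends to the component, and it moves every vertex. The good components can be shifted
    independently, and the shifted ones are recognised by their roots. *)
Lemma card_shift_automorphisms :
  (2 ^ #|good_roots| <= #|[set s : {perm V} | [forall x, forall y,
    e (s x) (s y) == e x y]]%SET|)%N.
Proof.
pose u : 'rV[int]_d := uvec (Ordinal d0, false).
have /choice[p pP] : forall v, exists p, v \in good_roots -> [/\ cover e r p,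
  p 0 = v & ~ twisted p].
  move=> v; have [|_] := boolP (v \in good_roots); last by exists (fun=> v).
  by rewrite inE => /andP[_ /asboolP[p pP]]; exists p.
have /choice[z zP] : forall v, exists z,
  fingraph.root e v \in good_roots -> p (fingraph.root e v) z = v.
  move=> v; have [vg|_] := boolP (fingraph.root e v \in good_roots); last by exists 0.
  have [cp p0 _] := pP _ vg.
  have [|y yv] := @cover_connectP (p (fingraph.root e v)) 0 v cp; last by exists y.
  by rewrite p0 csym connect_root.
pose sh (S : {set V}) v := if fingraph.root e v \in S then p (fingraph.root e v) (z v + u) else v.
have sh_root (S : {set V}) v : S \subset good_roots -> fingraph.root e (sh S v) = fingraph.root
  e v.
  move=> /fintype.subsetP SG; rewrite /sh; case: ifP => // /SG vg; have [cp _ _] := pP _ vg.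
  by apply/esym/(fingraph.rootP csym); rewrite -{1}(zP v vg); apply: cover_connect.
have pu v y y' : v \in good_roots -> p v (y + u) = p v (y' + u) <-> p v y = p v y'.
  move=> vg; have [cp _ np] := pP _ vg; split=> /(untwisted_periods cp np).
    by rewrite opprD addrACA subrr addr0 => hp; rewrite -(subrK y' y) hp.
  by move=> hp; rewrite -{1}(subrK y' y) -addrA hp.
have sh_inj (S : {set V}) : S \subset good_roots -> injective (sh S).
  move=> SG v w E; have := congr1 (fingraph.root e) E; rewrite !sh_root // => rE.
  move: E; rewrite /sh rE; case: ifP => // wS /(pu _ _ _ (fintype.subsetP SG _ wS)).
  by rewrite -{1}rE !zP // ?rE; apply: (fintype.subsetP SG).
have sh_adj (S : {set V}) x y : S \subset good_roots -> e (sh S x) (sh S y) = e x y.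
  move=> SG; have e_root a b : e a b -> fingraph.root e a = fingraph.root e b.
    by move=> ab; apply/(fingraph.rootP csym)/connect1.
  have [rE|rE] := eqVneq (fingraph.root e x) (fingraph.root e y); last first.
    by apply/idP/idP=> /e_root; rewrite ?sh_root // => E; rewrite E eqxx in rE.
  rewrite /sh rE; case: ifP => // /(fintype.subsetP SG) yg; have [cp _ _] := pP _ yg.
  have xg : fingraph.root e x \in good_roots by rewrite rE.
  have xE := zP x xg; have yE := zP y yg; rewrite rE in xE.
  rewrite -[X in _ = e _ X]yE -[X in _ = e X _]xE; have [nb _] := cp.
  apply/idP/idP=> /nb[s sE]; apply/nb; exists s; first by apply/(pu _ _ _ yg); rewrite addrAC.
  by rewrite addrAC; apply/(pu _ _ _ yg).
pose sp (S : {set V}) : {perm V} := if pselect (S \subset good_roots) is left H then perm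
  (sh_inj S H) else 1%g.
have spE (S : {set V}) v : S \subset good_roots -> sp S v = sh S v.
  by move=> SG; rewrite /sp; case: pselect => // H; rewrite permE.
rewrite -card_powerset -(card_in_imset (f := sp)).
  apply: subset_leq_card; apply/fintype.subsetP => s /imsetP[S]; rewrite powersetE => SG ->.
  rewrite inE; apply/forallP=> x; apply/forallP=> y; rewrite !spE //; apply/eqP;
    exact: (sh_adj _ _ _ SG).
have memE (S : {set V}) v : S \subset good_roots -> v \in good_roots -> (v \in S) = (sp S v != v).
  move=> SG vg; rewrite spE // /sh; have := vg; rewrite inE => /andP[/eqP rv _].
  have E := zP v; rewrite rv in E *; case: ifP => [vS|]; last by rewrite eqxx.
  have [cp _ _] := pP _ vg; rewrite -{3}(E vg); apply/esym/eqP.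
  exact: (cover_neq cp).
move=> S S'; rewrite !powersetE => SG SG' E; apply/finset.setP => v.
have [vg|vg] := boolP (v \in good_roots); first by rewrite (memE S) // (memE S') // E.
have out (R : {set V}) : R \subset good_roots -> v \in R = false.
  by move=> /fintype.subsetP RG; apply: contraNF vg; apply: RG.
by rewrite !out.
Qed.

End Components.

(** Covers with the same fibres have isomorphic images, so any colour-preserving bijection between
    the components extends to an isomorphism. *)
Lemma graphs_iso d r (V : finType) (e e' : rel V) (T : eqType) (c c' : V -> T)
    (p p' : V -> 'rV[int]_d -> V) :
  symmetric e -> symmetric e' ->
  (forall v, roots e v -> cover e r (p v) /\ connect e v (p v 0)) ->
  (forall v, roots e' v -> cover e' r (p' v) /\ connect e' v (p' v 0)) ->
  (forall v v', roots e v -> roots e' v' -> c v = c' v' ->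
     forall z y, p v z = p v y <-> p' v' z = p' v' y) ->
  (forall t, #|[set v | roots e v & c v == t]%SET| = #|[set v | roots e' v & c' v == t]%SET|) ->
  exists s : {perm V}, forall x y, e' (s x) (s y) = e x y.
Proof.
move=> e_sym e'_sym pP pP' ker cnt.
have cs := sym_connect_sym e_sym; have cs' := sym_connect_sym e'_sym.
pose A t := [set v | roots e v & c v == t]%SET; pose A' t := [set v | roots e' v & c' v == t]%SET.
(* The i-th root of a colour goes to the i-th root of that colour. *)
pose h v := nth v (enum (A' (c v))) (index v (enum (A (c v)))).
have lt_idx v : roots e v -> (index v (enum (A (c v))) < size (enum (A' (c v))))%N.
  by move=> rv; rewrite -cardE -cnt cardE index_mem mem_enum inE rv eqxx.
have hA v : roots e v -> h v \in A' (c v).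
  by move=> rv; rewrite -mem_enum /h mem_nth // lt_idx.
have h_root v : roots e v -> roots e' (h v) by move=> /hA; rewrite inE => /andP[].
have hc v : roots e v -> c v = c' (h v).
  by move=> /hA; rewrite inE => /andP[_ /eqP].
have h_inj v w : roots e v -> roots e w -> h v = h w -> v = w.
  move=> rv rw E; have cE : c v = c w by rewrite !hc // E.
  have := lt_idx v rv; have := lt_idx w rw; move: E; rewrite /h cE => E lw lv.
  have /eqP := E; rewrite (set_nth_default v) // nth_uniq ?enum_uniq // => /eqP.
  by move=> H; apply: (index_inj v _ _ H); rewrite mem_enum inE ?rv ?rw ?cE eqxx.
have rr v : roots e (fingraph.root e v) by apply: roots_root.
have /choice[z zP] : forall v, exists z, p (fingraph.root e v) z = v.
  move=> v; have [cp p0] := pP _ (rr v).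
  apply: (@cover_connectP d r V e (p (fingraph.root e v)) 0 v cp).
  by apply: connect_trans (_ : connect e _ v); [rewrite cs; exact: p0|rewrite cs connect_root].
pose th v := p' (h (fingraph.root e v)) (z v).
have th_root v : fingraph.root e' (th v) = h (fingraph.root e v).
  have rh := h_root _ (rr v); have [cp p0] := pP' _ rh.
  have /eqP <- := rh; apply/esym/(fingraph.rootP cs'); apply: connect_trans p0 _.
  exact: (cover_connect _ _ cp).
have same_root v w : fingraph.root e' (th v) = fingraph.root e' (th w) -> fingraph.root e v =
  fingraph.root e w.
  by rewrite !th_root => /h_inj; apply.
have kerE v y y' : p (fingraph.root e v) y = p (fingraph.root e v) y' <->
    p' (h (fingraph.root e v)) y = p' (h (fingraph.root e v)) y'.
  by apply: ker => //; [exact: h_root|exact: hc].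
have th_inj : injective th.
  move=> v w E; have rE := same_root _ _ (congr1 (fingraph.root e') E).
  move: E; rewrite /th rE => /kerE; rewrite zP -rE zP //.
exists (perm th_inj) => v w; rewrite !permE.
have [rE|rE] := eqVneq (fingraph.root e v) (fingraph.root e w); last first.
  apply/idP/idP => [/connect1/(fingraph.rootP cs')/same_root|/connect1/(fingraph.rootP cs)] E;
    by rewrite E eqxx in rE.
have [[nb _] _] := pP _ (rr w); have [[nb' _] _] := pP' _ (h_root _ (rr w)).
have vE := zP v; have wE := zP w; rewrite rE in vE.
rewrite -[X in _ = e _ X]wE -[X in _ = e X _]vE /th rE.
apply/idP/idP => [/nb'[s sE]|/nb[s sE]].
  by apply/nb; exists s; apply/kerE.
by apply/nb'; exists s; apply/kerE.
Qed.

(** * Counting graphs with few good components *)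

Lemma class_eq n (C C' : {set lgraph n}) G G' : C \in unlabelled n -> C' \in unlabelled n ->
  G \in C -> G' \in C' -> isomorphic G G' -> C = C'.
Proof.
have eqv : {in [set: lgraph n]%SET & &, equivalence_rel (@isomorphic n)}.
  by move=> ? ? ? _ _ _; apply: isomorphic_equiv.
have /and3P[_ tI _] := equivalence_partitionP eqv.
move=> hC hC' GC GC' GG'.
rewrite -(def_pblock tI hC GC) -(def_pblock tI hC' GC'); apply/esym/same_pblock => //.
by rewrite pblock_equivalence_partition ?finset.in_setT.
Qed.

Section BadClasses.
Variables (d r : nat).
Hypotheses (d2 : (2 <= d)%N) (r2 : (2 <= r)%N) (dr3 : d = 2%N \/ (3 <= r)%N).
Hypothesis (dr : (d <= (2 * r).+1)%N).

Section Exceptional.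
Variables (V : finType) (e : rel V) (y : nat).
Hypotheses (e_sym : symmetric e).

Definition big_roots : {set V} :=
  [set v | roots e v & (y < #|[set w | connect e v w]|)%N]%SET.

Lemma card_big_roots : (0 < y)%N -> (#|big_roots| <= #|V| %/ y)%N.
Proof.
move=> y0; have cs := sym_connect_sym e_sym; rewrite leq_divRL // -sum_nat_const.
apply: (@leq_trans (\sum_(v in big_roots) #|[set w | fingraph.root e w == v]%SET|)).
  apply: leq_sum => v; rewrite inE => /andP[/eqP rv /ltnW yv]; apply: leq_trans yv _.
  apply: subset_leq_card; apply/fintype.subsetP => w; rewrite !inE => /(fingraph.rootP cs) <-.
  by rewrite rv.
rewrite -[#|V|]sum1_card [leqRHS](partition_big (fingraph.root e) xpredT) //=.
rewrite [leqRHS](bigID (mem big_roots)) /= -[leqLHS]addn0 leq_add //.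
by apply: leq_sum => v _; rewrite -sum1_card; apply/eq_leq/eq_bigl => w; rewrite inE.
Qed.

End Exceptional.

Definition coded_root (T1 T2 : finType) (A1 : {set T1})
    (E1 : T1 -> {perm dir d} -> 'rV[int]_d -> Prop) (E2 : T2 -> {perm dir d} -> 'rV[int]_d ->
      Prop)
    (V : finType) (e : rel V) (y : nat) (v : V) (pc : ('rV[int]_d -> V) * (T1 + T2)) :=
  [/\ cover e r pc.1, connect e v (pc.1 0) &
    match pc.2 with
    | inl c => c \in A1 /\ forall b z, signed b -> trans_part pc.1 b z <-> E1 c b z
    | inr c => v \in good_roots d r e :|: big_roots e y /\
        forall b z, signed b -> trans_part pc.1 b z <-> E2 c b z
    end].

(** A bad graph is determined by the multiplicity, at most n, of each short code and by a list of at
    most K + n / y long codes. *)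
Lemma bad_classes : exists C1 C2, forall n y K, (0 < y)%N ->
  (#|[set C in unlabelled_r_locally (@lattice d) 0%R r n |
       [exists G in C, (#|good_roots d r (ladj G)| < K)%N]]%SET| <=
    n.+1 ^ (C1 * ((y * #|{perm dir d}|) ^ d.-1 * lg (y * #|{perm dir d}|) ^ (2 * d))) *
    (C2 * (n * #|{perm dir d}|).+1 ^ (d * d)).+1 ^ (K + n %/ y))%N.
Proof.
have [C1 C1P] := small_code d2 r2 dr; have [C2 C2P] := all_code d2 r2 dr.
exists C1, C2 => n y K y0; set beta := #|{perm dir d}|; set bad := finset _.
have [T1 [A1 [E1 [cA1 E1P]]]] := C1P (y * beta)%N.
have [T2 [E2 [cT2 E2P]]] := C2P (n * beta)%N.
set M := (K + n %/ y)%N.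
have [->|[C0 C0b]] := set_0Vmem bad; first by rewrite cards0.
have /choice[G GP] : forall C, exists G, C \in bad -> [/\ G \in C,
    (#|good_roots d r (ladj G)| < K)%N & forall v, exists p : 'rV[int]_d -> 'I_n,
       cover (ladj G) r p /\ p 0 = v].
  move=> C; have [|_] := boolP (C \in bad).
    rewrite inE => /andP[]; rewrite inE => /andP[_ /forall_inP lC] /exists_inP[G GC GK].
    exists G => _; split=> //; have [es _] := ladj_simple G.
    by apply/(r_locallyP r2 es dr3)/asboolP/lC.
  have G0P : [forall i, ~~ (const_mx false : 'M[bool]_n) i i] && ((const_mx false :
    'M[bool]_n)^T == const_mx false).
    apply/andP; split; first by apply/forallP=> i; rewrite mxE.
    by rewrite trmx_const.
  by exists (exist (fun A : 'M[bool]_n => [forall i, ~~ A i i] && (A^T == A)) _ G0P).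
pose o := fun C => ladj (G C).
have osym C : symmetric (o C) by case: (ladj_simple (G C)).
have /choice[k kP] : forall C, exists k : 'I_n -> ('rV[int]_d -> 'I_n) * (T1 + T2),
    C \in bad -> forall v, roots (o C) v -> coded_root A1 E1 E2 (o C) y v (k v).
  suff kex C : C \in bad -> exists k : 'I_n -> ('rV[int]_d -> 'I_n) * (T1 + T2),
      forall v, roots (o C) v -> coded_root A1 E1 E2 (o C) y v (k v).
    have [k0 _] := kex C0 C0b => C.
    by have [/kex[k kP]|_] := boolP (C \in bad); [exists k|exists k0].
  move=> Cb.
  have [_ _ covG] := GP C Cb.
  have /choice[kv kvP] : forall v, exists pc, roots (o C) v -> coded_root A1 E1 E2 (o C) y v pc.
    move=> v; have [p [cp p0]] := covG v.
    have conn w : connect (o C) v (p (w + 0)) by rewrite -{1}p0; apply: (cover_connect _ _ cp).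
    have [vx|vx] := boolP (v \in good_roots d r (o C) :|: big_roots (o C) y)%SET.
      have px : (cover_size p <= n * beta)%N.
        by rewrite leq_mul2r -[X in (_ <= X)%N]card_ord max_card orbT.
      have [w [c [_ cP]]] := E2P _ _ _ cp px.
      by exists (fun z => p (w + z), inr c) => _; split=> //=; apply: (cover_trans _ cp).
    have [rv|rv] := boolP (roots (o C) v); last first.
      have px : (cover_size p <= n * beta)%N.
        by rewrite leq_mul2r -[X in (_ <= X)%N]card_ord max_card orbT.
      have [w [c [_ cP]]] := E2P _ _ _ cp px.
      by exists (fun z => p (w + z), inr c).
    move: vx; rewrite !inE rv /= negb_or -leqNgt => /andP[/asboolPn ng sz].
    have tw : twisted p by apply: contrapT => ntw; apply: ng; exists p.
    have px : (cover_size p <= y * beta)%N.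
      rewrite leq_mul2r; apply/orP; right; apply: leq_trans sz.
      apply: subset_leq_card; apply/fintype.subsetP => _ /cover_imageP[z <-].
      by rewrite inE -p0; apply: (cover_connect _ _ cp).
    have [w [c [cA cP]]] := E1P _ _ _ cp px tw.
    by exists (fun z => p (w + z), inl c) => _; split=> //=; apply: (cover_trans _ cp).
  by exists kv.
pose cnt C t := #|[set v | roots (o C) v & (k C v).2 == t]%SET|.
have cntn C t : (cnt C t < n.+1)%N by rewrite ltnS -[X in (_ <= X)%N]card_ord max_card.
pose mu C : {ffun T1 -> 'I_n.+1} := [ffun t => inord (cnt C (inl t))].
pose prr (t : T1 + T2) : option T2 := if t is inr c then Some c else None.
pose xr C := [set v | roots (o C) v & prr (k C v).2 != None]%SET.
have xrM C : C \in bad -> (#|xr C| <= M)%N.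
  move=> Cb; have [_ gK _] := GP C Cb.
  apply: (@leq_trans #|(good_roots d r (o C) :|: big_roots (o C) y)%SET|).
    apply: subset_leq_card; apply/fintype.subsetP => v; rewrite inE => /andP[rv].
    by have [_ _] := kP C Cb v rv; case: (k C v).2 => //= c [].
  apply: leq_trans (leq_card_setU _ _) _; rewrite leq_add ?(ltnW gK) //.
  by have := card_big_roots (osym C) y0; rewrite card_ord.
(* Padding by [None] gives all lists the same length and accounts for the successor in the base of
   the second power. *)
pose xs C := [seq prr (k C v).2 | v <- enum (xr C)] ++ nseq (M - #|xr C|) None.
have size_xs C : C \in bad -> size (xs C) == M.
  by move=> /xrM xM; rewrite size_cat size_map size_nseq -cardE subnKC.
pose sg C : M.-tuple (option T2) := insubd (nseq_tuple M None) (xs C).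
have sgE C : C \in bad -> tval (sg C) = xs C.
  by move=> Cb; rewrite /sg val_insubd size_xs.
have cnt_inr C t : cnt C (inr t) = count_mem (Some t) (xs C).
  rewrite /xs count_cat count_nseq mul0n addn0 count_map /cnt cardE.
  rewrite -size_filter; apply: perm_size; apply: uniq_perm;
    [exact: enum_uniq|exact: (filter_uniq _ (enum_uniq _))|].
  move=> v; rewrite mem_enum mem_filter mem_enum !inE /=.
  case: (k C v).2 => [c|c] /=; first by rewrite andbF.
  rewrite andbT andbC; congr (_ && _).
pose S := finset.setX [set f : {ffun T1 -> 'I_n.+1} | f \in pffun_on ord0 (mem A1) predT]%SET
  [set: M.-tuple (option T2)]%SET.
have sig_in C : C \in bad -> (mu C, sg C) \in S.
  move=> Cb; rewrite !inE andbT; apply/pffun_onP; split=> //.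
  apply/fintype.subsetP => t; rewrite unfold_in /= ffunE; apply: contraNT => tA.
  rewrite -val_eqE /= inordK //; apply/eqP/eqP; rewrite cards_eq0; apply/eqP/finset.setP => v.
  rewrite !inE; apply/negbTE/negP => /andP[rv /eqP kE].
  by have [_ _] := kP C Cb v rv; rewrite kE => -[tA' _]; rewrite tA' in tA.
have sig_inj : {in bad &, injective (fun C => (mu C, sg C))}.
  move=> C C' Cb C'b [mE sE].
  have [GC _ _] := GP C Cb; have [GC' _ _] := GP C' C'b.
  have CU D : D \in bad -> D \in unlabelled n by rewrite !inE => /andP[/andP[]].
  apply: (class_eq (CU _ Cb) (CU _ C'b) GC GC').
  have [|v rv|v rv|v v' rv rv' cE|t|s sP] := @graphs_iso d r _ (o C) (o C') _ (fun v => (k C v).2)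
     (fun v => (k C' v).2) (fun v => (k C v).1) (fun v => (k C' v).1) (osym C).
  - exact: osym.
  - by have [] := kP C Cb v rv.
  - by have [] := kP C' C'b v rv.
  - have [cv _ hv] := kP C Cb v rv; have [cv' _ hv'] := kP C' C'b v' rv'.
    apply: (cover_kernel_eq r2 cv cv') => b z hb; move: hv hv'; rewrite cE.
    by case: (k C' v').2 => c [_ h1] [_ h2]; rewrite h1 // h2.
  - rewrite -!/(cnt _ _); case: t => t; last by rewrite !cnt_inr -!sgE // sE.
    have := congr1 (fun f : {ffun T1 -> 'I_n.+1} => val (f t)) mE.
    by rewrite !ffunE /= !inordK.
  by apply/existsP; exists s; apply/is_isomP.
have -> : #|bad| = #|[set (mu C, sg C) | C in bad]%SET| by rewrite card_in_imset.
apply: (@leq_trans #|S|).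
  by apply: subset_leq_card; apply/fintype.subsetP => _ /imsetP[C Cb ->]; apply: sig_in.
rewrite cardsX cardsT cardsE card_pffun_on card_tuple card_option card_ord.
rewrite leq_mul //; last by case: (M) => // m; rewrite leq_exp2r.
by rewrite leq_pexp2l ?(eq_card (B := A1)) // => v; rewrite inE.
Qed.

End BadClasses.

(** * Circulant graphs *)

Lemma dvdzN (a x : int) : (a %| - x)%Z = (a %| x)%Z.
Proof. by rewrite !dvdzE abszN. Qed.

Lemma dvdz_add (a x y : int) : (a %| x)%Z -> (a %| y)%Z -> (a %| x + y)%Z.
Proof. exact: rpredD. Qed.

Lemma dvdz_sub (a x y : int) : (a %| x)%Z -> (a %| y)%Z -> (a %| x - y)%Z.
Proof. exact: rpredB. Qed.

Section Circulant.
Variables (d' K l : nat).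
Hypotheses (K0 : (0 < K)%N) (l0 : (0 < l)%N).
Let d := d'.+1.
Implicit Types (t : {ffun 'I_d -> 'I_l}) (z y : 'rV[int]_d).

(* Superincreasing jumps: the form below vanishes on no short nonzero vector. *)
Definition jump t (k : nat) : nat :=
  if k == 0%N then 1%N else ((4 * K) ^ k * l + t (inord k))%N.

Definition form t z : int := \sum_(k < d) (jump t k)%:Z * z 0 k.

Lemma formD t z y : form t (z + y) = form t z + form t y.
Proof. by rewrite /form -big_split; apply: eq_bigr => k _; rewrite mxE mulrDr. Qed.

Lemma formZ t a z : form t (a *: z) = a * form t z.
Proof. by rewrite /form mulr_sumr; apply: eq_bigr => k _; rewrite mxE mulrCA. Qed.

Lemma form0 t : form t 0 = 0.
Proof. by rewrite -(scale0r 0) formZ mul0r. Qed.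

Lemma formB t z y : form t (z - y) = form t z - form t y.
Proof. by rewrite formD -scaleN1r formZ mulN1r. Qed.

Lemma form_delta t (k : 'I_d) : form t (delta_mx 0 k) = (jump t k)%:Z.
Proof.
rewrite /form (bigD1 k) //= mxE !eqxx mulr1 big1 ?addr0 // => i ik.
by rewrite mxE (negbTE ik) andbF mulr0.
Qed.

Lemma jump_lt t k : (k < d)%N -> (jump t k < (4 * K) ^ d * l)%N.
Proof.
move=> kd; have e0 j : (0 < (4 * K) ^ j)%N by rewrite expn_gt0 muln_gt0 K0.
rewrite /jump; case: eqP => [_|/eqP k0].
  apply: (@leq_trans ((4 * K) ^ 1 * l)); first by rewrite expn1; nia.
  by rewrite leq_mul2r leq_pexp2l ?orbT // muln_gt0 K0.
apply: (@leq_trans ((4 * K) ^ k.+1 * l)); last first.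
  by rewrite leq_mul2r leq_pexp2l ?orbT // muln_gt0 K0.
rewrite expnS; have := ltn_ord (t (inord k)); have := e0 k; nia.
Qed.

(** For k > 0 the k-th jump is below 2 (4K)^k l and is multiplied by at most K; the factor 4 works
    because 1 + 2K <= 4K. *)
Lemma partial_form_lt t z k : (k <= d)%N -> (forall i, (`|z 0%R i| <= K)%N) ->
  (`|(\sum_(i < k) (jump t i)%:Z * z 0 (inord i))%R| < (4 * K) ^ k * l)%N.
Proof.
move=> + zK; elim: k => [|k IH] kd; first by rewrite big_ord0 expn0 mul1n.
rewrite big_ord_recr /=; have := IH (ltnW kd).
have e0 j : (0 < (4 * K) ^ j)%N by rewrite expn_gt0 muln_gt0 K0.
have := zK (inord k); rewrite expnS; have := e0 k.
move: (\sum_(i < k) _) (z 0 _) => a b; rewrite /jump.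
have [->|k0] := eqVneq k 0%N; first by rewrite expn0 /=; nia.
rewrite /=; have := ltn_ord (t (inord k)); move: (t _ : nat) ((4 * K) ^ k)%N => c x cl x0 bK ax.
have h : (`|((x * l + c)%N%:Z * b)%R| <= 2 * (x * l) * K)%N.
  by rewrite abszM absz_nat leq_mul //; nia.
have u0 : (0 < x * l)%N by rewrite muln_gt0 x0.
move: h ax u0; rewrite -[(4 * K * x * l)%N]mulnA; move: (x * l)%N (_ * b) => u f; nia.
Qed.

(** The last nonzero coordinate dominates: the earlier terms sum to less than the jump it
    multiplies. *)
Lemma form_small t z : (nrm z <= K)%N -> z != 0 ->
  form t z != 0 /\ (`|form t z| < (4 * K) ^ d * l)%N.
Proof.
move=> zK z0; have zK' i : (`|z 0%R i| <= K)%N.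
  by apply: leq_trans zK; rewrite /nrm (bigD1 i) //= leq_addr.
have inord_val' (k : 'I_d) : inord k = k by apply: val_inj; rewrite /= inordK.
have formE : form t z = \sum_(i < d) (jump t i)%:Z * z 0 (inord i).
  by apply: eq_bigr => i _; rewrite inord_val'.
split; last by rewrite formE; apply: partial_form_lt.
case/rV0Pn: z0 => i0 zi0.
case: (@arg_maxnP _ i0 (fun i => z 0 i != 0) val zi0) => k zk kmax.
have -> : form t z = \sum_(i < k.+1) (jump t i)%:Z * z 0 (inord i).
  rewrite formE [RHS](big_ord_widen d (fun i => (jump t i)%:Z * z 0 (inord i))) ?ltn_ord //.
  rewrite [RHS]big_mkcond /=; apply: eq_bigr => i _; case: ifP => // /negbT.
  rewrite inord_val' -leqNgt => ki; have [->|zi] := eqVneq (z 0 i) 0; first by rewrite mulr0.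
  by have := kmax i zi; rewrite /= leqNgt ki.
rewrite big_ord_recr /= inord_val'.
have := @partial_form_lt t z k (ltnW (ltn_ord k)) zK'.
move: zk; rewrite /jump; have [k0|k0] /= := eqVneq (k : nat) 0%N => zk.
  by rewrite big1 ?add0r ?mul1r // => i _; exfalso; have := ltn_ord i; lia.
rewrite ?(negbTE k0); move: zk;
  move: (\sum_(i < k) _) (z 0 k) (t _ : nat) ((4 * K) ^ k)%N => a b c x b0.
apply: contraTneq => /eqP; rewrite addr_eq0 => /eqP ->.
rewrite abszN abszM absz_nat -leqNgt; apply: leq_trans (leq_addr c _) _.
by rewrite leq_pmulr // absz_gt0.
Qed.

Section Blocks.
Variables (r N : nat) (I : finType) (m : I -> nat) (t : I -> {ffun 'I_d -> 'I_l}).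
Hypotheses (Kr : K = (2 * r).+1) (mN : forall i, (m i <= N)%N).
Hypothesis (mK : forall i, (0 < m i)%N -> ((4 * K) ^ d * l <= m i)%N).

(** The disjoint union of the cyclic groups Z/(m i), where [m i = 0] gives an empty block. *)
Definition blocks : finType := {x : I * 'I_N | (x.2 < m x.1)%N}.

Definition block_adj : rel blocks := fun x y : blocks => ((val x).1 == (val y).1) &&
  [exists s : dir d, (m (val x).1 %| ((val y).2)%:Z - ((val x).2)%:Z - form (t (val x).1) (uvec
    s))%Z].

Lemma blocks_gt0 (x : blocks) : (0 < m (val x).1)%N.
Proof. by apply: leq_ltn_trans (valP x). Qed.

Definition block_move (x : blocks) z : blocks :=
  insubd x ((val x).1, insubd (val x).2 `|((((val x).2)%:Z + form (t (val x).1) z) %% m (val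
    x).1)%Z|%N).

Lemma block_moveE x z : (val (block_move x z)).1 = (val x).1 /\
  ((val (block_move x z)).2)%:Z = ((((val x).2)%:Z + form (t (val x).1) z) %% m (val x).1)%Z.
Proof.
have m0 := blocks_gt0 x; set i := (val x).1 in m0 *; set a := _%:Z + _.
have mz : (m i)%:Z != 0 by lia.
have am : (`|(a %% m i)%Z| < m i)%N.
  have := modz_ge0 a mz; have := @ltz_pmod a (m i) m0; move: (a %% _)%Z => c; lia.
rewrite /block_move val_insubd /= val_insubd (leq_trans am (mN i)) /= am /= val_insubd
  (leq_trans am (mN i)).
split=> //; rewrite gez0_abs // modz_ge0 //.
Qed.

Lemma block_eq (x y : blocks) : (val x).1 = (val y).1 ->
  (m (val x).1 %| ((val x).2)%:Z - ((val y).2)%:Z)%Z -> x = y.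
Proof.
move=> xy1; have := valP x; have := valP y; rewrite -xy1 /= => ym xm dv.
apply: val_inj; rewrite [val x]surjective_pairing [val y]surjective_pairing xy1; congr pair.
apply: val_inj => /=; move: dv; rewrite dvdzE absz_nat => /dvdn_leq.
move: (nat_of_ord _) (nat_of_ord _) xm ym => a b; lia.
Qed.

Lemma block_move_dvd x z (y : blocks) : block_move x z = y <->
  (val y).1 = (val x).1 /\
  (m (val x).1 %| ((val y).2)%:Z - ((val x).2)%:Z - form (t (val x).1) z)%Z.
Proof.
have [m1 m2] := block_moveE x z.
have dv : (m (val x).1 %| ((val (block_move x z)).2)%:Z - ((val x).2)%:Z - form (t (val x).1)
  z)%Z.
  rewrite m2 -addrA -opprD; set a := _ + form _ _.
  by rewrite [X in _ - X](divz_eq a (m (val x).1)) opprD addrCA subrr addr0 dvdzN dvdz_mull.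
split=> [<- //|[y1 y2]]; apply: block_eq; rewrite ?y1 // m1.
have := dvdz_sub dv y2; congr (_ %| _)%Z; ring.
Qed.

(** On nonzero vectors of norm at most K = 2r+1 the form is nonzero and smaller than the block size,
    hence not divisible by it. *)
Lemma block_cover x : cover block_adj r (block_move x).
Proof.
split=> [z c|z y zy].
  have [m1 m2] := block_moveE x z; have [_] := proj1 (block_move_dvd x z _) erefl.
  rewrite /block_adj m1 => dv; split=> [/andP[/eqP c1 /existsP[s sP]]|[s sE]].
    exists s; apply/esym/block_move_dvd; split=> //; rewrite formD.
    by have := dvdz_add sP dv; congr (_ %| _)%Z; ring.
  have [c1 c2] := proj1 (block_move_dvd x _ _) (esym sE).
  rewrite c1 eqxx /=; apply/existsP; exists s; have := dvdz_sub c2 dv.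
  by rewrite formD; congr (_ %| _)%Z; ring.
move=> E; have [_ dz] := proj1 (block_move_dvd x z _) erefl.
have [_ dy] := proj1 (block_move_dvd x y _) erefl; rewrite -E in dy.
have dv : (m (val x).1 %| form (t (val x).1) (z - y))%Z.
  by have := dvdz_sub dy dz; rewrite formB; congr (_ %| _)%Z; ring.
apply/eqP; rewrite -subr_eq0; apply: contraT => zy0.
have [f0 fs] := @form_small (t (val x).1) (z - y) (leq_trans zy (eq_leq (esym Kr))) zy0.
have := mK (blocks_gt0 x); move: dv; rewrite dvdzE absz_nat => /dvdn_leq;
  rewrite absz_gt0 => /(_ f0).
by move=> h1 h2; have := leq_trans (leq_trans fs h2) h1; rewrite ltnn.
Qed.

Lemma block_move0 x : block_move x 0 = x.
Proof. by apply/block_move_dvd; split=> //; rewrite form0 subr0 subrr dvdz0. Qed.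

Lemma block_simple : simple_graph block_adj.
Proof.
split=> [x y|x].
  have sym u v : block_adj u v -> block_adj v u.
    case/andP=> /eqP uv /existsP[s sP]; rewrite /block_adj -uv eqxx /=; apply/existsP.
    exists (oppd s); rewrite uvec_opp -[- uvec s]add0r formB form0 -dvdzN.
    by move: sP; congr (_ %| _)%Z; ring.
  by apply/idP/idP; apply: sym.
apply/negbTE/negP => xx; have [nb inj] := block_cover x.
have /nb[s sE] : block_adj (block_move x 0) (block_move x 0) by rewrite block_move0.
have := inj 0 (0 + uvec s); rewrite sub0r add0r nrmN nrm_uvec => /(_ isT).
rewrite add0r in sE; move=> /(_ sE)/esym/eqP; by rewrite (negbTE (uvec_neq0 s)).
Qed.

Lemma card_blocks : #|blocks| = (\sum_i m i)%N.
Proof.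
rewrite card_sub -sum1_card.
rewrite (eq_bigl (fun x : I * 'I_N => xpredT x.1 && (x.2 < m x.1)%N)) //.
rewrite -(pair_big_dep xpredT (fun i (a : 'I_N) => (a < m i)%N) (fun _ _ => 1%N)) /=.
by apply: eq_bigr => i _; rewrite sum1_card card_ord_below.
Qed.

End Blocks.
End Circulant.

(** * Families of circulant graphs *)

(** Greedy choice: each selected element discards its at most k relatives. *)
Lemma independent_ex (T : finType) (R : rel T) (A : {set T}) k : symmetric R ->
  (forall x, x \in A -> R x x) ->
  (forall x, x \in A -> (#|[set y in A | R x y]%SET| <= k)%N) ->
  exists J : {set T}, [/\ J \subset A,
    forall x y, x \in J -> y \in J -> R x y -> x = y & (#|A| <= k * #|J|)%N].
Proof.
move=> Rsym; have [n] := ubnP #|A|; elim: n A => // n IH A An Rxx Rk.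
have [->|[x xA]] := set_0Vmem A.
  by exists finset.set0; split; rewrite ?finset.sub0set ?cards0 // => ? ?; rewrite inE.
pose N := [set y in A | R x y]%SET; have NA : N \subset A.
  by apply/fintype.subsetP => y; rewrite inE => /andP[].
have xN : x \in N by rewrite inE xA Rxx.
have cA : #|A| = (#|N| + #|A :\: N|)%N by rewrite -(cardsID N A) (finset.setIidPr NA).
have N0 : (0 < #|N|)%N by apply/card_gt0P; exists x.
have [|y|y|J [JA Jind cJ]] := IH (A :\: N)%SET.
- by move: An; rewrite cA; lia.
- by rewrite !inE => /andP[_ /Rxx].
- rewrite inE => /andP[_ yA]; apply: leq_trans (Rk y yA).
  apply: subset_leq_card; apply/fintype.subsetP => w; rewrite !inE.
  by case/andP=> /andP[_ ->] ->.
have JN y : y \in J -> y \in A /\ ~~ R x y.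
  by move=> /(fintype.subsetP JA); rewrite !inE => /andP[+ yA]; rewrite yA.
have xJ : x \notin J by apply/negP => /JN[_]; rewrite Rxx.
exists (x |: J)%SET; split.
- apply/fintype.subsetP => y; rewrite !inE => /orP[/eqP -> //|/JN[]//].
- move=> y z; rewrite !inE => /orP[/eqP ->|yJ] /orP[/eqP ->|zJ] //; last exact: Jind.
    by case: (JN z zJ) => _ /negbTE ->.
  by rewrite Rsym; case: (JN y yJ) => _ /negbTE ->.
rewrite cardsU1 xJ cA mulnDr muln1 leq_add //.
exact: Rk.
Qed.

Lemma lgraph_ex (W : finType) (e : rel W) n : simple_graph e -> #|W| = n ->
  exists (G : lgraph n) (h : 'I_n -> W) (g : W -> 'I_n),
    [/\ cancel h g, cancel g h & forall x y, ladj G x y = e (h x) (h y)].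
Proof.
move=> [es ei] <-.
pose A : 'M[bool]_#|W| := \matrix_(i, j) e (enum_val i) (enum_val j).
have AP : [forall i, ~~ A i i] && (A^T == A).
  apply/andP; split; first by apply/forallP => i; rewrite mxE ei.
  by apply/eqP/matrixP => i j; rewrite !mxE es.
exists (exist (fun A : 'M[bool]_#|W| =>
  [forall i, ~~ A i i] && (A^T == A)) A AP), enum_val, enum_rank.
split; [exact: enum_valK|exact: enum_rankK|].
by move=> x y; rewrite /ladj /= mxE.
Qed.

Section LowerBound.
Variables (d' r l m : nat).
Let d := d'.+1.
Let K := (2 * r).+1.
Hypotheses (r2 : (2 <= r)%N) (dr3 : d = 2%N \/ (3 <= r)%N) (l0 : (0 < l)%N).
Hypothesis (lm : ((4 * K) ^ d * l <= m)%N).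

Lemma covers_isomorphic n (G H : lgraph n) : isomorphic G H ->
  (forall v, exists p : 'rV[int]_d -> 'I_n, cover (ladj G) r p /\ p 0 = v) ->
  forall v, exists p : 'rV[int]_d -> 'I_n, cover (ladj H) r p /\ p 0 = v.
Proof.
move=> /existsP[s /is_isomP sP] cG v; have [p [cp p0]] := cG ((s^-1)%g v).
exists (s \o p); split; last by rewrite /= p0 permKV.
apply: (cover_iso _ _ _ cp) => [|x y|x c _]; [exact: perm_inj|exact: sP|].
by exists ((s^-1)%g c); rewrite permKV.
Qed.

Lemma class_locally n (G : lgraph n) :
  (forall v, exists p : 'rV[int]_d -> 'I_n, cover (ladj G) r p /\ p 0 = v) ->
  [set H | isomorphic G H]%SET \in unlabelled_r_locally (@lattice d) 0 r n.
Proof.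
move=> cG; rewrite inE; apply/andP; split.
  apply/imsetP; exists G; first by rewrite inE.
  by apply/finset.setP => H; rewrite !inE.
apply/forall_inP => H; rewrite inE => GH; apply/asboolP.
have [es _] := ladj_simple H; apply/(r_locallyP r2 es dr3); exact: covers_isomorphic GH cG.
Qed.

Let fam : finType := ('I_m * {ffun 'I_d -> 'I_l})%type.

Definition fam_size (x : fam) := (m + x.1)%N.

(** The period lattice of the circulant graph on Z/(fam_size x) with the jumps given by [x.2]. *)
Definition in_kernel (x : fam) (z : 'rV[int]_d) := ((fam_size x)%:Z %| form K x.2 z)%Z.

Definition same_shape (x y : fam) :=
  `[< exists2 b, signed b & forall z, in_kernel x z = in_kernel y (z *m bmx b) >].

Let m0 : (0 < m)%N.
Proof. by apply: leq_trans lm; rewrite muln_gt0 l0 andbT expn_gt0. Qed.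

Lemma kernel_dvd (x y : fam) : (forall z, in_kernel x z -> in_kernel y z) ->
  (fam_size y %| fam_size x)%N.
Proof.
move=> /(_ ((fam_size x)%:Z *: delta_mx 0 ord0)).
by rewrite /in_kernel !formZ !form_delta /jump /= !mulr1 dvdzz => /(_ isT).
Qed.

(** The first jump is 1, so multiples of the first unit vector reveal the size. The vectors jump_k
    e_0 - e_k then reveal each jump modulo the size, and jumps are smaller than the size. *)
Lemma kernel_inj (x y : fam) : x.2 ord0 = y.2 ord0 -> in_kernel x =1 in_kernel y -> x = y.
Proof.
move=> x0 xy; have sxy : fam_size x = fam_size y.
  by apply/eqP; rewrite eqn_dvd !kernel_dvd // => z; rewrite xy.
have jE (k : 'I_d) : jump K x.2 k = jump K y.2 k.
  have := xy ((jump K x.2 k)%:Z *: delta_mx 0 ord0 - delta_mx 0 k).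
  rewrite /in_kernel !formB !formZ !form_delta /= mulr1 subrr dvdz0 => /esym.
  rewrite dvdzE absz_nat => /dvdn_leq.
  have K0 : (0 < K)%N by [].
  have := @jump_lt d' K l K0 l0 x.2 k (ltn_ord k);
    have := @jump_lt d' K l K0 l0 y.2 k (ltn_ord k).
  have : ((4 * K) ^ d * l <= fam_size y)%N by apply: leq_trans lm (leq_addr _ _).
  move: (jump _ _ _) (jump _ _ _) (_ * l)%N (fam_size y) => a b c s; lia.
case: x y x0 xy sxy jE => [x1 x2] [y1 y2] /= x0 _;
  rewrite /fam_size /= => /addnI/val_inj -> jE; congr pair.
apply/ffunP => k; have [->//|k0] := eqVneq k ord0.
have := jE k; rewrite /jump -!val_eqE /= in k0 *; rewrite (negbTE k0) => /addnI.
have -> : inord k = k by apply: val_inj; rewrite /= inordK.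
exact: val_inj.
Qed.

Lemma same_shape_sym : symmetric same_shape.
Proof.
have sym x y : same_shape x y -> same_shape y x.
  move=> /asboolP[b hb bE]; apply/asboolP; exists (b^-1)%g; first exact: signedV.
  by move=> z; rewrite bE -mulmxA bmxVK // mulmx1.
by move=> x y; apply/idP/idP; apply: sym.
Qed.

Lemma same_shape_refl x : same_shape x x.
Proof. by apply/asboolP; exists 1%g => [|z]; rewrite ?signed1 ?bmx1 ?mulmx1. Qed.

Definition normal_fam : {set fam} := [set x : fam | x.2 ord0 == Ordinal l0]%SET.

Lemma card_normal_fam : #|normal_fam| = (m * l ^ d')%N.
Proof.
pose F (k : 'I_d) : pred 'I_l := if k == ord0 then pred1 (Ordinal l0) else predT.
have -> : #|normal_fam| = #|finset.setX [set: 'I_m]%SET [set t | t \in family F]%SET|.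
  apply: eq_card => -[a t];
    rewrite [LHS]inE finset.in_setX finset.in_setT /= [RHS]finset.in_set;
      apply/eqP/familyP => [t0 k|/(_ ord0)].
    by rewrite /F; case: eqP => [->|//]; rewrite inE t0.
  by rewrite inE => /eqP.
rewrite cardsX cardsT card_ord cardsE card_family foldrE big_map big_enum /=; congr muln.
rewrite (bigD1 ord0) //= /F eqxx card1 mul1n.
rewrite (eq_bigr (fun=> l)) => [|k /negbTE ->]; last by rewrite card_ord.
rewrite prod_nat_const; congr (_ ^ _)%N.
by rewrite (eq_card (B := predC1 ord0)) // cardC1 card_ord.
Qed.

(** [x] and the signed permutation determine the kernel of [y], hence [y]. *)
Lemma card_same_shape x : x \in normal_fam ->
  (#|[set y in normal_fam | same_shape x y]%SET| <= #|{perm dir d}|)%N.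
Proof.
move=> xn; have /choice[b bP] : forall y, exists b : {perm dir d}, same_shape x y ->
    signed b /\ forall z, in_kernel x z = in_kernel y (z *m bmx b).
  move=> y; have [/asboolP[b hb bE]|_] := boolP (same_shape x y); first by exists b.
  by exists 1%g.
rewrite -(card_in_imset (f := b)); first exact: max_card.
move=> y y'; rewrite !inE => /andP[/eqP y0 xy] /andP[/eqP y'0 xy'] bE.
apply: kernel_inj; first by rewrite y0 y'0.
have [hb yE] := bP y xy; have [_ y'E] := bP y' xy'.
by move=> z; rewrite -[z]mulmx1 -(bmxVK hb) mulmxA -yE bE -y'E.
Qed.

End LowerBound.

(** * Disjoint unions of circulant graphs *)

Section ManyClasses.
Variables (d' r l m : nat).
Let d := d'.+1.
Let K := (2 * r).+1.
Hypotheses (r2 : (2 <= r)%N) (dr3 : d = 2%N \/ (3 <= r)%N) (l0 : (0 < l)%N).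
Hypothesis (lm : ((4 * K) ^ d * l <= m)%N).

Let fam : finType := ('I_m * {ffun 'I_d -> 'I_l})%type.

Lemma block_fibre N (I : finType) (s : I -> nat) (t : I -> {ffun 'I_d -> 'I_l})
    (x : blocks N s) (z : 'rV[int]_d) : (forall i, (s i <= N)%N) ->
  block_move K t x z = x <-> ((s (val x).1)%:Z %| form K (t (val x).1) z)%Z.
Proof.
move=> sN; have K0 : (0 < K)%N by [].
rewrite (block_move_dvd K0 l0 t (erefl : K = (2 * r).+1) sN) subrr sub0r dvdzN.
by split=> [[]|].
Qed.

Definition realizes n (G : lgraph n) (x : fam) := exists2 p, cover (ladj G) r p &
  forall z, p z = p 0 <-> in_kernel r x z.

Lemma realizes_iso n (G H : lgraph n) x : isomorphic G H -> realizes G x -> realizes H x.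
Proof.
move=> /existsP[s /is_isomP sP] [p cp px]; exists (s \o p).
  apply: (cover_iso _ _ _ cp) => [|u v|u c _]; [exact: perm_inj|exact: sP|].
  by exists ((s^-1)%g c); rewrite permKV.
by move=> z; rewrite -px; split=> [/perm_inj|/= ->].
Qed.

Variables (n : nat) (J : {set fam}).
Hypothesis (J_ind : forall x y, x \in J -> y \in J -> same_shape r x y -> x = y).
Hypothesis (nJ : (2 * m * (#|J|.+1) <= n)%N).

Let m0 : (0 < m)%N.
Proof. by apply: leq_trans lm; rewrite muln_gt0 l0 andbT expn_gt0. Qed.

(* Blocks outside S are empty, and the block None fills up to n vertices. *)
Definition union_size (S : {set fam}) (i : option fam) : nat :=
  if i is Some x then (if x \in S then fam_size x else 0)%N
  else (n - \sum_(x in S) fam_size x)%N.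

Definition union_jumps (i : option fam) : {ffun 'I_d -> 'I_l} :=
  if i is Some x then x.2 else [ffun=> Ordinal l0].

Let size_lt x : (fam_size (x : fam) < 2 * m)%N.
Proof. by rewrite /fam_size mul2n -addnn ltn_add2l. Qed.

Let sum_size (S : {set fam}) : S \subset J -> (\sum_(x in S) fam_size x <= 2 * m * #|J|)%N.
Proof.
move=> SJ; apply: (@leq_trans (\sum_(x in S) 2 * m)%N).
  by apply: leq_sum => x _; apply: ltnW.
by rewrite sum_nat_const mulnC leq_mul2l subset_leq_card ?orbT.
Qed.

Let filler_size (S : {set fam}) : S \subset J -> (2 * m <= union_size S None)%N.
Proof.
move=> /sum_size sS; rewrite /union_size; move: nJ sS; rewrite mulnS.
by move: (2 * m)%N (\sum_(_ in _) _)%N (#|J|) => a b c; nia.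
Qed.

Let union_size_le (S : {set fam}) i : S \subset J -> (union_size S i <= n)%N.
Proof.
move=> SJ; case: i => [x|]; last exact: leq_subr.
rewrite /=; case: ifP => // _; apply: leq_trans (ltnW (size_lt x)) _.
by apply: leq_trans nJ; rewrite leq_pmulr.
Qed.

Let union_size_ge (S : {set fam}) i : S \subset J -> (0 < union_size S i)%N -> ((4 * K) ^ d * l
  <= union_size S i)%N.
Proof.
move=> SJ; case: i => [x|_] /=.
  by case: ifP => // _ _; apply: leq_trans lm (leq_addr _ _).
apply: leq_trans lm _; apply: leq_trans (filler_size SJ).
by rewrite mul2n -addnn leq_addr.
Qed.

(** If [x] is realised, its component is a block with the same kernel up to a signed permutation. A
    block of [S] must be [x] by independence; the filler is excluded because its size, at least 2m,
    would divide [fam_size x] < 2m. *)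
Lemma union_graph (S : {set fam}) : S \subset J -> exists G : lgraph n,
  (forall v, exists p : 'rV[int]_d -> 'I_n, cover (ladj G) r p /\ p 0 = v) /\
  forall x, x \in J -> realizes G x <-> x \in S.
Proof.
move=> SJ; have K0 : (0 < K)%N by [].
have sN i := @union_size_le S i SJ; have sK i := @union_size_ge S i SJ.
have Kr : K = (2 * r).+1 by [].
have simp := block_simple K0 l0 union_jumps Kr sN sK.
have bcov := block_cover K0 l0 union_jumps Kr sN sK.
have b0 := block_move0 K0 l0 union_jumps Kr sN.
pose W := blocks n (union_size S).
have cW : #|W| = n.
  rewrite (card_blocks sN) (bigD1 None) //= (reindex_omap Some id) /=; last by case.
  rewrite [X in (_ + X)%N](eq_bigl xpredT) => [|x]; last by rewrite /= eqxx.
  rewrite -big_mkcond /= subnK //.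
  by have := filler_size SJ; rewrite /=; move: (\sum_(_ in _) _)%N => a; have := m0; lia.
have [G [h [g [hK gK hE]]]] := lgraph_ex simp cW.
have h_inj := can_inj hK; have g_inj := can_inj gK.
have coverh p : cover (ladj G) r p -> cover (block_adj K union_jumps) r (h \o p).
  move=> cp; apply: (cover_iso _ _ _ cp) => [|x y|x c _]; [exact: h_inj|by rewrite hE|].
  by exists (g c); rewrite gK.
have coverg p : cover (block_adj K union_jumps) r p -> cover (ladj G) r (g \o p).
  move=> cp; apply: (cover_iso _ _ _ cp) => [|x y|x c _]; [exact: g_inj|by rewrite hE !gK|].
  by exists (h c); rewrite hK.
exists G; split.
  move=> v; exists (g \o block_move K union_jumps (h v)); split; first exact: coverg.
  by rewrite /= b0 hK.
move=> x xJ; split=> [[p cp px]|xS].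
  pose w := h (p 0); have [b hb bE] := cover_same_base r2 (bcov w) (coverh _ p cp) (b0 w).
  have ker z : in_kernel r x z <->
      ((union_size S (val w).1)%:Z %| form K (union_jumps (val w).1) (z *m bmx b))%Z.
    rewrite -px -block_fibre //; split=> [E|E].
      by rewrite -bE /= E.
    by apply: h_inj; rewrite -[LHS]/((h \o p) z) bE E.
  have := blocks_gt0 w; move: ker; case: (val w).1 => [y|] /= ker.
    case: ifP ker => // yS ker _; suff -> : x = y by [].
    apply: J_ind => //; first exact: (fintype.subsetP SJ).
    by apply/asboolP; exists b => // z; apply/idP/idP => /ker.
  have := ker ((fam_size x)%:Z *: (delta_mx 0 ord0 *m bmx b^-1%g)).
  rewrite -scalemxAl -mulmxA bmxVK // mulmx1 /in_kernel !formZ form_delta /jump /= mulr1.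
  rewrite dvdz_mulr // => -[/(_ isT)]; rewrite dvdzE !absz_nat => /dvdn_leq.
  have x0 : (0 < fam_size x)%N by rewrite addn_gt0 m0.
  move=> /(_ x0) le1 _ _; have := leq_trans (filler_size SJ) le1.
  by rewrite leqNgt size_lt.
have xs0 : (0 < fam_size x)%N by rewrite addn_gt0 m0.
have xn : (fam_size x <= n)%N by have := sN (Some x); rewrite /= xS.
pose w0 : option fam * 'I_n := (Some x, Ordinal (leq_trans xs0 xn)).
have w0P : (w0.2 < union_size S w0.1)%N by rewrite /= xS.
pose w : W := Sub w0 w0P.
exists (g \o block_move K union_jumps w); first exact: coverg.
move=> z; rewrite /= b0; have := block_fibre union_jumps w z sN.
rewrite SubK /= xS => <-; split=> [/g_inj //|-> //].
Qed.

Lemma many_classes : (2 ^ #|J| <= #|unlabelled_r_locally (@lattice d) 0%R r n|)%N.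
Proof.
have /choice[G GP] : forall S : {set fam}, exists G : lgraph n, S \subset J ->
    (forall v, exists p : 'rV[int]_d -> 'I_n, cover (ladj G) r p /\ p 0 = v) /\
    forall x, x \in J -> realizes G x <-> x \in S.
  move=> S; have [SJ|_] := boolP (S \subset J).
    by have [G GP] := union_graph SJ; exists G.
  by have [G _] := union_graph (finset.sub0set J); exists G.
rewrite -card_powerset -(card_in_imset (f := fun S => [set H | isomorphic (G S) H]%SET)).
  apply: subset_leq_card; apply/fintype.subsetP => C /imsetP[S]; rewrite powersetE => SJ ->.
  by apply: class_locally => //; case: (GP S SJ).
move=> S S'; rewrite !powersetE => SJ S'J /finset.setP E.
have [_ SP] := GP S SJ; have [_ S'P] := GP S' S'J.
have iso1 H : isomorphic H H.
  by apply/existsP; exists 1%g; apply/is_isomP => x y; rewrite !perm1.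
have iso12 : isomorphic (G S) (G S') by have := E (G S'); rewrite !inE iso1.
have iso21 : isomorphic (G S') (G S) by have := E (G S); rewrite !inE iso1.
apply/finset.setP => x; have [xJ|xJ] := boolP (x \in J).
  by apply/idP/idP => [/(SP x xJ)/(realizes_iso iso12)/(S'P x xJ)|/(S'P x xJ)/(realizes_iso
    iso21)/(SP x xJ)].
have out (R : {set fam}) : R \subset J -> x \in R = false.
  by move=> /fintype.subsetP RJ; apply: contraNF xJ; apply: RJ.
by rewrite !out.
Qed.

End ManyClasses.

(** * Asymptotics *)

(** With q = x / (a+1) one has x <= (a+1) 2^q; raising this to the power a+1 leaves a spare factor x
    that absorbs the constants. *)
Lemma exp_beats_poly C a : exists x0, forall x, (x0 <= x)%N -> (C * x ^ a <= 2 ^ x)%N.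
Proof.
exists (C * a.+1 ^ a.+1)%N => x xC.
have [x0|x0] := posnP x.
  by move: xC; rewrite x0 leqn0 muln_eq0 expn_eq0 /= orbF => /eqP ->.
pose q := (x %/ a.+1)%N.
have h1 : (x <= a.+1 * 2 ^ q)%N.
  have := ltn_pmod x (ltn0Sn a); have := divn_eq x a.+1; rewrite -/q.
  have := ltn_expl q (ltnSn 1); nia.
have h2 : (x ^ a.+1 <= a.+1 ^ a.+1 * 2 ^ x)%N.
  apply: (@leq_trans ((a.+1 * 2 ^ q) ^ a.+1)); first by rewrite leq_exp2r.
  rewrite expnMn leq_mul2l -expnM leq_exp2l //; apply/orP; right; exact: leq_trunc_div.
have c0 : (0 < a.+1 ^ a.+1)%N by rewrite expn_gt0.
rewrite -(leq_pmul2l c0) mulnA; apply: leq_trans h2;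
  rewrite [leqRHS]expnS leq_mul2r [(_ * C)%N]mulnC.
by rewrite xC orbT.
Qed.

Lemma lg_le_pow x a : (x < 2 ^ a)%N -> (0 < a)%N -> (lg x <= a)%N.
Proof.
move=> xa a0; rewrite /lg ltnNge; apply/negP => ax.
have [x0|x0] := posnP x; first by move: ax; rewrite x0 trunc_log0 leqNgt a0.
have := trunc_logP (ltnSn 1) x0; rewrite leqNgt => /negP; apply.
by apply: leq_trans xa _; rewrite leq_exp2l.
Qed.

Lemma pow_lg x : (x < 2 ^ lg x)%N.
Proof. exact: trunc_log_ltn. Qed.

Lemma lg_pow_le C a : exists x0, forall x, (x0 <= x)%N -> (C * lg x ^ a <= x)%N.
Proof.
have [l0 l0P] := exp_beats_poly (2 * C) a; exists (2 ^ l0)%N => x xl.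
have x0 : (0 < x)%N by apply: leq_trans xl; rewrite expn_gt0.
have ll : (l0 <= lg x)%N.
  by rewrite /lg ltnW // ltnS trunc_log_max.
have := l0P _ ll; have := trunc_logP (ltnSn 1) x0; rewrite /lg expnS.
move: (2 ^ _)%N (_ ^ a)%N => u v; nia.
Qed.

Lemma root_scale e n : (0 < e)%N -> (4 <= n)%N ->
  exists2 M, (0 < M)%N & (4 * M ^ e <= n < 4 * M.+1 ^ e)%N.
Proof.
move=> e0 n4; pose P M := (4 * M ^ e <= n)%N.
have P1 : exists M, P M by exists 1%N; rewrite /P exp1n muln1.
have Pb M : P M -> (M <= n)%N.
  move=> PM; apply: leq_trans PM; have [->//|M0] := posnP M.
  apply: (@leq_trans (M ^ e)); last by rewrite leq_pmull.
  by rewrite -{1}[M]expn1 leq_pexp2l.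
case: (ex_maxnP P1 Pb) => M PM Mmax; exists M.
  by apply: Mmax; rewrite /P exp1n muln1.
by rewrite -/(P M) PM /= ltnNge; apply/negP => /Mmax; rewrite ltnn.
Qed.

Section Asymptotics.
Variables (d' r : nat).
Let d := d'.+1.
Hypotheses (d2 : (2 <= d)%N) (r2 : (2 <= r)%N) (dr3 : d = 2%N \/ (3 <= r)%N).
Hypothesis (dr : (d <= (2 * r).+1)%N).

Let beta := #|{perm dir d}|.
Let K := (2 * r).+1.

Let beta0 : (0 < beta)%N.
Proof. by apply/card_gt0P; exists 1%g. Qed.

(** For m = M^d there are at most m^d normalised circulant graphs, each of size below 2m, so a
    filler and all selected ones fit into 4 m^(d+1) <= n vertices. [A] pays for coincidences under
    signed permutations and for the bound m / B on the jump parameters. *)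
Lemma total_classes : exists A, forall n M, ((4 * K) ^ d <= M)%N ->
  (4 * M ^ (d * d.+1) <= n)%N ->
  exists2 j, (M ^ (d * d) <= A * j)%N &
    (2 ^ j <= #|unlabelled_r_locally (@lattice d) 0%R r n|)%N.
Proof.
pose B := ((4 * K) ^ d)%N; exists (beta * (2 * B) ^ d')%N => n M BM Mn.
have B0 : (0 < B)%N by rewrite expn_gt0.
have M0 : (0 < M)%N by apply: leq_trans BM.
pose m := (M ^ d)%N; have Mm : (M <= m)%N by rewrite -{1}[M]expn1 leq_pexp2l.
have m0 : (0 < m)%N by apply: leq_trans Mm.
pose l := (m %/ B)%N; have l0 : (0 < l)%N by rewrite divn_gt0 // (leq_trans BM Mm).
have lm : (B * l <= m)%N by rewrite mulnC leq_trunc_div.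
have ml : (m <= 2 * B * l)%N.
  have := ltn_pmod m B0; have := divn_eq m B; rewrite -/l; nia.
pose R : rel ('I_m * {ffun 'I_d -> 'I_l})%type := fun x y => same_shape r x y.
have [J [JA Jind cJ]] := @independent_ex _ R (normal_fam d' m l0) beta (@same_shape_sym d' r l m)
  (fun x _ => same_shape_refl r x) (fun x => @card_same_shape d' r l m r2 dr3 l0 lm x).
exists #|J|; last first.
  apply: (@many_classes d' r l m r2 dr3 l0 lm n J Jind).
  have cJ' : (#|J| <= m ^ d)%N.
    apply: leq_trans (subset_leq_card JA) _; rewrite card_normal_fam expnS leq_mul2l.
    by case: (d') => [|e]; rewrite ?expn0 ?orbT // leq_exp2r // leq_div ?orbT.
  apply: leq_trans Mn; rewrite expnM -/m expnS.
  have md : (0 < m ^ d)%N by rewrite expn_gt0 m0.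
  rewrite (_ : (4 * (m * m ^ d) = 2 * m * (2 * m ^ d))%N); last by ring.
  rewrite leq_mul2l; apply/orP; right; move: cJ' md; move: (m ^ d)%N => u h1 h2.
  by apply: leq_ltn_trans h1 _; rewrite ltn_Pmull.
rewrite card_normal_fam in cJ.
rewrite expnM -/m -mulnA [in leqRHS]mulnCA.
apply: (@leq_trans ((2 * B) ^ d' * (m * l ^ d'))); last by rewrite leq_mul2l cJ orbT.
rewrite mulnCA -expnMn expnS leq_mul2l.
by case: (d') => [|e]; rewrite ?expn0 ?orbT // leq_exp2r // ml orbT.
Qed.

(** The threshold y = M^(d+1) balances the two exponents: y^(d-1) equals M^(d^2-1), and n / y is at
    most a constant times it. *)
Lemma bad_exponent : exists C, forall n M, (0 < M)%N ->
  (4 * M ^ (d * d.+1) <= n < 4 * M.+1 ^ (d * d.+1))%N ->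
  (#|[set C in unlabelled_r_locally (@lattice d) 0%R r n |
     [exists G in C, (#|good_roots d r (ladj G)| < M ^ (d * d).-1)%N]]%SET| <=
    2 ^ (C * lg M ^ (2 * d).+1 * M ^ (d * d).-1))%N.
Proof.
have [C1 [C2 bad]] := bad_classes d2 r2 dr3 dr.
pose D := (d * d.+1)%N; pose e := (2 * D + 2)%N.
pose c3 := (C2.+1 * beta ^ (d * d))%N.
pose h := (d.+1 + beta)%N.
exists (e * (C1 * (beta ^ d.-1 * h ^ (2 * d))) + (c3 + e * (d * d)) * (1 + 4 * 2 ^ D))%N =>
  n M M0 /andP[Mn nM].
set lam := lg M; have lam0 : (0 < lam)%N by [].
pose y := (M ^ d.+1)%N; have y0 : (0 < y)%N by rewrite expn_gt0 M0.
apply: leq_trans (bad n y _ y0) _.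
have nM' : (n < 4 * 2 ^ D * M ^ D)%N.
  apply: leq_trans nM _; rewrite -mulnA -expnMn leq_mul2l leq_exp2r ?muln_gt0 //.
  by lia.
have ML : (M < 2 ^ lam)%N by apply: pow_lg.
have n2 : (n.+1 <= 2 ^ (e * lam))%N.
  apply: leq_trans nM' _.
  apply: (@leq_trans (4 * 2 ^ D * (2 ^ lam) ^ D)).
    by rewrite leq_mul2l leq_exp2r ?muln_gt0 // ltnW ?orbT.
  rewrite -expnM -[4%N]/(2 ^ 2)%N -!expnD leq_exp2l // /e; nia.
have lgy : (lg (y * beta) <= h * lam)%N.
  apply: lg_le_pow; last by rewrite muln_gt0 lam0 andbT addn_gt0.
  apply: (@leq_trans ((2 ^ lam) ^ d.+1 * 2 ^ beta)).
    apply: (@leq_ltn_trans ((2 ^ lam) ^ d.+1 * beta)).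
      by rewrite leq_mul2r leq_exp2r // ltnW ?orbT.
    by rewrite ltn_pmul2l ?expn_gt0 // ltn_expl.
  by rewrite -expnM -expnD leq_exp2l // /h; nia.
have dd : (d.+1 * d.-1 = (d * d).-1)%N by rewrite /d; lia.
have E1 : ((y * beta) ^ d.-1 * lg (y * beta) ^ (2 * d) <=
    beta ^ d.-1 * h ^ (2 * d) * (lam ^ (2 * d) * M ^ (d * d).-1))%N.
  apply: (@leq_trans ((y * beta) ^ d.-1 * (h * lam) ^ (2 * d))).
    by rewrite leq_mul2l leq_exp2r ?lgy ?orbT.
  rewrite (expnMn y) (expnMn h) /y -expnM dd; apply/eq_leq; ring.
have E2 : ((C2 * (n * beta).+1 ^ (d * d)).+1 <= 2 ^ (c3 + e * (d * d) * lam))%N.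
  apply: (@leq_trans (c3 * n.+1 ^ (d * d))).
    have b1 : ((n * beta).+1 <= beta * n.+1)%N by rewrite mulnS [(beta * n)%N]mulnC -add1n
      leq_add2r.
    have : ((n * beta).+1 ^ (d * d) <= beta ^ (d * d) * n.+1 ^ (d * d))%N.
      by rewrite -expnMn leq_exp2r // muln_gt0.
    have : (0 < beta ^ (d * d) * n.+1 ^ (d * d))%N by rewrite muln_gt0 !expn_gt0 beta0.
    rewrite /c3 -mulnA => w0 vw; rewrite mulSn -addn1 addnC leq_add //.
    by rewrite leq_mul2l vw orbT.
  rewrite expnD leq_mul //; first by rewrite ltnW // ltn_expl.
  by rewrite mulnAC [leqRHS]expnM leq_exp2r // muln_gt0.
have E3 : (M ^ (d * d).-1 + n %/ y <= (1 + 4 * 2 ^ D) * M ^ (d * d).-1)%N.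
  rewrite mulnDl mul1n leq_add2l -(leq_pmul2r y0); apply: leq_trans (leq_trunc_div _ _) _.
  apply: leq_trans (ltnW nM') _; rewrite -[leqRHS]mulnA leq_mul2l /y -expnD.
  rewrite (_ : (d * d).-1 + d.+1 = D)%N ?leqnn ?orbT //.
  by rewrite addnS -addSn prednK // /D mulnS addnC.
apply: (@leq_trans (2 ^ (e * lam * (C1 * (beta ^ d.-1 * h ^ (2 * d) * (lam ^ (2 * d) * M ^ (d *
  d).-1)))) *
   2 ^ ((c3 + e * (d * d) * lam) * ((1 + 4 * 2 ^ D) * M ^ (d * d).-1)))).
  apply: leq_mul.
    rewrite [leqRHS]expnM;
      apply: (@leq_trans (n.+1 ^ (C1 * (beta ^ d.-1 * h ^ (2 * d) * (lam ^ (2 * d) * M ^ (d *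
        d).-1))))).
      by rewrite leq_pexp2l // leq_mul2l E1 orbT.
    by case: (C1 * _)%N => [|u]; rewrite ?expn0 // leq_exp2r.
  rewrite [leqRHS]expnM; apply: leq_trans (leq_pexp2l _ E3) _ => //.
  by case: (_ * M ^ _)%N => [|u]; rewrite ?expn0 // leq_exp2r.
rewrite -expnD leq_exp2l // [in leqRHS]expnS.
have l1 : (0 < lam ^ (2 * d))%N by rewrite expn_gt0 lam0.
move: l1; move: (lam ^ (2 * d))%N (M ^ _)%N (_ * h ^ _)%N (1 + _)%N => u v w z u0.
move: (e * (d * d))%N => f.
rewrite [leqRHS](_ : _ = e * lam * (C1 * (w * (u * v))) + (c3 + f) * lam * u * (z * v))%N;
  last by ring.
rewrite leq_add2l leq_mul2r; apply/orP; right.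
apply: (@leq_trans ((c3 + f) * lam)); last by rewrite leq_pmulr.
by rewrite mulnDl leq_add2r leq_pmulr.
Qed.

End Asymptotics.

(** Everything follows once M exceeds A (C + k) lg(M)^(2d+1) and a constant times lg(M): then
    M^(d^2) / A beats C lg(M)^(2d+1) M^(d^2-1) + k. *)
Lemma bad_is_negligible d' r (d := d'.+1) (D := (d * d.+1)%N) k : (2 <= d)%N -> (2 <= r)%N ->
  d = 2%N \/ (3 <= r)%N -> (d <= (2 * r).+1)%N ->
  exists n0, forall n, (n0 <= n)%N -> exists M,
    [/\ (0 < n)%N, (n <= (2 ^ (D + 2) * M ^ (d * d - 2)) ^ 6)%N,
        (n <= 2 ^ ((2 * D + 2) * lg M))%N, (2 ^ (D + 2) * ((2 * D + 2) * lg M) <= M)%N &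
        let U := unlabelled_r_locally (@lattice d) 0%R r n in (0 < #|U|)%N /\
        (#|[set C in U | [exists G in C, (#|good_roots d r (ladj G)| < M ^ (d * d).-1)%N]]%SET|
          * 2 ^ k <= #|U|)%N].
Proof.
move=> d2 r2 dr3 dr.
have [A total] := total_classes d2 r2 dr3 dr; have [C bad] := bad_exponent d2 r2 dr3 dr.
have [M1 M1P] := lg_pow_le (A * (C + k)) (2 * d).+1.
have [M2 M2P] := lg_pow_le (2 ^ (D + 2) * (2 * D + 2)) 1.
pose M0 := (maxn M1 M2 + (4 * (2 * r).+1) ^ d)%N.
exists (4 * M0 ^ D + 4)%N => n n0n.
have D0 : (0 < D)%N by [].
have [M Mpos /andP[Mn nM]] := root_scale D0 (leq_trans (leq_addl _ _) n0n).
have M0M : (M0 <= M)%N.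
  rewrite -ltnS ltnNge; apply/negP => MM0.
  have : (4 * M.+1 ^ D <= n)%N.
    by apply: leq_trans (leq_trans (leq_addr 4 _) n0n); rewrite leq_mul2l leq_exp2r.
  by rewrite leqNgt nM.
have nM' : (n <= 4 * 2 ^ D * M ^ D)%N.
  apply: leq_trans (ltnW nM) _; rewrite -mulnA -expnMn leq_mul2l leq_exp2r //.
  by apply/orP; right; lia.
have ML := pow_lg M; have lam0 : (0 < lg M)%N by [].
exists M; split.
- by apply: leq_trans n0n; rewrite addn_gt0 orbT.
(* The exponents compare by d(d+1) <= 6 (d^2 - 2) for d >= 2. *)
- apply: leq_trans nM' _; rewrite expnMn; apply: leq_mul.
    by rewrite -[4%N]/(2 ^ 2)%N -expnD -expnM leq_exp2l // addnC leq_pmulr.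
  rewrite -expnM leq_pexp2l // /D; move: d2; rewrite -/d; case: (d) => [|[|e]] // _; nia.
- apply: leq_trans nM' _; apply: (@leq_trans (4 * 2 ^ D * (2 ^ lg M) ^ D)).
    by rewrite leq_mul2l leq_exp2r // ltnW ?orbT.
  rewrite -expnM -[4%N]/(2 ^ 2)%N -!expnD leq_exp2l //; nia.
- have := M2P M; rewrite expn1 mulnA; apply.
  by apply: leq_trans M0M; rewrite /M0 (leq_trans (leq_maxr M1 M2)) ?leq_addr.
set U := unlabelled_r_locally _ _ _ _.
have BM : ((4 * (2 * r).+1) ^ d <= M)%N by apply: leq_trans M0M; rewrite leq_addl.
have [j Mj jU] := total n M BM Mn; split; first by apply: leq_trans jU; rewrite expn_gt0.
apply: leq_trans jU; apply: leq_trans (leq_mul (bad n M Mpos _) (leqnn _)) _; first by rewrite Mn.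
rewrite -expnD leq_exp2l //.
have A0 : (0 < A)%N by case: (A) Mj => //; rewrite leqNgt expn_gt0 Mpos.
rewrite -(leq_pmul2l A0); apply: leq_trans Mj.
have -> : (M ^ (d * d) = M * M ^ (d * d).-1)%N by rewrite -expnS prednK.
have v0 : (0 < M ^ (d * d).-1)%N by rewrite expn_gt0 Mpos.
have u0 : (0 < lg M ^ (2 * d).+1)%N by rewrite expn_gt0.
have hM : (A * (C + k) * lg M ^ (2 * d).+1 <= M)%N.
  by apply: M1P; apply: leq_trans M0M; rewrite /M0 (leq_trans (leq_maxl M1 M2)) ?leq_addr.
apply: leq_trans (leq_mul hM (leqnn _)); move: (lg M ^ _)%N (M ^ _)%N u0 v0 => u v u0 v0.
rewrite -[leqRHS]mulnA -[leqRHS]mulnA leq_mul2l; apply/orP; right.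
by rewrite mulnDl mulnA leq_add2l leq_pmulr // muln_gt0 u0.
Qed.

Lemma card_graph_aut n d r (G : lgraph n) : (0 < d)%N -> (2 <= r)%N ->
  (2 ^ #|good_roots d r (ladj G)| <= #|graph_aut G|)%N.
Proof.
move=> d0 r2; have [es _] := ladj_simple G.
by apply: leq_trans (card_shift_automorphisms r2 es d0) _.
Qed.

Lemma root_log_bound (R : realType) (n N L K : nat) : (0 < n)%N -> (n <= N ^ 6)%N ->
  (n <= 2 ^ L)%N -> (N * L <= K)%N ->
  expR (1 * n%:R `^ 6^-1 * ln n%:R) <= (2 ^ K)%N%:R :> R.
Proof.
move=> n0 nN nL NLK; have n0' : (0 : R) < n%:R by rewrite ltr0n.
have ln2 : 0 <= ln 2%:R :> R by rewrite ln_ge0 // ler1n.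
have h1 : n%:R `^ 6^-1 <= N%:R :> R.
  have -> : (N%:R : R) = (N%:R ^+ 6) `^ 6^-1.
    by rewrite -powR_mulrn // -powRrM mulfV ?powRr1 // pnatr_eq0.
  by rewrite ge0_ler_powR ?nnegrE ?invr_ge0 ?ler0n ?exprn_ge0 // -natrX ler_nat.
have h2 : ln n%:R <= L%:R * ln 2%:R :> R.
  rewrite mulr_natl -lnXn ?ltr0n // -natrX ler_ln ?posrE ?ltr0n ?expn_gt0 //.
  by rewrite ler_nat.
rewrite natrX -[X in _ <= X ^+ _](@lnK R) ?posrE ?ltr0n // -expRM_natl ler_expR mul1r.
apply: (@le_trans _ _ (N%:R * (L%:R * ln 2%:R))).
  by rewrite ler_pM ?powR_ge0 // ln_ge0 // ler1n.
by rewrite mulrA -natrM ler_wpM2r // ler_nat.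
Qed.

Theorem proposition46 (R : realType) :
  exists2 c : R, 0 < c &
    forall d r : nat, (2 <= d)%N -> (rstar d <= r)%N ->
      (fun n : nat =>
         prob_aut_ge (@lattice d) 0 r n
           (expR (c * n%:R `^ 6^-1 * ln n%:R)))
        @ \oo --> (1 : R).
Proof.
exists 1 => // -[//|d'] r d2 dr.
have r2 : (2 <= r)%N by move: dr; rewrite /rstar; case: ifP => // _; case: ifP => //; lia.
have dr3 : d'.+1 = 2%N \/ (3 <= r)%N.
  by move: dr; rewrite /rstar; case: eqP => [->|_]; [left|case: ifP; [right|right; lia]].
(* For d >= 8 this is what the value ceil((d-1)/2) of [rstar] provides, and it is the condition for
   torsion-freeness. *)
have d2r : (d'.+1 <= (2 * r).+1)%N.
  by move: dr; rewrite /rstar; case: eqP => [|_]; [lia|case: ifP; lia].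
apply/cvgrPdist_le => eps eps0.
pose k := Num.bound eps^-1.
have epsk : (2 ^ k)%N%:R^-1 <= eps.
  rewrite -[leRHS]invrK lef_pV2 ?posrE ?invr_gt0 ?ltr0n ?expn_gt0 //.
  apply: le_trans (ltW (archi_boundP _)) _; first by rewrite invr_ge0 ltW.
  by rewrite ler_nat ltnW // ltn_expl.
have [n0 n0P] := bad_is_negligible k d2 r2 dr3 d2r.
near=> n; have n0n : (n0 <= n)%N by near: n; exact: nbhs_infty_ge.
have [M [n_gt0 nN nL NL [U0 badU]]] := n0P n n0n.
rewrite /prob_aut_ge /unif_prob; set U := unlabelled_r_locally _ _ _ _ in U0 badU *.
set t := expR _; pose E (C : {set lgraph n}) := [forall G in C, t <= #|graph_aut G|%:R].
rewrite (_ : finset _ = [set C in U | E C]%SET) //.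
set bad := [set C in U | _]%SET in badU.
(* A constant times M^(d^2-2) pays for n^(1/6); the remaining factor M pays for log n and that
   constant. *)
have tM : t <= (2 ^ (M ^ (d'.+1 * d'.+1).-1))%N%:R.
  apply: root_log_bound n_gt0 nN nL _.
  have -> : ((d'.+1 * d'.+1).-1 = (d'.+1 * d'.+1 - 2).+1)%N by nia.
  by rewrite mulnAC expnS leq_mul2r NL orbT.
(* If every member of a class has enough good components, shifting them already gives [t]
   automorphisms. *)
have badE : [set C in U | ~~ E C]%SET \subset bad.
  apply/fintype.subsetP => C; rewrite !inE => /andP[-> /=]; apply: contraR => nbad.
  apply/forall_inP => G GC; apply: le_trans tM _; rewrite ler_nat.
  apply: leq_trans (card_graph_aut G (ltn0Sn d') r2); rewrite leq_exp2l // leqNgt.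
  by apply: contra nbad => lt_good; apply/exists_inP; exists G.
have cU : #|U| = (#|[set C in U | E C]%SET| + #|[set C in U | ~~ E C]%SET|)%N.
  rewrite -(cardsID [set C | E C]%SET U); congr (_ + _)%N; apply: eq_card => C; rewrite !inE //.
  by rewrite andbC.
have U0' : (0 : R) < #|U|%:R by rewrite ltr0n.
have -> : 1 - #|[set C in U | E C]%SET|%:R / #|U|%:R = #|[set C in U | ~~ E C]%SET|%:R /
  #|U|%:R :> R.
  by apply: (mulIf (lt0r_neq0 U0'));
    rewrite mulrBl !divfK ?lt0r_neq0 // mul1r {1}cU natrD addrAC subrr add0r.
rewrite ger0_norm ?divr_ge0 ?ler0n //; apply: le_trans epsk.
rewrite ler_pdivrMr // ler_pdivlMl ?ltr0n ?expn_gt0 // -natrM ler_nat mulnC.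
by apply: leq_trans badU; rewrite leq_mul2r subset_leq_card ?orbT.
Unshelve. all: by end_near.
Qed.
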